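(* Let $C_1,C_2\subset\mathbb P^3_{\mathbb C}$ be smooth curves meeting transversely at $p$, let $C_i\subset S_i$ with $S_i$ local smooth surfaces, and let $Z_1,Z_2$ be multiplicity structures with $Z_1=mC_1\subset S_1$ and $Z_2=nC_2\subset S_2$. Assume that $C_1$ meets $S_2$ transversely at $p$, that $C_2$ is tangent to $S_1$ at $p$ of order $q>1$, and that $Z=Z_1\cup Z_2$ has embedding dimension three at $p$. If $m\le q$, then the general surface $S$ containing $Z$ has a singularity of type $\mathbf A_{mn-1}$ at $p$, and $C_1$ (resp. $C_2$) maps to $1$ (resp. $mn-m$) under the isomorphism $\operatorname{Cl}\widehat{\mathcal O}_{S,p}\cong\mathbb Z/mn\mathbb Z$; that is, there is such an isomorphism for which these are the images.
   Context: A local smooth surface is a smooth surface defined in a neighbourhood of $p$ in $\mathbb P^3$. $Z_i=kC_i\subset S_i$ means that near $p$ the (locally Cohen-Macaulay) scheme $Z_i$ supported on $C_i$ is the effective Cartier divisor $kC_i$ on $S_i$. ''$C_2$ is tangent to $S_1$ of order $q$'' means that the scheme $C_2\cap S_1$ has length $q$ at $p$; $q=\infty$ is allowed and means $C_2\subset S_1$ near $p$. ''Meeting transversely'' for curves means having distinct tangent lines at $p$. ''General surface containing $Z$'' means a general member of $|H^0(\mathbb P^3,\mathcal I_Z(d))|$ for $d\gg0$. The embedding dimension of $Z$ at $p$ is the dimension of its Zariski tangent space. $S$ has an $\mathbf A_k$ singularity at $p$ if $\widehat{\mathcal O}_{S,p}\cong\mathbb C[[x,y,z]]/(xy-z^{k+1})$.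 The image of $C_i$ is taken under the natural map $\operatorname{Cl} S\to\operatorname{Cl}\mathcal O_{S,p}\hookrightarrow\operatorname{Cl}\widehat{\mathcal O}_{S,p}$, i.e. the class of the ideal of $C_i$ in $\widehat{\mathcal O}_{S,p}$. *)

(* Defs.v *)
(* Closed subschemes of P^3 over a field K are given by homogeneous ideals of
   K[x_0,..,x_3].  Distinct ideals may define the same subscheme; everything
   below depends on an ideal only through its stalks in the local rings of
   P^3, except for the sections of the twisted ideal sheaf, which are computed
   from the stalks as well.  A germ at p of a closed subscheme of a
   neighbourhood of p is an ideal of the local ring of P^3 at p.  As K is
   algebraically closed in the application, points are closed points, given by
   nonzero vectors of homogeneous coordinates. *)
From HB Require Import structures.
From mathcomp Require Import all_boot all_order all_algebra.
From mathcomp Require Import classical_sets boolp functions reals.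
From mathcomp Require Import mpoly freeg complex ring_quotient fraction.

Set Implicit Arguments.
Unset Strict Implicit.
Unset Printing Implicit Defensive.

Import GRing.Theory.
Local Open Scope ring_scope.
Local Open Scope classical_set_scope.

Section Ideals.
Variable A : comPzRingType.
Implicit Types (I P X : set A) (a b : A).

Definition is_ideal I :=
  [/\ I 0, (forall a b, I a -> I b -> I (a + b))
    & (forall a b, I b -> I (a * b))].

Definition gen_ideal X : set A :=
  [set a | forall I, is_ideal I -> X `<=` I -> I a].

Lemma gen_idealP X : is_ideal (gen_ideal X).
Proof.
split=> [I [] // | a b Xa Xb I idI XI | a b Xb I idI XI].
  by have [_ + _] := idI; apply; [exact: Xa | exact: Xb].
by have [_ _] := idI; apply; exact: Xb.
Qed.

Lemma sub_gen_ideal X : X `<=` gen_ideal X.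
Proof. by move=> a Xa I _; apply. Qed.

Lemma ideal_sub I a b : is_ideal I -> I a -> I b -> I (a - b).
Proof. by case=> _ ID IM Ia Ib; apply: ID; rewrite // -mulN1r; apply: IM. Qed.

Definition idpow X (n : nat) : set A :=
  gen_ideal [set a | exists s : seq A,
    [/\ size s = n, (forall x, x \in s -> X x) & a = \prod_(x <- s) x]].

Definition prime_ideal P :=
  [/\ is_ideal P, ~ P 1 & forall a b, P (a * b) -> P a \/ P b].

(* In a local ring this is the maximal ideal. *)
Definition maxideal : set A := [set a | ~ exists b, a * b = 1].

Definition prime_chain (Q : nat -> set A) (n : nat) :=
  (forall i, (i <= n)%N -> prime_ideal (Q i)) /\
  (forall i, (i < n)%N -> Q i `<` Q i.+1).

Definition krull_dim (n : nat) :=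
  (exists Q, prime_chain Q n) /\ ~ (exists Q, prime_chain Q n.+1).

Definition height P (n : nat) :=
  (exists2 Q, prime_chain Q n & Q n = P) /\
  ~ (exists2 Q, prime_chain Q n.+1 & Q n.+1 = P).

(* The next two notions are for a (Noetherian) local ring A. *)
Definition regular_local (d : nat) :=
  krull_dim d /\
  exists2 s : seq A, size s = d & maxideal = gen_ideal [set x | x \in s].

Definition regular_seq (s : seq A) :=
  forall i, (i < size s)%N -> forall a,
    gen_ideal [set x | x \in take i s] (a * s`_i) ->
    gen_ideal [set x | x \in take i s] a.

Definition cohen_macaulay := exists s : seq A,
  [/\ (forall x, x \in s -> maxideal x), regular_seq s & krull_dim (size s)].

(* Length of A as an A-module, through a composition series. *)
Definition has_length (n : nat) := exists I : nat -> set A,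
  [/\ I 0%N = [set 0], I n = setT, (forall i, (i <= n)%N -> is_ideal (I i))
    & forall i, (i < n)%N -> I i `<` I i.+1 /\
        forall J, is_ideal J -> I i `<=` J -> J `<=` I i.+1 ->
          J = I i \/ J = I i.+1].

End Ideals.

(* The quotient of A by the ideal generated by X.  ring_quotient only makes
   rings of quotients by proper ideals, so the ring structure is redone here
   on its underlying quotient group. *)
Section QuotientRing.
Variables (A : comPzRingType) (X : set A).

Definition gen_pred : pred A := fun a => `[< gen_ideal X a >].

Lemma gen_predP a : reflect (gen_ideal X a) (a \in gen_pred).
Proof. exact: asboolP. Qed.

Lemma gen_pred_zmod : zmod_closed gen_pred.
Proof.
split=> [|a b /gen_predP Xa /gen_predP Xb]; apply/gen_predP.
  by case: (gen_idealP X).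
exact: ideal_sub (gen_idealP X) Xa Xb.
Qed.

HB.instance Definition _ := GRing.isZmodClosed.Build A gen_pred gen_pred_zmod.

Definition gen_zmod : zmodClosed A := GRing.ZmodClosed.clone A gen_pred _.

Definition quotring := Quotient.quot gen_zmod.

HB.instance Definition _ := GRing.Zmodule.on quotring.

Definition quot_pi (a : A) : quotring := (\pi_(Quotient.quot gen_zmod) a)%qT.

Definition quot_mul (x y : quotring) : quotring :=
  quot_pi (repr x * repr y).

Lemma quot_piE a b : quot_pi a = quot_pi b <-> gen_ideal X (a - b).
Proof.
split=> [/eqP | Xab]; first by rewrite -Quotient.idealrBE => /gen_predP.
by apply/eqP; rewrite -Quotient.idealrBE; apply/gen_predP.
Qed.

Lemma quot_piK (x : quotring) : quot_pi (repr x) = x.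
Proof. exact: reprK. Qed.

Lemma quot_piD a b : quot_pi (a + b) = quot_pi a + quot_pi b.
Proof. exact: Quotient.pi_add. Qed.

Lemma quot_piM a b : quot_pi (a * b) = quot_mul (quot_pi a) (quot_pi b).
Proof.
have [_ ID IM] := gen_idealP X.
have [Xa Xb] : gen_ideal X (a - repr (quot_pi a)) /\
               gen_ideal X (b - repr (quot_pi b)).
  by split; apply/quot_piE; rewrite quot_piK.
apply/quot_piE; set a' := repr _ in Xa *; set b' := repr _ in Xb *.
have -> : a * b - a' * b' = b * (a - a') + a' * (b - b').
  by rewrite !mulrBr addrA [b * a]mulrC [b * a']mulrC subrK.
by apply: ID; apply: IM.
Qed.

Fact quot_mulA : associative quot_mul.
Proof.
move=> x y z; rewrite -[x]quot_piK -[y]quot_piK -[z]quot_piK.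
by rewrite -!quot_piM mulrA.
Qed.

Fact quot_mulC : commutative quot_mul.
Proof.
by move=> x y; rewrite -[x]quot_piK -[y]quot_piK -!quot_piM mulrC.
Qed.

Fact quot_mul1 : left_id (quot_pi 1) quot_mul.
Proof. by move=> x; rewrite -[x]quot_piK -quot_piM mul1r. Qed.

Fact quot_mulDl : left_distributive quot_mul +%R.
Proof.
move=> x y z; rewrite -[x]quot_piK -[y]quot_piK -[z]quot_piK.
by rewrite -quot_piD -!quot_piM mulrDl quot_piD.
Qed.

HB.instance Definition _ := GRing.Zmodule_isComPzRing.Build quotring
  quot_mulA quot_mulC quot_mul1 quot_mulDl.

End QuotientRing.

(* The completion of A along the ideal J: sequences u with
   u_(n+1) = u_n mod J^n for all n, modulo those with u_n in J^n for all n,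
   i.e. the inverse limit of the rings A / J^n. *)
Section Completion.
Variables (A : comPzRingType) (J : set A).

Definition coherent : pred (nat -> A) :=
  fun u => `[< forall n, idpow J n (u n.+1 - u n) >].

Lemma coherentP u :
  reflect (forall n, idpow J n (u n.+1 - u n)) (u \in coherent).
Proof. exact: asboolP. Qed.

Lemma coherent_subring : subring_closed coherent.
Proof.
split=> [|u v /coherentP cu /coherentP cv|u v /coherentP cu /coherentP cv];
    apply/coherentP => n; have idJ := gen_idealP
      [set a | exists s : seq A,
        [/\ size s = n, (forall x, x \in s -> J x) & a = \prod_(x <- s) x]].
- by rewrite subrr; case: idJ.
- have E (a b c d : A) : a - b - (c - d) = (a - c) - (b - d).
    by rewrite opprD addrACA -opprD.
  by rewrite [X in idpow _ _ X]E; apply: (ideal_sub idJ); [exact: cu | exact: cv].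
have [_ ID IM] := idJ.
have E (a b c d : A) : a * b - c * d = a * (b - d) + d * (a - c).
  by rewrite !mulrBr addrA [d * a]mulrC subrK [d * c]mulrC.
rewrite [X in idpow _ _ X]E.
by apply: ID; apply: IM; [exact: cv | exact: cu].
Qed.

HB.instance Definition _ :=
  GRing.isSubringClosed.Build (nat -> A) coherent coherent_subring.

Record cohseq := CohSeq { cohseq_val : nat -> A; _ : cohseq_val \in coherent }.

HB.instance Definition _ := [isSub for cohseq_val].
HB.instance Definition _ := Choice.copy cohseq (sub_type cohseq).
HB.instance Definition _ :=
  GRing.SubChoice_isSubComPzRing.Build _ _ cohseq (GRing.subringClosedP _).

Definition completion :=
  quotring [set u : cohseq | forall n, idpow J n (cohseq_val u n)].

HB.instance Definition _ := GRing.ComPzRing.on completion.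

Lemma coherent_cst (a : A) : (fun=> a) \in coherent.
Proof.
by apply/coherentP => n; rewrite subrr; case: (gen_idealP _ : is_ideal (idpow J n)).
Qed.

Definition to_completion (a : A) : completion :=
  quot_pi _ (CohSeq (coherent_cst a)).

End Completion.

(* Formal power series in n variables: families of coefficients, with the
   Cauchy product. *)
Section PowerSeries.
Variables (n : nat) (K : comNzRingType).

Definition fps : Type := 'X_{1..n} -> K.

HB.instance Definition _ := GRing.Zmodule.copy fps ('X_{1..n} -> K).

Implicit Types f g h : fps.

Definition fps_mul f g : fps := fun m =>
  \sum_(k : 'X_{1..n < (mdeg m).+1, (mdeg m).+1} | m == (k.1 + k.2)%MM)
    f k.1 * g k.2.

Definition fps_of_mpoly (p : {mpoly K[n]}) : fps := fun m => p@_m.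

Let trunc (d : nat) f : {mpoly K[n]} := \sum_(m : 'X_{1..n < d}) f m *: 'X_[m].

Let fps_mulE d f g m : (mdeg m < d)%N ->
  fps_mul f g m = (trunc d f * trunc d g)@_m.
Proof.
move=> md; rewrite (mcoeff_poly_mul _ _ (ltnSn (mdeg m))).
apply: eq_bigr => -[[/= k1 lt1] [/= k2 lt2]] _.
by rewrite !mcoeff_mpoly //; apply: leq_trans md.
Qed.

Let trunc_mul d (p q p' q' : {mpoly K[n]}) m : (mdeg m < d)%N ->
  (forall k, (mdeg k < d)%N -> p@_k = p'@_k) ->
  (forall k, (mdeg k < d)%N -> q@_k = q'@_k) ->
  (p * q)@_m = (p' * q')@_m.
Proof.
move=> md pp' qq'; rewrite !(mcoeff_poly_mul _ _ (ltnSn (mdeg m))).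
apply: eq_bigr => -[[/= k1 lt1] [/= k2 lt2]] _.
by rewrite pp' ?qq' //; apply: leq_trans md.
Qed.

Let coeff_trunc d f k : (mdeg k < d)%N -> (trunc d f)@_k = f k.
Proof. exact: mcoeff_mpoly. Qed.

Fact fps_mulA : associative fps_mul.
Proof.
move=> f g h; apply/funext => m; set d := (mdeg m).+1.
have md : (mdeg m < d)%N by [].
rewrite !(fps_mulE _ _ md).
transitivity ((trunc d f * (trunc d g * trunc d h))@_m).
  by apply: (trunc_mul md) => // k kd; rewrite coeff_trunc // (fps_mulE _ _ kd).
rewrite mulrA.
by apply: (trunc_mul md) => // k kd; rewrite coeff_trunc // (fps_mulE _ _ kd).
Qed.

Fact fps_mulC : commutative fps_mul.
Proof.
by move=> f g; apply/funext => m; rewrite !(fps_mulE _ _ (ltnSn _)) mulrC.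
Qed.

Fact fps_mul1 : left_id (fps_of_mpoly 1) fps_mul.
Proof.
move=> f; apply/funext => m; have md := ltnSn (mdeg m).
rewrite (fps_mulE _ _ md) -[RHS](coeff_trunc _ md) -[X in _ = X@_m]mul1r.
by apply: (trunc_mul md) => // k kd; rewrite coeff_trunc.
Qed.

Fact fps_mulDl : left_distributive fps_mul +%R.
Proof.
move=> f g h; apply/funext => m; have md := ltnSn (mdeg m).
transitivity (fps_mul f h m + fps_mul g h m); last by [].
rewrite !(fps_mulE _ _ md) -mcoeffD -mulrDl.
by apply: (trunc_mul md) => // k kd; rewrite mcoeffD !coeff_trunc.
Qed.

Fact fps_nonzero1 : fps_of_mpoly 1 != 0.
Proof.
apply/eqP => /(congr1 (fun f : fps => f 0%MM)).
rewrite /fps_of_mpoly mcoeff1 eqxx => /eqP.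
by rewrite [X in _ == X](_ : _ = 0 :> K) // oner_eq0.
Qed.

HB.instance Definition _ := GRing.Zmodule_isComNzRing.Build fps
  fps_mulA fps_mulC fps_mul1 fps_mulDl fps_nonzero1.

End PowerSeries.

(* Weil divisor class group of a Noetherian normal domain A. *)
Section ClassGroup.
Variable A : comPzRingType.

Definition height1 := {P : set A | `[< prime_ideal P /\ height P 1 >]}.

(* The elements of A lying in P^k A_P. *)
Definition sympow (P : set A) (k : nat) : set A :=
  [set a | exists2 s, ~ P s & idpow P k (s * a)].

(* The valuation of the discrete valuation ring A_P, on nonzero elements
   of A. *)
Definition val_at (P : set A) (a : A) : nat :=
  xget 0%N [set k | sympow P k a /\ ~ sympow P k.+1 a].

Definition weil_div := {freeg height1 / int}.

HB.instance Definition _ := GRing.Zmodule.on weil_div.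

Definition is_div_of (D : weil_div) (a : A) :=
  forall P : height1, coeff P D = (val_at (val P) a)%:Z.

(* The subgroup generated by the divisors of the nonzero elements. *)
Definition principal_div : set weil_div :=
  [set D | forall H : set weil_div,
     H 0 -> (forall D1 D2, H D1 -> H D2 -> H (D1 - D2)) ->
     (forall a D1, a <> 0 -> is_div_of D1 a -> H D1) -> H D].

Definition principal_pred : pred weil_div := fun D => `[< principal_div D >].

Lemma principal_zmod : zmod_closed principal_pred.
Proof.
split=> [|D1 D2 /asboolP p1 /asboolP p2]; apply/asboolP => H H0 HB Hdiv //.
by apply: (HB); [exact: p1 | exact: p2].
Qed.

HB.instance Definition _ :=
  GRing.isZmodClosed.Build weil_div principal_pred principal_zmod.

Definition principal_group : zmodClosed weil_div :=
  GRing.ZmodClosed.clone weil_div principal_pred _.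

Definition Cl := Quotient.quot principal_group.

HB.instance Definition _ := GRing.Zmodule.on Cl.

Definition prime_class (P : height1) : Cl :=
  (\pi_(Quotient.quot principal_group) (<< P >> : weil_div))%qT.

End ClassGroup.

Section Basis.
Variables (K : fieldType) (U : lmodType K).

Definition lincomb (N : nat) (b : 'I_N -> U) (c : 'I_N -> K) : U :=
  \sum_(i < N) c i *: b i.

Definition is_basis (V : set U) (N : nat) (b : 'I_N -> U) :=
  (forall c, V (lincomb b c)) /\
  (forall u, V u -> exists! c, u = lincomb b c).

Definition has_dim (V : set U) (N : nat) := exists b : 'I_N -> U, is_basis V b.

End Basis.

Section ProjectiveSpace.
Variable K : fieldType.

Notation S := {mpoly K[4]}.
Notation point := ('I_4 -> K).

Definition homog_ideal (I : set S) :=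
  is_ideal I /\ forall d F, I F -> I (pihomog mdeg d F).

Definition on_scheme (I : set S) (x : point) :=
  forall d F, F \is d.-homog -> I F -> F.@[x] = 0.

Section LocalRing.
Variable x : point.

Definition local_pred : pred {fraction S} := fun f =>
  `[< exists d (F G : S), [/\ F \is d.-homog, G \is d.-homog, G.@[x] != 0
      & f = tofrac F / tofrac G] >].

Lemma local_pred_subring : subring_closed local_pred.
Proof.
have nz (G : S) : G.@[x] != 0 -> tofrac G != 0.
  by apply: contraNneq => /eqP; rewrite tofrac_eq0 => /eqP ->; rewrite meval0.
split=> [|f g /asboolP[d [F [G [Fd Gd Gx ->]]]] /asboolP[e [F' [G' [Fe Ge Gx' ->]]]]
  |f g /asboolP[d [F [G [Fd Gd Gx ->]]]] /asboolP[e [F' [G' [Fe Ge Gx' ->]]]]];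
  apply/asboolP.
- exists 0%N, 1, 1; split; rewrite ?dhomog1 ?meval1 ?oner_neq0 //.
  by rewrite tofrac1 divr1.
- exists (d + e)%N, (F * G' - F' * G), (G * G').
  split.
  + by apply: rpredB; [|rewrite addnC]; apply: dhomogM.
  + exact: dhomogM.
  + by rewrite mevalM mulf_neq0.
  + by rewrite -mulNr addf_div ?nz // mulNr -!tofracM -tofracB.
exists (d + e)%N, (F * F'), (G * G'); split; try exact: dhomogM.
  by rewrite mevalM mulf_neq0.
by rewrite mulf_div -!tofracM.
Qed.

HB.instance Definition _ :=
  GRing.isSubringClosed.Build {fraction S} local_pred local_pred_subring.

(* The local ring of P^3 at x: fractions of forms of the same degree, with
   denominator nonzero at x. *)
Record localP3 := LocalP3 {
  localP3_val : {fraction S};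
  _ : localP3_val \in local_pred }.

HB.instance Definition _ := [isSub for localP3_val].
HB.instance Definition _ := Choice.copy localP3 (sub_type localP3).
HB.instance Definition _ :=
  GRing.SubChoice_isSubComNzRing.Build _ _ localP3 (GRing.subringClosedP _).

Lemma local_cst (c : K) : tofrac (c%:MP : S) \in local_pred.
Proof.
apply/asboolP; exists 0%N, c%:MP, 1; rewrite meval1 oner_neq0 tofrac1 divr1.
by split; rewrite ?dhomog1 // -[c%:MP]mulr1 mul_mpolyC rpredZ // dhomog1.
Qed.

Definition cstP3 (c : K) : localP3 := LocalP3 (local_cst c).

Definition stalk (I : set S) : set localP3 :=
  [set f | exists d F G, [/\ F \is d.-homog, G \is d.-homog, G.@[x] != 0, I F
     & localP3_val f = tofrac F / tofrac G]].

(* The Zariski tangent space at x of the germ defined by J, inside the one of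
   P^3: linear forms on m/m^2 vanishing on J, where m is the maximal ideal;
   they are extended by 0 from m to the local ring, which is the direct sum of
   K and m. *)
Definition tangent (J : set localP3) : set (localP3 -> K^o) :=
  [set D | [/\ (forall f g, D (f + g) = D f + D g),
               (forall c f, D (cstP3 c * f) = c *: D f),
               D 1 = 0,
               (forall f g, maxideal f -> maxideal g -> D (f * g) = 0)
             & (forall f, J f -> D f = 0)]].

Definition smooth_surface_germ (J : set localP3) :=
  is_ideal J /\ regular_local (quotring J) 2.

(* With C a curve on the smooth surface germ S, both given by their ideals at
   x, Z is the effective Cartier divisor kC on S. *)
Definition cartier_multiple (k : nat) (S C Z : set localP3) :=
  exists2 g, C = gen_ideal (S `|` [set g]) & Z = gen_ideal (S `|` [set g ^+ k]).

(* The curve C and the surface S meet transversely at x. *)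
Definition transverse (C S : set localP3) :=
  forall D, tangent set0 D ->
    exists D1 D2, [/\ tangent C D1, tangent S D2 & D = D1 + D2].

(* None stands for infinity. *)
Definition tangency_order (C S : set localP3) (q : option nat) :=
  if q is Some q' then has_length (quotring (C `|` S)) q' else S `<=` C.

End LocalRing.

Arguments stalk : clear implicits.

(* The local ring at x of the closed subscheme defined by I. *)
Definition local_ring (I : set S) (x : point) := quotring (stalk x I).

Definition complete_local_ring (I : set S) (x : point) :=
  completion (@maxideal (local_ring I x)).


Definition to_complete I x (f : localP3 x) : complete_local_ring I x :=
  to_completion (@maxideal (local_ring I x)) (quot_pi (stalk x I) f).

(* The ideal in the completed local ring at x of the subscheme of I defined
   by J. *)
Definition complete_ideal (I J : set S) (x : point) :
    set (complete_local_ring I x) :=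
  gen_ideal (@to_complete I x @` stalk x J).

Definition smooth_curve (I : set S) :=
  homog_ideal I /\
  forall x : point, x != 0 -> on_scheme I x -> regular_local (local_ring I x) 1.

Definition multiplicity_structure (I J : set S) :=
  homog_ideal J /\
  forall x : point, x != 0 ->
    (on_scheme J x <-> on_scheme I x) /\
    (on_scheme J x -> cohen_macaulay (local_ring J x)).

(* H^0(P^3, I_Z(d)), for Z defined by I. *)
Definition sections (I : set S) (d : nat) : set S :=
  [set F | F \is d.-homog /\
     forall (x : point) (G : S) (f : localP3 x), x != 0 -> G \is d.-homog ->
       G.@[x] != 0 -> localP3_val f = tofrac F / tofrac G -> stalk x I f].

(* The general member of the linear system |V| satisfies Q: in homogeneous
   coordinates c, Q holds on a nonempty open set given by G != 0. *)
Definition general_member (V : set S) (Q : S -> Prop) :=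
  exists N (b : 'I_N -> S) e (G : {mpoly K[N]}),
    [/\ is_basis V b, G \is e.-homog,
        (exists2 c : 'I_N -> K, c != 0 & G.@[c] != 0)
      & forall c : 'I_N -> K, c != 0 -> G.@[c] != 0 -> Q (lincomb b c)].

Definition hypersurface (F : S) : set S := gen_ideal [set F].

(* K[[x,y,z]] / (xy - z^(k+1)) *)
Definition A_ring (k : nat) := quotring
  [set fps_of_mpoly
    ('X_(inord 0) * 'X_(inord 1) - 'X_(inord 2) ^+ k.+1 : {mpoly K[3]})].

(* The completed local ring of I at x is isomorphic, as a K-algebra, to
   K[[x,y,z]] / (xy - z^(k+1)). *)
Definition sing_type_A (I : set S) (x : point) (k : nat) :=
  exists2 phi : {rmorphism complete_local_ring I x -> A_ring k},
    bijective phi &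
    forall c : K,
      phi (to_complete I (cstP3 x c)) = quot_pi _ (fps_of_mpoly c%:MP).

(* There is an isomorphism from Cl, for the completed local ring of I at x, to
   Z/N mapping the classes of the ideals of C1 and C2 to k1 and k2; here
   'I_N.-1.+1 is the additive group Z/N for every N > 0. *)
Definition class_group_is (I : set S) (x : point) (C1 C2 : set S)
    (N k1 k2 : nat) :=
  exists2 phi : {additive Cl (complete_local_ring I x) -> 'I_N.-1.+1},
    bijective phi &
    exists P1 P2 : height1 (complete_local_ring I x),
      [/\ val P1 = @complete_ideal I C1 x, val P2 = @complete_ideal I C2 x,
          phi (prime_class P1) = inZp k1 & phi (prime_class P2) = inZp k2].

End ProjectiveSpace.

Arguments stalk {K} x I _.

(* k <= q, for q a natural number or infinity (None). *)
Definition leq_inf (k : nat) (q : option nat) : bool :=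
  if q is Some q' then (k <= q')%N else true.

(* Main.v *)
Require Import Defs.
From HB Require Import structures.
From mathcomp Require Import all_boot all_order all_algebra.
From mathcomp Require Import classical_sets boolp functions reals.
From mathcomp Require Import mpoly freeg complex ring_quotient fraction generic_quotient.
From mathcomp Require Import zify ring.
Set Implicit Arguments.
Unset Strict Implicit.
Unset Printing Implicit Defensive.

Import Order.TTheory GRing.Theory.
Local Open Scope ring_scope.
Local Open Scope classical_set_scope.

(** Near p there are regular parameters x, y, z in which everything is monomial:
    C_1 = (x, y), C_2 = (y, z), m C_1 = (y, x^m) and n C_2 = (z, y^n).  Here z is an
    equation of S_2, which is transverse to C_1, and y is an equation f_1 of S_1
    corrected by a multiple of x^M with M = max(m, 2).  As C_2 touches S_1 to order
    at least M, the correction can be chosen so that y vanishes on C_2, and because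
    of M >= m it changes neither C_1 nor m C_1 ([normal_form]).  The ideal of Z is
    then generated by y z, y^n and x^m z ([monomial_inter]), and n is at least 2,
    since y would otherwise be an equation of Z of order one ([tangent_dim_lt3]).

    A surface of degree d containing Z has a germ al y z + be y^n + ga x^m z.  The
    values of al, be and ga at p are Taylor coefficients of the germ, hence linear
    forms on the space of sections; for large d no one of them vanishes, because
    y z + y^n + x^m z is itself the germ of a section up to a unit.  So al, be and
    ga are units for the general surface ([general_member_functionals]).  Since
    y' = al y + ga x^m divides (al y)^n - (- ga x^m)^n, the term be y^n is a multiple
    of y' plus a unit times x^(m n), and up to a unit the equation becomes
    X Y = x^(m n), with X equal to y' up to a unit ([complete_product],
    [type_A_coordinates]).  This is the singularity A_(m n - 1).

    Put N = m n.  Through X = s^N, Y = t^N, Z = s t the complete local ring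
    K[[X,Y,Z]] / (X Y - Z^N) is the ring of the power series in s and t of weight
    zero, where s and t have the weights 1 and -1 modulo N ([subst_toric_ker],
    [subst_toric_image]).  Its height one primes are cut out by homogeneous prime
    elements of K[[s,t]] ([prime_contract]), and a divisor is principal exactly if
    the weights of the elements belonging to its components add up to zero, so that
    the weight identifies the class group with Z/N ([Cl_weight_bij]).  The engine
    is that an ideal of K[[s,t]] saturated with respect to s is principal
    ([saturated_principal]).  The ideal (X, Z) of C_1 is cut out by s, of weight 1.
    Substituting the parametrisation in y gives s^m times a series prime to s, and
    y generates the ideal of C_2 generically along C_2, so that m C_1 + C_2 is
    principal and C_2 has the class - m ([second_class]).

    Local algebra enters in two ways.  Germs have Taylor expansions in arbitrary
    parameters ([taylor]), and by Krull's theorem membership in an ideal can be read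
    off from them ([closed_ideal], [taylor_mem]).  Chains of primes are bounded
    through algebraic dependence ([prime_chain_bound]), which makes the ideal of a
    smooth surface germ principal ([smooth_surface]). *)

(** * Formal power series *)

Section Series.
Variables (n : nat) (K : comNzRingType).
Implicit Types (f g h : fps n K) (m k : 'X_{1..n}) (p q : {mpoly K[n]}).

Definition trunc (d : nat) f : {mpoly K[n]} := \sum_(m : 'X_{1..n < d}) f m *: 'X_[m].

Lemma coeff_trunc d f m : (trunc d f)@_m = if (mdeg m < d)%N then f m else 0.
Proof.
case: ifPn => [|/negbTE md]; first exact: mcoeff_mpoly.
rewrite /trunc raddf_sum big1 //= => -[k kd] _ /=; rewrite mcoeffZ mcoeffX.
by case: eqP => [km|]; rewrite ?mulr0 //; rewrite -km kd in md.
Qed.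

Lemma fpsP f g : (forall m, f m = g m) <-> f = g.
Proof. by split=> [/funext|->]. Qed.

Lemma fpsD f g m : (f + g) m = f m + g m. Proof. by []. Qed.
Lemma fpsN f m : (- f) m = - f m. Proof. by []. Qed.
Lemma fpsB f g m : (f - g) m = f m - g m. Proof. by []. Qed.
Lemma fps0 m : (0 : fps n K) m = 0. Proof. by []. Qed.
Lemma fps_sum (I : Type) (r : seq I) (P : pred I) (F : I -> fps n K) m :
  (\sum_(i <- r | P i) F i) m = \sum_(i <- r | P i) F i m.
Proof. by elim/big_ind2: _ => // f1 f2 g1 g2 <- <-. Qed.
Lemma fps1 m : (1 : fps n K) m = (m == 0%MM)%:R.
Proof. exact: mcoeff1. Qed.

Lemma fpsM_trunc d f g m : (mdeg m < d)%N -> (f * g) m = (trunc d f * trunc d g)@_m.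
Proof.
move=> md; rewrite (mcoeff_poly_mul _ _ (ltnSn (mdeg m))).
apply: eq_bigr => -[[/= k1 lt1] [/= k2 lt2]] _.
by rewrite !coeff_trunc !(leq_trans _ md).
Qed.

Lemma fpsM_sum d f g m : (mdeg m < d)%N ->
  (f * g) m = \sum_(k : 'X_{1..n < d} | (k <= m)%MM) f k * g (m - k)%MM.
Proof.
move=> md; rewrite (fpsM_trunc f g md) (mcoeff_poly_mul_lin _ _ md).
apply: eq_bigr => -[/= k kd] km; rewrite !coeff_trunc kd.
by rewrite (leq_ltn_trans (mdegB _ _) md).
Qed.

Lemma fpsM_pairs d f g m : (mdeg m < d)%N ->
  (f * g) m = \sum_(k : 'X_{1..n < d, d} | m == (k.1 + k.2)%MM) f k.1 * g k.2.
Proof.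
move=> md; rewrite (fpsM_trunc f g md) (mcoeff_poly_mul _ _ md).
by apply: eq_bigr => -[[/= k1 lt1] [/= k2 lt2]] _; rewrite !coeff_trunc lt1 lt2.
Qed.

Fact fps_of_mpoly_additive : zmod_morphism (@fps_of_mpoly n K).
Proof. by move=> p q; apply/fpsP => m; rewrite /fps_of_mpoly mcoeffB. Qed.

Fact fps_of_mpoly_multiplicative : monoid_morphism (@fps_of_mpoly n K).
Proof.
split=> // p q; apply/fpsP => m; rewrite (fpsM_pairs _ _ (ltnSn (mdeg m))).
exact: mcoeff_poly_mul.
Qed.

HB.instance Definition _ := GRing.isZmodMorphism.Build _ _ _ fps_of_mpoly_additive.
HB.instance Definition _ := GRing.isMonoidMorphism.Build _ _ _ fps_of_mpoly_multiplicative.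

Definition mono k : fps n K := fps_of_mpoly 'X_[k].

Lemma monoE k m : mono k m = (k == m)%:R.
Proof. exact: mcoeffX. Qed.

Lemma monoM k f m : (mono k * f) m = if (k <= m)%MM then f (m - k)%MM else 0.
Proof.
rewrite (fpsM_sum _ _ (ltnSn (mdeg m))); case: ifP => [km|km].
  have kd : (mdeg k < (mdeg m).+1)%N by rewrite ltnS -(submK km) mdegD leq_addl.
  rewrite (bigD1 (BMultinom kd)) //= monoE eqxx mul1r big1 ?addr0 // => -[/= l ld].
  by rewrite -val_eqE /= => /andP[_ /negbTE lk]; rewrite monoE eq_sym lk mul0r.
rewrite big1 // => -[/= l ld] lm; rewrite monoE.
by case: eqP lm => [<-|]; rewrite ?km // mul0r.
Qed.

Lemma monoD k l : mono (k + l) = mono k * mono l.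
Proof. by rewrite /mono mpolyXD rmorphM. Qed.

Lemma mono0 : mono 0%MM = 1. Proof. by rewrite /mono mpolyX0 rmorph1. Qed.

Lemma mono_exp k i : mono k ^+ i = mono (k *+ i)%MM.
Proof. by rewrite /mono -mpolyXn rmorphXn. Qed.

Definition cst (c : K) : fps n K := fps_of_mpoly c%:MP.

Lemma cstM c f m : (cst c * f) m = c * f m.
Proof.
rewrite (fpsM_trunc _ _ (ltnSn (mdeg m))) (_ : trunc _ _ = c%:MP).
  by rewrite mcoeffCM coeff_trunc ltnSn.
apply/mpolyP => l; rewrite coeff_trunc /cst /fps_of_mpoly mcoeffC.
by case: ifP => //; case: eqP => [->|]; rewrite ?mdeg0 // mulr0.
Qed.

(** The filtration by the powers of the maximal ideal. *)
Definition ordge (d : nat) f := forall m, (mdeg m < d)%N -> f m = 0.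

Lemma ordgeD d f g : ordge d f -> ordge d g -> ordge d (f + g).
Proof. by move=> of_ og m md; rewrite fpsD of_ // og // addr0. Qed.
Lemma ordgeN d f : ordge d f -> ordge d (- f).
Proof. by move=> of_ m md; rewrite fpsN of_ // oppr0. Qed.
Lemma ordgeB d f g : ordge d f -> ordge d g -> ordge d (f - g).
Proof. by move=> of_ og; apply: ordgeD => //; apply: ordgeN. Qed.
Lemma ordgeM d e f g : ordge d f -> ordge e g -> ordge (d + e) (f * g).
Proof.
move=> of_ og m md; rewrite (fpsM_sum _ _ (ltnSn (mdeg m))) big1 // => -[/= k kd] km.
have [lt|ge] := ltnP (mdeg k) d; first by rewrite of_ ?mul0r.
rewrite og ?mulr0 //; move: md; rewrite -{1}(submK km) mdegD; lia.
Qed.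
Lemma ordgeMl d f g : ordge d g -> ordge d (f * g).
Proof. by move=> og; rewrite -[d]add0n; apply: ordgeM. Qed.
Lemma ordgeX d f : f 0%MM = 0 -> ordge d (f ^+ d).
Proof.
move=> f0; elim: d => [m|d IH]; first by [].
rewrite exprS -add1n; apply: ordgeM => // m; rewrite ltnS leqn0 mdeg_eq0.
by move/eqP ->.
Qed.
Lemma ordge_eq0 f : (forall d, ordge d f) -> f = 0.
Proof. by move=> fd; apply/fpsP => m; apply: (fd (mdeg m).+1). Qed.
Lemma ordge_trunc d f : ordge d (f - fps_of_mpoly (trunc d f)).
Proof. by move=> m md; rewrite fpsB /fps_of_mpoly coeff_trunc md subrr. Qed.

Lemma fpsM0 f g : (f * g) 0%MM = f 0%MM * g 0%MM.
Proof.
have d0 : (mdeg (0%MM : 'X_{1..n}) < 1)%N by rewrite mdeg0.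
rewrite (fpsM_sum _ _ d0) (bigD1 (BMultinom d0)) ?lepm_refl //= sub0m big1 ?addr0 //.
move=> -[/= k kd]; rewrite -val_eqE /= => /andP[_]; rewrite -mdeg_eq0.
by move: kd; rewrite ltnS leqn0 => ->.
Qed.

(** Completeness for the order filtration: every coefficient of the partial sums
    is eventually constant. *)
Lemma series_lim (c : nat -> fps n K) : (forall i, ordge i (c i)) ->
  exists a, forall d, ordge d (a - \sum_(i < d) c i).
Proof.
move=> oc; pose G d := \sum_(i < d) c i.
exists (fun m => G (mdeg m).+1 m) => d m md; rewrite fpsB.
have [e ->] : exists e, d = ((mdeg m).+1 + e)%N by exists (d - (mdeg m).+1)%N; lia.
elim: e => [|e IH]; first by rewrite addn0 subrr.
rewrite addnS big_ord_recr /= fpsD opprD addrA IH sub0r oc ?oppr0 //; lia.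
Qed.

End Series.

Section SeriesDomain.
Variables (n : nat) (K : idomainType).
Implicit Types (f g : fps n K).

Lemma wf_min (P : set 'X_{1..n}) m : P m ->
  exists2 k, P k & forall l, (l < k)%O -> ~ P l.
Proof.
elim/(well_founded_ind (@ltom_wf n)): m => m IH Pm.
have [[l lm Pl]|no] := pselect (exists2 l, (l < m)%O & P l); first exact: IH Pl.
by exists m => // l lm Pl; apply: no; exists l.
Qed.

(** The least monomials of f and g, for a monomial order, multiply to a monomial
    which no other pair of monomials produces. *)
Lemma fps_mulf_eq0 f g : f * g = 0 -> f = 0 \/ g = 0.
Proof.
move=> fg0; have [->|f0] := pselect (f = 0); [by left|].
have [->|g0] := pselect (g = 0); [by right|].
have nz (h : fps n K) : h <> 0 -> exists2 k, h k != 0 & forall l, (l < k)%O -> h l = 0.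
  move=> h0; have [m hm] : exists m, h m != 0.
    apply: contrapT => h_; apply: h0; apply/fpsP => m.
    by apply/eqP; apply/negPn/negP => hm; apply: h_; exists m.
  have [k hk kmin] := @wf_min (fun m => h m != 0) m hm.
  by exists k => // l /kmin /negP; rewrite negbK => /eqP.
have [a fa amin] := nz f f0; have [b gb bmin] := nz g g0.
have := congr1 (fun h : fps n K => h (a + b)%MM) fg0.
have ad : (mdeg a < (mdeg (a + b)%MM).+1)%N by rewrite ltnS mdegD leq_addr.
rewrite (fpsM_sum _ _ (ltnSn _)) (bigD1 (BMultinom ad)) ?lem_addr //=.
rewrite [(a + b - a)%MM](_ : _ = b) 1?addmC ?addmK // big1 ?addr0 => [|[/= k kd]].
  by move=> /eqP; rewrite mulf_eq0 (negbTE fa) (negbTE gb).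
rewrite -val_eqE /= => /andP[kab ka].
case: (ltgtP k a) ka => // [lt _|gt _]; first by rewrite amin ?mul0r.
rewrite bmin ?mulr0 //; rewrite -(ltmc_add2r k) addmC submK // addmC.
by rewrite addmC ltmc_add2l.
Qed.

Lemma fps_mulfI f : f <> 0 -> injective ( *%R f).
Proof.
move=> f0 g h /eqP; rewrite -subr_eq0 -mulrBr => /eqP /fps_mulf_eq0[//|].
by move=> /eqP; rewrite subr_eq0 => /eqP.
Qed.

End SeriesDomain.

Section SeriesUnit.
Variables (n : nat) (K : fieldType).
Implicit Types (f g : fps n K).

(** The inverse is a geometric series in 1 - f / f(0). *)
Lemma fps_unit f : f 0%MM != 0 -> exists g, f * g = 1.
Proof.
move=> f0; set c := (f 0%MM)^-1; pose u : fps n K := 1 - cst c * f.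
have u0 : u 0%MM = 0.
  by rewrite /u fpsB fps1 eqxx cstM /c mulVf // subrr.
pose G (d : nat) : fps n K := \sum_(i < d) u ^+ i.
have GE d : (1 - u) * G d = 1 - u ^+ d.
  by rewrite -opprB mulNr -subrX1 opprB.
have [g Gg] := series_lim (fun d => @ordgeX _ _ d u u0).
exists (cst c * g); rewrite mulrA [f * _]mulrC.
have -> : cst c * f = 1 - u by rewrite /u; ring.
apply/eqP; rewrite -subr_eq0; apply/eqP; apply: ordge_eq0 => d.
have -> : (1 - u) * g - 1 = (1 - u) * (g - G d) - u ^+ d.
  by rewrite mulrBr GE; ring.
by apply: ordgeB; [apply: ordgeMl | apply: ordgeX].
Qed.

End SeriesUnit.

(** * Monomial substitutions in power series *)

Section Pushforward.
Variables (n r : nat) (K : comNzRingType).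
Variable phi : 'X_{1..n} -> 'X_{1..r}.
Hypothesis phiD : forall a b, phi (a + b)%MM = (phi a + phi b)%MM.
Hypothesis phi_deg : forall a, (mdeg a <= mdeg (phi a))%N.
Implicit Types (V W : fps n K).

Lemma sum_bmnm_widen (G : nmodType) (P : pred 'X_{1..n}) (F : 'X_{1..n} -> G) e d :
  (e <= d)%N -> (forall k, P k -> (mdeg k < e)%N) ->
  \sum_(k : 'X_{1..n < d} | P k) F k = \sum_(k : 'X_{1..n < e} | P k) F k.
Proof.
move=> ed Pe; case: e ed Pe => [|e] ed Pe.
  by rewrite !big1 // => k /Pe.
pose h (k : 'X_{1..n < e.+1}) : 'X_{1..n < d} := BMultinom (leq_trans (bmdeg k) ed).
have z0 : (mdeg (0%MM : 'X_{1..n}) < e.+1)%N by rewrite mdeg0.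
pose h' (k : 'X_{1..n < d}) : 'X_{1..n < e.+1} := insubd (BMultinom z0) (val k).
rewrite (reindex_onto h h') /= => [|[k kd] /= Pk].
  apply: eq_bigl => -[k kd] /=; case: (P k) => //=.
  by apply/eqP/val_inj; rewrite /= val_insubd kd.
by apply: val_inj; rewrite /= val_insubd Pe.
Qed.

(** The substitution of 'X_[phi k] for 'X_[k]; the sums are finite because [phi]
    does not lower degrees. *)
Definition push V : fps r K := fun m =>
  \sum_(k : 'X_{1..n < (mdeg m).+1} | phi k == m) V k.

Lemma push_sum d V m : (mdeg m < d)%N ->
  push V m = \sum_(k : 'X_{1..n < d} | phi k == m) V k.
Proof.
move=> md; rewrite [RHS](@sum_bmnm_widen _ (fun k => phi k == m) V (mdeg m).+1) // => k /eqP <-.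
by rewrite ltnS phi_deg.
Qed.

Lemma phi0 : phi 0%MM = 0%MM.
Proof. by apply: (@addIm _ (phi 0%MM)); rewrite -phiD !add0m. Qed.

Lemma push_mono k : push (mono K k) = mono K (phi k).
Proof.
apply/fpsP => m; rewrite monoE /push; case: eqP => [km|km].
  have kd : (mdeg k < (mdeg m).+1)%N by rewrite -km ltnS phi_deg.
  rewrite (bigD1 (BMultinom kd)) /= ?km // monoE eqxx big1 ?addr0 // => -[/= l ld].
  by case/andP=> _; rewrite -val_eqE /= => /negbTE lk; rewrite monoE eq_sym lk.
rewrite big1 // => -[/= l ld] /eqP lm; rewrite monoE; case: eqP => // kl.
by rewrite kl in km.
Qed.

Fact push_additive : zmod_morphism push.
Proof.
by move=> V W; apply/fpsP => m; rewrite fpsB /push -sumrB; apply: eq_bigr.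
Qed.

(** Both sides sum V k1 * W k2 over the pairs with phi k1 + phi k2 = m, grouped by
    k1 + k2 on the left and by (phi k1, phi k2) on the right. *)
Fact push_multiplicative : monoid_morphism push.
Proof.
split=> [|V W]; first by rewrite -(mono0 n) push_mono phi0 mono0.
apply/fpsP => m; set d := (mdeg m).+1; have md : (mdeg m < d)%N by [].
rewrite (fpsM_pairs _ _ md) [LHS](push_sum _ md).
transitivity (\sum_(k : 'X_{1..n < d, d} | (phi k.1 + phi k.2)%MM == m)
    V k.1 * W k.2).
  transitivity (\sum_(l : 'X_{1..n < d} | phi l == m)
    \sum_(k : 'X_{1..n < d, d} | val l == (k.1 + k.2)%MM) V k.1 * W k.2).
    by apply: eq_bigr => -[l ld] _; rewrite (fpsM_pairs _ _ ld).
  rewrite (exchange_big_dep (fun k : 'X_{1..n < d, d} => (phi k.1 + phi k.2)%MM == m)) /=.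
    apply: eq_bigr => -[[k1 d1] [k2 d2]] /= /eqP km.
    have kd : (mdeg (k1 + k2)%MM < d)%N.
      by rewrite ltnS -km -phiD phi_deg.
    rewrite (big_pred1 (BMultinom kd)) // => -[l ld] /=.
    rewrite -[in RHS]val_eqE /=.
    by case: (l =P _) => [->|]; rewrite ?andbF // phiD km eqxx.
  by move=> l k /eqP <- /eqP /= lk; rewrite -phiD -lk.
transitivity (\sum_(l : 'X_{1..r < d, d} | m == (l.1 + l.2)%MM)
  \sum_(k : 'X_{1..n < d, d} | (phi k.1 == l.1) && (phi k.2 == l.2)) V k.1 * W k.2).
  rewrite (exchange_big_dep (fun k : 'X_{1..n < d, d} => (phi k.1 + phi k.2)%MM == m)) /=.
    apply: eq_bigr => -[[k1 d1] [k2 d2]] /= /eqP km.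
    have kd1 : (mdeg (phi k1) < d)%N by rewrite ltnS -km mdegD leq_addr.
    have kd2 : (mdeg (phi k2) < d)%N by rewrite ltnS -km mdegD leq_addl.
    rewrite (big_pred1 (BMultinom kd1, BMultinom kd2)) // => -[[l1 e1] [l2 e2]] /=.
    rewrite xpair_eqE; apply/idP/idP => [/and3P[_ /eqP p1 /eqP p2]|/andP[/eqP [->] /eqP [->]]].
      by apply/andP; split; apply/eqP/val_inj.
    by rewrite km !eqxx.
  by move=> l k /eqP -> /andP[/eqP -> /eqP ->].
apply: eq_bigr => -[[/= l1 e1] [/= l2 e2]] _.
rewrite [push V l1](push_sum _ e1) [push W l2](push_sum _ e2) big_distrlr /=.
by rewrite pair_big /=; apply: eq_bigl.
Qed.

HB.instance Definition _ := GRing.isZmodMorphism.Build _ _ _ push_additive.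
HB.instance Definition _ := GRing.isMonoidMorphism.Build _ _ _ push_multiplicative.

Lemma push_ordge d V : ordge d V -> ordge d (push V).
Proof.
move=> oV m md; rewrite /push big1 // => -[/= k kd] /eqP km.
by apply: oV; rewrite (leq_ltn_trans _ md) // -km phi_deg.
Qed.

End Pushforward.

(** * The toric parametrisation of the surface X Y = Z^N *)

Definition mnm2 (i j : nat) : 'X_{1..2} := [multinom nth 0%N [:: i; j] k | k < 2].
Definition mnm3 (a b c : nat) : 'X_{1..3} := [multinom nth 0%N [:: a; b; c] k | k < 3].

Lemma mnm2E0 i j : mnm2 i j (inord 0) = i. Proof. by rewrite mnmE inordK. Qed.
Lemma mnm2E1 i j : mnm2 i j (inord 1) = j. Proof. by rewrite mnmE inordK. Qed.
Lemma mnm3E0 a b c : mnm3 a b c (inord 0) = a. Proof. by rewrite mnmE inordK. Qed.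
Lemma mnm3E1 a b c : mnm3 a b c (inord 1) = b. Proof. by rewrite mnmE inordK. Qed.
Lemma mnm3E2 a b c : mnm3 a b c (inord 2) = c. Proof. by rewrite mnmE inordK. Qed.
Definition mnmE23 := (mnm2E0, mnm2E1, mnm3E0, mnm3E1, mnm3E2).

Lemma mnm2P (m : 'X_{1..2}) : m = mnm2 (m (inord 0)) (m (inord 1)).
Proof.
apply/mnmP => -[[|[|//]] i2]; rewrite mnmE /=; congr (m _); apply: val_inj;
  by rewrite /= inordK.
Qed.

Lemma mnm3P (m : 'X_{1..3}) : m = mnm3 (m (inord 0)) (m (inord 1)) (m (inord 2)).
Proof.
apply/mnmP => -[[|[|[|//]]] i2]; rewrite mnmE /=; congr (m _); apply: val_inj;
  by rewrite /= inordK.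
Qed.

Lemma mdeg2 i j : mdeg (mnm2 i j) = (i + j)%N.
Proof. by rewrite mdegE !big_ord_recl big_ord0 !mnmE /= addn0. Qed.

Lemma mdeg3 a b c : mdeg (mnm3 a b c) = (a + b + c)%N.
Proof. by rewrite mdegE !big_ord_recl big_ord0 !mnmE /= addn0 addnA. Qed.

Lemma mnm2D i j i' j' : (mnm2 i j + mnm2 i' j')%MM = mnm2 (i + i') (j + j').
Proof. by rewrite [LHS]mnm2P !mnmDE !mnmE23. Qed.

Lemma mnm3D a b c a' b' c' :
  (mnm3 a b c + mnm3 a' b' c')%MM = mnm3 (a + a') (b + b') (c + c').
Proof. by rewrite [LHS]mnm3P !mnmDE !mnmE23. Qed.

Lemma mnm2B i j i' j' : (mnm2 i j - mnm2 i' j')%MM = mnm2 (i - i') (j - j').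
Proof. by rewrite [LHS]mnm2P !mnmBE !mnmE23. Qed.

Lemma mnm3B a b c a' b' c' :
  (mnm3 a b c - mnm3 a' b' c')%MM = mnm3 (a - a') (b - b') (c - c').
Proof. by rewrite [LHS]mnm3P !mnmBE !mnmE23. Qed.

Lemma mnm2_inj i j i' j' : mnm2 i j = mnm2 i' j' -> i = i' /\ j = j'.
Proof.
by move=> e; split; [have := mnm2E0 i j | have := mnm2E1 i j]; rewrite e mnmE23.
Qed.

Lemma mnm2_le i j i' j' : (mnm2 i j <= mnm2 i' j')%MM = (i <= i')%N && (j <= j')%N.
Proof.
apply/mnm_lepP/andP => [le|[le1 le2] k]; first by
  have := (le (inord 0), le (inord 1)); rewrite !mnmE23 => -[].
rewrite !mnmE; case: k => [[|[|k]] kk] //=.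
Qed.

Lemma mnm3_le a b c a' b' c' :
  (mnm3 a b c <= mnm3 a' b' c')%MM = [&& (a <= a')%N, (b <= b')%N & (c <= c')%N].
Proof.
apply/mnm_lepP/and3P => [le|[le1 le2 le3] k]; first by
  have := (le (inord 0), le (inord 1), le (inord 2)); rewrite !mnmE23 => -[] [].
rewrite !mnmE; case: k => [[|[|[|k]]] kk] //=.
Qed.

Lemma U3E0 : U_(inord 0)%MM = mnm3 1 0 0.
Proof. by rewrite [LHS]mnm3P !mnm1E -!val_eqE /= !inordK. Qed.
Lemma U3E1 : U_(inord 1)%MM = mnm3 0 1 0.
Proof. by rewrite [LHS]mnm3P !mnm1E -!val_eqE /= !inordK. Qed.
Lemma U3E2 : U_(inord 2)%MM = mnm3 0 0 1.
Proof. by rewrite [LHS]mnm3P !mnm1E -!val_eqE /= !inordK. Qed.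

Lemma mnm3Mn a b c k : (mnm3 a b c *+ k)%MM = mnm3 (a * k) (b * k) (c * k).
Proof. by rewrite [LHS]mnm3P !mulmnE !mnmE23. Qed.
Lemma mnm2Mn a b k : (mnm2 a b *+ k)%MM = mnm2 (a * k) (b * k).
Proof. by rewrite [LHS]mnm2P !mulmnE !mnmE23. Qed.

Section ToricParam.
Variables (K : comNzRingType) (N : nat).
Hypothesis N0 : (0 < N)%N.
Implicit Types (V Q : fps 3 K) (r : fps 2 K).

(** The effect on exponents of X = s^N, Y = t^N, Z = s t. *)
Definition toric (k : 'X_{1..3}) : 'X_{1..2} :=
  mnm2 (N * k (inord 0) + k (inord 2)) (N * k (inord 1) + k (inord 2)).

Lemma toricE a b c : toric (mnm3 a b c) = mnm2 (N * a + c) (N * b + c).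
Proof. by rewrite /toric !mnmE23. Qed.

Lemma toricD k l : toric (k + l)%MM = (toric k + toric l)%MM.
Proof. by rewrite /toric mnm2D !mnmDE; congr mnm2; lia. Qed.

Lemma toric_deg k : (mdeg k <= mdeg (toric k))%N.
Proof. by rewrite (mnm3P k) toricE mdeg2 mdeg3; nia. Qed.

Definition subst_toric : fps 3 K -> fps 2 K := push toric.

HB.instance Definition _ := GRing.isZmodMorphism.Build _ _ subst_toric
  (push_additive toric).
HB.instance Definition _ := GRing.isMonoidMorphism.Build _ _ subst_toric
  (push_multiplicative K toricD toric_deg).

Definition A_eq : fps 3 K :=
  fps_of_mpoly ('X_(inord 0) * 'X_(inord 1) - 'X_(inord 2) ^+ N).

Lemma A_eqE : A_eq = mono K (mnm3 1 1 0) - mono K (mnm3 0 0 N).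
Proof.
rewrite /A_eq rmorphB /= rmorphM rmorphXn /= -!/(mono _ _) mono_exp -monoD.
by rewrite U3E0 U3E1 U3E2 mnm3D mnm3Mn mul1n !mul0n.
Qed.

Lemma subst_toric_mono k : subst_toric (mono K k) = mono K (toric k).
Proof. by apply: push_mono; exact: toric_deg. Qed.

Lemma subst_A_eq : subst_toric A_eq = 0.
Proof.
by rewrite A_eqE rmorphB /= !subst_toric_mono !toricE !muln1 !muln0 !addn0 subrr.
Qed.

(** The sum of the coefficients of V over the fibre of [toric] through (a, b, c),
    which is a segment in the direction (1, 1, -N) when a or b is zero. *)
Definition diag_sum V a b c :=
  \sum_(l < (c %/ N).+1) V (mnm3 (a + l) (b + l) (c - l * N)).

Lemma subst_toric_coef V a b c : (a == 0%N) || (b == 0%N) ->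
  subst_toric V (mnm2 (N * a + c) (N * b + c)) = diag_sum V a b c.
Proof.
move=> ab0; rewrite /subst_toric /push; set m := mnm2 _ _.
have hd (l : 'I_(c %/ N).+1) : (mdeg (mnm3 (a + l) (b + l) (c - l * N)) < (mdeg m).+1)%N.
  have lc : (l * N <= c)%N by rewrite -leq_divRL // -ltnS.
  by rewrite mdeg3 /m mdeg2; nia.
pose h l : 'X_{1..3 < (mdeg m).+1} := BMultinom (hd l).
pose h' (k : 'X_{1..3 < (mdeg m).+1}) : 'I_(c %/ N).+1 := inord (k (inord 0) - a).
rewrite (reindex_onto h h') => [|[k kd]] /=.
  apply: eq_big => [l|l _] //=; rewrite toricE /m.
  have lc : (l * N <= c)%N by rewrite -leq_divRL // -ltnS.
  apply/andP; split; first by apply/eqP; congr mnm2; nia.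
  by apply/eqP/val_inj; rewrite /h' /= mnmE23 inordK addnC addnK.
have [a' [b' [c' ek]]] : exists a' b' c', k = mnm3 a' b' c'.
  by exists (k (inord 0)), (k (inord 1)), (k (inord 2)); apply: mnm3P.
subst k => /eqP; rewrite toricE => /mnm2_inj [e1 e2].
apply: val_inj; rewrite /= /h' /= mnmE23.
have aa : (a <= a')%N by case/orP: ab0 => /eqP ab0; nia.
have bb : (b <= b')%N by case/orP: ab0 => /eqP ab0; nia.
have ea : (c = c' + N * (a' - a))%N by nia.
have eb : (b' - b = a' - a)%N by nia.
have le : ((a' - a) * N <= c)%N by nia.
rewrite inordK; first by congr mnm3; nia.
by rewrite ltnS leq_divRL.
Qed.

Lemma A_eqM Q a b c : (A_eq * Q) (mnm3 a b c) =
  (if (0 < a)%N && (0 < b)%N then Q (mnm3 a.-1 b.-1 c) else 0) -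
  (if (N <= c)%N then Q (mnm3 a b (c - N)) else 0).
Proof.
rewrite A_eqE mulrBl fpsB !monoM !mnm3_le !mnm3B !subn0 !subn1 /= andbT.
by [].
Qed.

(** The quotient by X Y - Z^N is found by summing the coefficients of V along the
    direction (1, 1, -N); the sums over whole fibres vanish. *)
Lemma subst_toric_ker V : subst_toric V = 0 -> exists Q, V = A_eq * Q.
Proof.
move=> V0.
pose Q : fps 3 K := fun k => diag_sum V (k (inord 0)).+1 (k (inord 1)).+1 (k (inord 2)).
exists Q; apply/fpsP => k; rewrite (mnm3P k); move: (k _) (k _) (k _) => c b a.
rewrite A_eqM /Q !mnmE23.
have -> : (if (0 < a)%N && (0 < b)%N then diag_sum V a.-1.+1 b.-1.+1 c else 0) =
          diag_sum V a b c.
  case: ifPn => [/andP[a0 b0]|]; first by rewrite !prednK.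
  rewrite negb_and -!eqn0Ngt => ab0.
  by rewrite -subst_toric_coef // V0.
rewrite /diag_sum big_ord_recl /= !addn0 mul0n subn0.
case: leqP => Nc; last first.
  by rewrite divn_small // big_ord0 subr0 addr0.
have -> : (c %/ N = ((c - N) %/ N).+1)%N by rewrite -{1}(subnK Nc) divnDr // divnn N0 addn1.
rewrite (eq_bigr (fun l : 'I_((c - N) %/ N).+1 =>
  V (mnm3 (a.+1 + l) (b.+1 + l) (c - N - l * N)))) ?addrK // => l _.
by rewrite /bump /= !addSnnS; congr (V (mnm3 _ _ _)); lia.
Qed.

Lemma subst_toric_support V m : subst_toric V m != 0 ->
  m (inord 0) = m (inord 1) %[mod N].
Proof.
have [//|/eqP ne] := eqVneq (m (inord 0) %% N)%N (m (inord 1) %% N)%N.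
case/eqP; rewrite /subst_toric /push big1 // => -[k kd] /= /eqP km.
by case: ne; rewrite -km /toric !mnmE23 !(mulnC N) !modnMDl.
Qed.

(** Each monomial with exponents congruent modulo N comes from exactly one monomial
    not divisible by X Y, and this one can carry its coefficient. *)
Lemma subst_toric_image r :
  (forall m, r m != 0 -> m (inord 0) = m (inord 1) %[mod N]) ->
  exists V, subst_toric V = r.
Proof.
move=> rw.
pose V : fps 3 K := fun k => if (k (inord 0) == 0%N) || (k (inord 1) == 0%N)
  then r (toric k) else 0.
exists V; apply/fpsP => m.
have [mN|/eqP ne] := eqVneq (m (inord 0) %% N)%N (m (inord 1) %% N)%N; last first.
  have -> : r m = 0 by apply/eqP/negPn/negP => /rw.
  by apply/eqP/negPn/negP => /subst_toric_support.
have [a [b [c [ab0 ->]]]] : exists a b c, (a == 0%N) || (b == 0%N) /\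
    m = mnm2 (N * a + c) (N * b + c).
  rewrite (mnm2P m); move: mN; move: (m _) (m _) => j i ij.
  have [le|/ltnW le] := leqP i j.
    exists 0%N, ((j - i) %/ N)%N, i; split=> //; rewrite muln0 add0n mulnC divnK ?subnK //.
    by rewrite -eqn_mod_dvd // eq_sym; apply/eqP.
  exists ((i - j) %/ N)%N, 0%N, j; split=> //; rewrite ?orbT //.
  rewrite muln0 add0n mulnC divnK ?subnK //.
  by rewrite -eqn_mod_dvd //; apply/eqP.
rewrite subst_toric_coef // /diag_sum big_ord_recl /= big1 => [|l _].
  by rewrite addr0 /V !mnmE23 !addn0 ab0 toricE mul0n subn0.
by rewrite /V !mnmE23 !addnS.
Qed.

Definition toric_morphism : {rmorphism fps 3 K -> fps 2 K} := subst_toric.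

End ToricParam.

(** * Ideals of K[[s,t]] saturated with respect to s *)

Section SaturatedIdeals.
Variable K : fieldType.
Notation R := (fps 2 K).
Implicit Types (f g h r a b : R).

Definition fdvd h r := exists g, r = h * g.

Lemma fdvdMr h r g : fdvd h r -> fdvd h (r * g).
Proof. by case=> x ->; exists (x * g); rewrite mulrA. Qed.
Lemma fdvdMl h r g : fdvd h r -> fdvd h (g * r).
Proof. by rewrite mulrC; apply: fdvdMr. Qed.
Lemma fdvd_trans h r g : fdvd h r -> fdvd r g -> fdvd h g.
Proof. by move=> hr [x ->]; apply: fdvdMr. Qed.
Lemma fdvdxx h : fdvd h h. Proof. by exists 1; rewrite mulr1. Qed.
Lemma fdvdD h r g : fdvd h r -> fdvd h g -> fdvd h (r + g).
Proof. by case=> x -> [y ->]; exists (x + y); rewrite mulrDr. Qed.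
Lemma fdvdN h r : fdvd h r -> fdvd h (- r).
Proof. by case=> x ->; exists (- x); rewrite mulrN. Qed.
Lemma fdvdB h r g : fdvd h r -> fdvd h g -> fdvd h (r - g).
Proof. by move=> hr hg; apply: fdvdD hr (fdvdN hg). Qed.
Lemma fdvd0 h : fdvd h 0. Proof. by exists 0; rewrite mulr0. Qed.

Definition vs : R := mono K (mnm2 1 0).
Definition vt : R := mono K (mnm2 0 1).

Lemma vsP r : fdvd vs r <-> forall j, r (mnm2 0 j) = 0.
Proof.
split=> [[g ->] j|r0]; first by rewrite monoM mnm2_le.
exists (fun m => r (m + mnm2 1 0)%MM); apply/fpsP => m.
rewrite monoM (mnm2P m) mnm2_le; move: (m _) (m _) => j [|i]; first by rewrite r0.
by rewrite /= mnm2B mnm2D subn0 subn1 addn1 addn0.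
Qed.

Lemma vsX j : vs ^+ j = mono K (mnm2 j 0).
Proof. by rewrite mono_exp mnm2Mn mul1n mul0n. Qed.
Lemma vtX j : vt ^+ j = mono K (mnm2 0 j).
Proof. by rewrite mono_exp mnm2Mn mul1n mul0n. Qed.

Lemma vs_neq0 : vs <> 0.
Proof.
by move/fpsP/(_ (mnm2 1 0)) => /eqP; rewrite /vs monoE eqxx fps0 oner_eq0.
Qed.

Lemma vs_ndvd_vt j : ~ fdvd vs (vt ^+ j).
Proof.
by move/vsP/(_ j) => /eqP; rewrite vtX monoE eqxx oner_eq0.
Qed.

Lemma nat_min (P : nat -> Prop) j : P j -> exists2 e, P e & forall i, (i < e)%N -> ~ P i.
Proof.
elim/ltn_ind: j => j IH Pj.
have [[i ij Pi]|no] := pselect (exists2 i, (i < j)%N & P i); first exact: IH Pi.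
by exists j => // i ij Pi; apply: no; exists i.
Qed.

(** The order in t of the restriction of r to the line s = 0. *)
Definition tord e r := r (mnm2 0 e) != 0 /\ forall j, (j < e)%N -> r (mnm2 0 j) = 0.

Lemma tord_ex r : ~ fdvd vs r -> exists e, tord e r.
Proof.
move=> sr; have [j rj] : exists j, r (mnm2 0 j) != 0.
  apply: contrapT => no; apply: sr; apply/vsP => j.
  by apply/eqP/negPn/negP => rj; apply: no; exists j.
have [e re emin] := @nat_min (fun j => r (mnm2 0 j) != 0) j rj.
by exists e; split=> // i /emin/negP; rewrite negbK => /eqP.
Qed.

Lemma tord_nvs e r : tord e r -> ~ fdvd vs r.
Proof. by case=> re _ /vsP/(_ e) /eqP; rewrite (negbTE re). Qed.

Lemma fpsM_line r g j : (r * g) (mnm2 0 j) =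
  \sum_(i < j.+1) r (mnm2 0 i) * g (mnm2 0 (j - i)).
Proof.
rewrite (fpsM_sum _ _ (ltnSn _)).
have kd (i : 'I_j.+1) : (mdeg (mnm2 0 i) < (mdeg (mnm2 0 j)).+1)%N by rewrite !mdeg2 !add0n.
pose h i := BMultinom (kd i).
pose h' (k : 'X_{1..2 < (mdeg (mnm2 0 j)).+1}) : 'I_j.+1 := inord (k (inord 1)).
rewrite (reindex_onto h h') /=.
  apply: eq_big => [i|i _]; last by rewrite mnm2B.
  rewrite mnm2_le /= -ltnS ltn_ord; apply/eqP/val_inj.
  by rewrite /h' /= mnmE23 inordK.
move=> [k kd'] /=; rewrite {1}(mnm2P k) mnm2_le leqn0 => /andP[/eqP k0 k1].
apply: val_inj; rewrite /= /h' /=.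
rewrite inordK //.
by rewrite [RHS]mnm2P k0.
Qed.

Lemma tordM d e r g : tord d r -> tord e g -> tord (d + e) (r * g).
Proof.
move=> [rd r0] [ge g0]; split.
  have de : (d < (d + e).+1)%N by rewrite ltnS leq_addr.
  rewrite fpsM_line (bigD1 (Ordinal de)) //= big1 ?addr0 => [|i].
    by rewrite addKn mulf_neq0.
  rewrite -val_eqE neq_ltn /= => /orP[lt|gt]; first by rewrite r0 ?mul0r.
  by rewrite g0 ?mulr0 //; case: i gt => i /=; lia.
move=> j jde; rewrite fpsM_line big1 // => i _.
have [lt|ge'] := ltnP i d; first by rewrite r0 ?mul0r.
by rewrite g0 ?mulr0 //; case: i ge' => i /=; lia.
Qed.

(** Orders on the line s = 0 add up in products. *)
Lemma vs_prime a b : fdvd vs (a * b) -> fdvd vs a \/ fdvd vs b.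
Proof.
move=> sab; have [|na] := pselect (fdvd vs a); [by left | right].
apply: contrapT => nb; have [d da] := tord_ex na; have [e eb] := tord_ex nb.
exact: tord_nvs (tordM da eb) sab.
Qed.

Lemma vsX_ndvd k a b : ~ fdvd vs a -> fdvd a (vs ^+ k * b) -> fdvd a b.
Proof.
move=> na; elim: k b => [|k IH] b; first by rewrite expr0 mul1r.
rewrite exprS -mulrA => -[x]; set y := _ ^+ k * b => e.
have : fdvd vs (a * x) by rewrite -e; exists y.
case/vs_prime => // -[z xz]; apply: IH; exists z.
by apply: (fps_mulfI vs_neq0); rewrite e xz mulrCA.
Qed.

(** Restricted to s = 0 these are series in one variable, where divisibility is
    decided by the orders. *)
Lemma line_division e g h : tord e h -> (forall j, (j < e)%N -> g (mnm2 0 j) = 0) ->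
  exists a b, g = a * h + vs * b.
Proof.
move=> [he h0] g0.
pose shift f : R := fun m => if m (inord 0) == 0%N then f (mnm2 0 (e + m (inord 1))) else 0.
have shiftE f : (forall j, (j < e)%N -> f (mnm2 0 j) = 0) ->
    fdvd vs (f - vt ^+ e * shift f).
  move=> f0; apply/vsP => j; rewrite fpsB vtX monoM mnm2_le mnm2B /shift !mnmE23 /=.
  by case: leqP => [ej|/f0 ->]; rewrite ?subnKC ?subrr.
have [v uv] : exists v, shift h * v = 1.
  apply: fps_unit; rewrite /shift !mnm0E eqxx addn0; exact: he.
have [b1 e1] := shiftE h h0; have [b2 e2] := shiftE g g0.
exists (v * shift g), (b2 - v * shift g * b1).
have eg : g = vt ^+ e * shift g + vs * b2 by rewrite -e2; ring.
have eh : h = vt ^+ e * shift h + vs * b1 by rewrite -e1; ring.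
rewrite [LHS]eg [X in _ = _ * X + _]eh; move: (shift g) (shift h) uv => g' h' uv.
transitivity (vt ^+ e * g' * (h' * v) + vs * b2); first by rewrite uv mulr1.
ring.
Qed.

(** Modulo s, an ideal of K[[s,t]] is principal, hence generated by h modulo s;
    the remainders are multiples of s, and they can be divided by s when the
    ideal is saturated, so the division can be repeated for ever. *)
Lemma saturated_principal (I : set R) : is_ideal I ->
  (forall r, I (vs * r) -> I r) -> exists2 h, I h & forall r, I r -> fdvd h r.
Proof.
move=> idI sat; have [I0 ID IM] := idI.
have [alls|] := pselect (forall r, I r -> fdvd vs r).
  exists 0 => // r Ir; suff -> : r = 0 by exact: fdvd0.
  apply: ordge_eq0 => d; suff [g [_ ->]] : exists g, I g /\ r = vs ^+ d * g.
    by rewrite vsX => m md; rewrite monoM (mnm2P m) mnm2_le; case: leqP => // dm;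
       move: md; rewrite (mnm2P m) mdeg2; lia.
  elim: d => [|d [g [Ig ->]]]; first by exists r; rewrite expr0 mul1r.
  have [x gx] := alls g Ig; exists x; split; first by apply: sat; rewrite -gx.
  by rewrite gx exprSr mulrA.
move=> /existsNP[g0 /not_implyP[Ig0 ng0]].
have [e0 te0] := tord_ex ng0.
have [e [h Ih the] emin] := @nat_min (fun e => exists2 h, I h & tord e h) e0
  (ex_intro2 _ _ g0 Ig0 te0).
have low g : I g -> forall j, (j < e)%N -> g (mnm2 0 j) = 0.
  move=> Ig j je; apply: contrapT => /eqP gj.
  have [l gl lmin] := @nat_min (fun j => g (mnm2 0 j) != 0) j gj.
  have lj : (l <= j)%N by rewrite leqNgt; apply/negP => /lmin /negP; rewrite gj.
  apply: (emin l); first exact: leq_ltn_trans lj je.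
  by exists g => //; split=> // i /lmin /negP; rewrite negbK => /eqP.
have step g : exists ab : R * R, I g -> I ab.2 /\ g = ab.1 * h + vs * ab.2.
  have [Ig|nIg] := pselect (I g); last by exists (0, 0).
  have [a [b gab]] := line_division the (low g Ig).
  exists (a, b) => _; split=> //; apply: sat.
  have -> : vs * b = g - a * h by rewrite gab; ring.
  by apply: (ideal_sub idI) => //; apply: IM.
have [F FP] := choice step.
exists h => // r Ir; pose q k := iter k (fun g => (F g).2) r.
have Iq k : I (q k) by elim: k => [//|k IH]; have [] := FP _ IH.
have os i (x : R) : ordge i (vs ^+ i * x).
  rewrite vsX => m md; rewrite monoM (mnm2P m) mnm2_le; case: leqP => // im.
  by move: md; rewrite (mnm2P m) mdeg2; lia.
have [a la] := series_lim (fun i => @os i (F (q i)).1).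
have part d : r = (\sum_(i < d) vs ^+ i * (F (q i)).1) * h + vs ^+ d * q d.
  elim: d => [|d IH]; first by rewrite big_ord0 mul0r add0r expr0 mul1r.
  rewrite big_ord_recr /= {1}IH {1}(FP (q d) (Iq d)).2 exprSr.
  set S := \sum_(_ < _) _; rewrite -/(q d.+1) /=; ring.
exists a; apply/eqP; rewrite -subr_eq0; apply/eqP; apply: ordge_eq0 => d.
rewrite {1}(part d); set S := \sum_(_ < _) _.
have -> : S * h + vs ^+ d * q d - h * a = vs ^+ d * q d - h * (a - S) by ring.
by apply: ordgeB; [exact: os | apply: ordgeMl; exact: la].
Qed.

End SaturatedIdeals.

(** * Homogeneous primes of K[[s,t]] for the weights modulo N *)

Section Weights.
Variables (K : fieldType) (N' : nat).
Notation N := N'.+1.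
Notation R := (fps 2 K).
Notation G := 'I_N.
Implicit Types (f g h r a b : R) (u v w : G).

Lemma inZpD i j : inZp (i + j) = inZp i + inZp j :> G.
Proof. by apply: val_inj; rewrite /= modnDm. Qed.
Lemma inZp0 : inZp 0 = 0 :> G. Proof. exact: val_inj. Qed.
Lemma inZpE w : inZp w = w. Proof. exact: valZpK. Qed.

(** With the weight 1 for s and -1 for t the monomials of weight zero are those in
    s^N, t^N and s t. *)
Definition wt (m : 'X_{1..2}) : G := inZp (m (inord 0)) - inZp (m (inord 1)).

Lemma wtE i j : wt (mnm2 i j) = inZp i - inZp j.
Proof. by rewrite /wt !mnmE23. Qed.

Lemma wtD m k : wt (m + k)%MM = wt m + wt k.
Proof. by rewrite /wt !mnmDE !inZpD opprD addrACA. Qed.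

Lemma wt0 : wt 0%MM = 0. Proof. by rewrite /wt !mnm0E subrr. Qed.

Definition weighted w r := forall m, r m != 0 -> wt m = w.

Definition hpart w r : R := fun m => if wt m == w then r m else 0.

Lemma weighted_hpart w r : weighted w (hpart w r).
Proof. by move=> m; rewrite /hpart; case: (wt m =P w) => [//|_]; rewrite eqxx. Qed.

Lemma hpartD w r g : hpart w (r + g) = hpart w r + hpart w g.
Proof. by apply/fpsP => m; rewrite fpsD /hpart !fpsD; case: ifP => // _; rewrite addr0. Qed.

Lemma weightedP w r : weighted w r <-> hpart w r = r.
Proof.
split=> [hr|<-]; last exact: weighted_hpart.
apply/fpsP => m; rewrite /hpart; case: eqP => // wm; apply/esym/eqP/negPn/negP.
by move/hr.
Qed.

Lemma hpart_id w r : weighted w r -> hpart w r = r. Proof. by move/weightedP. Qed.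

Lemma weighted_uniq u v r : weighted u r -> weighted v r -> r <> 0 -> u = v.
Proof.
move=> hu hv r0; apply: contrapT => uv; apply: r0; apply/fpsP => m.
by apply: contrapT => /eqP rm; apply: uv; rewrite -(hu m) // -(hv m).
Qed.

Lemma weightedM u v f g : weighted u f -> weighted v g -> weighted (u + v) (f * g).
Proof.
move=> hf hg m; rewrite (fpsM_sum _ _ (ltnSn _)) => ne.
apply: contrapT => wm; case/eqP: ne; rewrite big1 // => -[/= k kd] km.
have [->|fk] := eqVneq (f k) 0; first by rewrite mul0r.
have [->|gk] := eqVneq (g (m - k)%MM) 0; first by rewrite mulr0.
by case: wm; rewrite -(hf k) // -(hg _ gk) -wtD addmC submK.
Qed.

Lemma weighted1 : weighted 0 1.
Proof. by move=> m; rewrite fps1; case: (m =P 0%MM) => [->|]; rewrite ?wt0 ?eqxx. Qed.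
Lemma weighted0 w : weighted w 0. Proof. by move=> m; rewrite eqxx. Qed.
Lemma weightedX w f k : weighted w f -> weighted (w *+ k) (f ^+ k).
Proof.
move=> hf; elim: k => [|k IH]; first by rewrite expr0 mulr0n; exact: weighted1.
by rewrite exprS mulrS; apply: weightedM.
Qed.

Lemma weighted_mono i j : weighted (inZp i - inZp j) (mono K (mnm2 i j)).
Proof. by move=> m; rewrite monoE; case: (_ =P m) => [<-|]; rewrite ?wtE ?eqxx. Qed.

Lemma weighted_vs : weighted (inZp 1) (vs K).
Proof. by have := @weighted_mono 1 0; rewrite inZp0 subr0. Qed.
Lemma hpartM u w f g : weighted u f -> hpart w (f * g) = f * hpart (w - u) g.
Proof.
move=> hf; apply/fpsP => m; rewrite {1}/hpart.
rewrite !(fpsM_sum _ _ (ltnSn _)); case: eqP => wm.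
  apply: eq_bigr => -[/= k kd] km; have [->|fk] := eqVneq (f k) 0; first by rewrite !mul0r.
  have wE : wt m = wt (m - k)%MM + wt k by rewrite -wtD submK.
  by rewrite /hpart -wm -(hf k fk) wE addrK eqxx.
rewrite big1 // => -[/= k kd] km; have [->|fk] := eqVneq (f k) 0; first by rewrite !mul0r.
rewrite /hpart; case: eqP => e; last by rewrite mulr0.
by case: wm; rewrite -(submK km) wtD e (hf k fk) subrK.
Qed.

Lemma hpart_sum r : \sum_w hpart w r = r.
Proof.
apply/fpsP => m; transitivity (\sum_w hpart w r m).
  by elim/big_ind2: _ => // x1 x2 y1 y2 <- <-.
rewrite (bigD1 (wt m)) //= /hpart eqxx big1 ?addr0 // => w wm.
by rewrite eq_sym (negbTE wm).
Qed.

(** Only one homogeneous component of the quotient matters. *)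
Lemma fdvd_weighted u v h r : weighted u h -> weighted v r -> fdvd h r ->
  exists2 g, weighted (v - u) g & r = h * g.
Proof.
move=> hh hr [g rg]; exists (hpart (v - u) g); first exact: weighted_hpart.
by rewrite -(hpartM _ _ hh) -rg hpart_id.
Qed.

(** The generator h divides its homogeneous components, and the quotients add up
    to 1, so one of them is a unit. *)
Lemma weighted_generator (I : set R) h : I h -> (forall r, I r -> fdvd h r) ->
  (forall w r, I r -> I (hpart w r)) ->
  exists w g, [/\ weighted w g, I g & forall r, I r -> fdvd g r].
Proof.
move=> Ih hI Ipart; have [h0|h0] := pselect (h = 0).
  exists 0, 0; split; [exact: weighted0 | by rewrite -h0 | by move=> r /hI; rewrite h0].
have [c hc] := choice (fun w => hI _ (Ipart w h Ih)).
have c1 : \sum_w c w = 1.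
  by apply: (fps_mulfI h0); rewrite mulr_sumr mulr1 -(eq_bigr _ (fun w _ => hc w)) hpart_sum.
have [w cw] : exists w, c w 0%MM != 0.
  apply: contrapT => no; have := congr1 (fun f : R => f 0%MM) c1.
  rewrite fps1 eqxx (_ : _ 0%MM = \sum_w c w 0%MM); last first.
    by elim/big_ind2: _ => // x1 x2 y1 y2 <- <-.
  rewrite big1 => [/esym/eqP|w _]; first by rewrite oner_eq0.
  by apply/eqP/negPn/negP => cw; apply: no; exists w.
have [v cv] := fps_unit cw.
exists w, (hpart w h); split; [exact: weighted_hpart | exact: Ipart |].
move=> r /hI; apply: fdvd_trans; exists v.
by rewrite hc -mulrA cv mulr1.
Qed.

Definition hprime h := forall u v a b, weighted u a -> weighted v b ->
  fdvd h (a * b) -> fdvd h a \/ fdvd h b.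

(** The homogeneous prime elements, with primality tested on homogeneous elements.
    The last clause provides elements of every weight outside (h); multiplication
    by them brings an element to weight zero and keeps its order along h. *)
Definition hirr w h := [/\ weighted w h, h <> 0, ~ fdvd h 1, hprime h &
  forall v, exists2 c, weighted v c & ~ fdvd h c].

Lemma hprimeX h w c k : hprime h -> ~ fdvd h 1 -> weighted w c -> ~ fdvd h c ->
  ~ fdvd h (c ^+ k).
Proof.
move=> ph h1 hc nc; elim: k => [|k IH]; first by rewrite expr0.
by rewrite exprS => /(ph _ _ _ _ hc (weightedX hc))[].
Qed.

Lemma hirr_vs : hirr (inZp 1) (vs K).
Proof.
split; [exact: weighted_vs | exact: vs_neq0 | | by move=> u v a b _ _; exact: vs_prime |].
  by have := @vs_ndvd_vt K 0; rewrite expr0.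
move=> v; exists (vt K ^+ (nat_of_ord (- v))); last exact: vs_ndvd_vt.
have := @weighted_mono 0 (nat_of_ord (- v)); rewrite vtX inZpE inZp0 sub0r opprK.
exact.
Qed.

Lemma hirr_of w h : weighted w h -> hprime h -> h <> 0 -> ~ fdvd h (vs K) -> hirr w h.
Proof.
move=> hh ph h0 hs; have h1 : ~ fdvd h 1 by move=> /(@fdvdMr _ _ _ (vs K)); rewrite mul1r.
split=> // v; exists (vs K ^+ nat_of_ord v); last exact: (hprimeX _ h1 weighted_vs).
by have := @weighted_mono (nat_of_ord v) 0; rewrite vsX inZpE inZp0 subr0.
Qed.

Lemma hirr_assoc u v h g : hirr u h -> hirr v g -> fdvd h g -> fdvd g h.
Proof.
move=> [hh h0 h1 ph _] [hg g0 g1 pg _] hd.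
have [x hx gx] := fdvd_weighted hh hg hd.
have : fdvd g (h * x) by rewrite -gx; exact: fdvdxx.
case/(pg _ _ _ _ hh hx) => // -[y xy]; case: h1; exists y.
by apply: (fps_mulfI g0); rewrite mulr1 [in LHS]gx {1}xy; ring.
Qed.

Lemma nonunit_coef0 h : ~ fdvd h 1 -> h 0%MM = 0.
Proof.
move=> h1; apply: contrapT => /eqP /fps_unit[g hg]; apply: h1.
by exists g.
Qed.

Lemma hirrX_cancel w h v a u b k : hirr w h -> weighted u a -> weighted v b -> ~ fdvd h a ->
  fdvd (h ^+ k) (a * b) -> fdvd (h ^+ k) b.
Proof.
move=> [hh h0 h1 ph _] ha; elim: k v b => [|k IH] v b hb na.
  by rewrite expr0 => _; exists b; rewrite mul1r.
rewrite exprS => hd.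
have : fdvd h (a * b) by apply: fdvd_trans hd; exists (h ^+ k).
case/(ph _ _ _ _ ha hb) => // hb'; have [x hx bx] := fdvd_weighted hh hb hb'.
case: hd => z zE; have [|y xy] := IH _ _ hx na.
  by exists z; apply: (fps_mulfI h0); rewrite mulrCA -bx zE mulrA.
by exists y; rewrite bx xy mulrA.
Qed.

(** By induction on the order in t of the restriction to s = 0.  If r is not prime,
    so that r divides a b and neither a nor b, the saturation of (r, a) has a
    homogeneous generator d dividing r.  If d is a unit, then r divides b; if the
    order of d is that of r, then d and r are associated and r divides a; otherwise
    the induction applies to d. *)
Lemma hirr_factor_tord e w r : weighted w r -> tord e r -> ~ fdvd r 1 ->
  exists v h, hirr v h /\ fdvd h r.
Proof.
elim/ltn_ind: e w r => e IH w r hr te r1.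
have ns := tord_nvs te.
have r0 : r <> 0 by move=> r0; case: te => + _; rewrite r0 fps0 eqxx.
have [ph|] := pselect (hprime r).
  exists w, r; split; last exact: fdvdxx.
  apply: hirr_of => // -[x sx]; have : fdvd (vs K) (r * x) by rewrite -sx; exact: fdvdxx.
  case/vs_prime => // -[y xy]; apply: r1; exists y.
  by apply: (fps_mulfI (@vs_neq0 K)); rewrite mulr1 [LHS]sx xy; ring.
move=> /existsNP[u /existsNP[v /existsNP[a /existsNP[b]]]].
move=> /not_implyP[ha /not_implyP[hb /not_implyP[rab /not_orP[ra rb]]]].
pose I : set R := fun x => exists k y z, vs K ^+ k * x = r * y + a * z.
have idI : is_ideal I.
  split=> [|x x' [k [y [z e1]]] [k' [y' [z' e2]]]|x x' [k [y [z e1]]]].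
  - by exists 0%N, 0, 0; ring.
  - exists (k + k')%N, (vs K ^+ k' * y + vs K ^+ k * y'), (vs K ^+ k' * z + vs K ^+ k * z').
    transitivity (vs K ^+ k' * (vs K ^+ k * x) + vs K ^+ k * (vs K ^+ k' * x')).
      by rewrite exprD; ring.
    by rewrite e1 e2; ring.
  - exists k, (x * y), (x * z); rewrite mulrCA e1; ring.
have sat x : I (vs K * x) -> I x.
  by move=> [k [y [z e1]]]; exists k.+1, y, z; rewrite exprSr -mulrA.
have Ipart x' x : I x -> I (hpart x' x).
  move=> [k [y [z e1]]]; set c := x' + inZp 1 *+ k.
  exists k, (hpart (c - w) y), (hpart (c - u) z).
  have := congr1 (hpart c) e1.
  rewrite (hpartM _ _ (weightedX weighted_vs)) hpartD (hpartM _ _ hr) (hpartM _ _ ha).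
  by rewrite /c addrK.
have [d0 Id0 d0I] := saturated_principal idI sat.
have [wd [d [hd Id dI]]] := weighted_generator Id0 d0I Ipart.
have dr : fdvd d r by apply: dI; exists 0%N, 1, 0; ring.
have da : fdvd d a by apply: dI; exists 0%N, 0, 1; ring.
have [c hc rc] := fdvd_weighted hd hr dr.
have nsd : ~ fdvd (vs K) d by move=> sd; apply: ns; apply: fdvd_trans sd dr.
have nsc : ~ fdvd (vs K) c by move=> sc; apply: ns; rewrite rc; apply: fdvdMl.
have [ed td] := tord_ex nsd; have [ec tc] := tord_ex nsc.
have eE : e = (ed + ec)%N.
  have := tordM td tc; rewrite -rc => -[r2 r3]; case: te => r4 r5.
  apply/eqP; rewrite eqn_leq; apply/andP; split; rewrite leqNgt; apply/negP.
    by move=> /r5 /eqP; rewrite (negbTE r2).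
  by move=> /r3 /eqP; rewrite (negbTE r4).
have [d1|d1] := pselect (fdvd d 1).
  have [k [y [z e1]]] : I 1.
    by case: d1 => x ->; rewrite mulrC; case: idI => _ _; apply.
  case: rb; apply: (@vsX_ndvd _ k _ _ ns); rewrite mulr1 in e1.
  rewrite e1 mulrDl; apply: fdvdD; first by exists (y * b); ring.
  have -> : a * z * b = a * b * z by ring.
  exact: fdvdMr.
have [ed_lt|ed_ge] := ltnP ed e.
  have [v' [h [hh hd']]] := IH _ ed_lt _ _ hd td d1.
  by exists v', h; split=> //; apply: fdvd_trans hd' dr.
have ec0 : ec = 0%N by lia.
have [c' cc'] : exists c', c * c' = 1.
  apply: fps_unit; case: tc => + _; rewrite ec0 (_ : mnm2 0 0 = 0%MM) //.
  by apply/eqP; rewrite -mdeg_eq0 mdeg2.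
case: ra; apply: fdvd_trans da; exists c'.
by rewrite rc -mulrA cc' mulr1.
Qed.

Lemma hirr_factor w r : weighted w r -> ~ fdvd r 1 -> exists v h, hirr v h /\ fdvd h r.
Proof.
move=> hr r1; have [sr|ns] := pselect (fdvd (vs K) r).
  by exists (inZp 1), (vs K); split=> //; exact: hirr_vs.
by have [e te] := tord_ex ns; apply: hirr_factor_tord hr te r1.
Qed.

End Weights.

(** * The divisor class group of the series of weight zero *)

Arguments weighted_hpart {K N'} w r m _.

Section ClassGroupOfInvariants.
Variables (K : fieldType) (N' : nat) (T : comPzRingType).
Notation N := N'.+1.
Notation R := (fps 2 K).
Notation G := 'I_N.
Variable psi : {rmorphism T -> R}.
Hypothesis psi_inj : injective psi.
Hypothesis psi_wt : forall x, weighted (0 : G) (psi x).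
Hypothesis psi_surj : forall r, weighted (0 : G) r -> exists x, psi x = r.
Arguments psi_wt : clear implicits.
Implicit Types (x y : T) (f g h r a b : R) (u v w : G).

Lemma psi_eq0 x : psi x = 0 -> x = 0.
Proof. by move=> x0; apply: psi_inj; rewrite rmorph0. Qed.

Lemma T_mulf_eq0 x y : x * y = 0 -> x = 0 \/ y = 0.
Proof.
move=> xy; have := rmorphM psi x y; rewrite xy rmorph0 => /esym/fps_mulf_eq0.
by case=> /psi_eq0; [left | right].
Qed.

Lemma T_mulfI x : x <> 0 -> injective ( *%R x).
Proof.
move=> x0 y z /eqP; rewrite -subr_eq0 -mulrBr => /eqP/T_mulf_eq0[//|/eqP].
by rewrite subr_eq0 => /eqP.
Qed.

Lemma set0_prime : prime_ideal ([set 0] : set T).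
Proof.
split; first by split=> [|a b -> ->|a b ->] //=; rewrite ?addr0 ?mulr0.
- by move=> /= /(congr1 psi); rewrite rmorph1 rmorph0 => /eqP; rewrite oner_eq0.
- by move=> a b /= /T_mulf_eq0.
Qed.

Definition contract h : set T := [set x | fdvd h (psi x)].

Lemma contract_ideal h : is_ideal (contract h).
Proof.
split=> [|a b|a b] /=; rewrite /contract /= ?rmorph0 ?rmorphD ?rmorphM.
- exact: fdvd0.
- exact: fdvdD.
- exact: fdvdMl.
Qed.

Lemma contract_prime h : hprime N' h -> ~ fdvd h 1 -> prime_ideal (contract h).
Proof.
move=> ph h1; split; [exact: contract_ideal | by rewrite /contract /= rmorph1 |].
move=> a b; rewrite /contract /= rmorphM.
by apply: ph; exact: psi_wt.
Qed.

Lemma hirr_prime w h : hirr w h -> prime_ideal (contract h).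
Proof. by case=> _ _ h1 ph _; exact: contract_prime. Qed.

Lemma contract_sub u v h g : hirr u h -> hirr v g -> contract g `<=` contract h ->
  fdvd h g.
Proof.
move=> [hh _ _ ph sep] [hg _ _ _ _] gh; have [c hc nc] := sep (- v).
have [x px] : exists x, psi x = g * c.
  by apply: psi_surj; rewrite -(subrr v); exact: weightedM.
have /gh : contract g x by exists c.
by rewrite /contract /= px => /(ph _ _ _ _ hg hc)[].
Qed.

Lemma contract_maximal u v h g : hirr u h -> hirr v g -> contract g `<=` contract h ->
  contract h `<=` contract g.
Proof.
move=> hh hg /(contract_sub hh hg) hd x; apply: fdvd_trans.
exact: hirr_assoc hh hg hd.
Qed.

Lemma hirr_nonzero w h : hirr w h -> exists2 x, contract h x & x <> 0.
Proof.
move=> [hh h0 _ _ sep]; have [c hc nc] := sep (- w).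
have [x px] : exists x, psi x = h * c.
  by apply: psi_surj; rewrite -(subrr w); exact: weightedM.
exists x; first by exists c.
move=> x0; have := px; rewrite x0 rmorph0 => /esym/fps_mulf_eq0[//|c0].
by apply: nc; rewrite c0; exact: fdvd0.
Qed.

Variable X : T.
Hypothesis psiX : psi X = vs K ^+ N.

(** The series all of whose multiples have their part of weight zero in P form an
    ideal of K[[s,t]].  It is saturated with respect to s because X = s^N is not in
    P, so it is principal, with a homogeneous generator, which is prime because P
    is. *)
Lemma prime_contract (P : set T) : prime_ideal P -> ~ P X -> (exists2 x, P x & x <> 0) ->
  exists w h, [/\ hirr w h, P = contract h & ~ fdvd h (vs K)].
Proof.
move=> [idP P1 pP] PX [x0 Px0 x00]; have [P0 PD PM] := idP.
pose I : set R := fun r => forall c, exists2 x, P x & psi x = hpart (0 : G) (c * r).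
have idI : is_ideal I.
  split=> [c|a b Ia Ib c|a b Ib c].
  - by exists 0 => //; rewrite rmorph0 mulr0; apply/fpsP => m; rewrite /hpart; case: ifP.
  - have [x Px ex] := Ia c; have [y Py ey] := Ib c.
    by exists (x + y); [exact: PD | rewrite rmorphD mulrDr hpartD ex ey].
  - by have [x Px ex] := Ib (c * a); exists x; rewrite // ex mulrA.
have [I0 ID IM] := idI.
have surj0 r : exists y, psi y = hpart (0 : G) r by apply: psi_surj; exact: weighted_hpart.
have wvs : weighted (0 : G) (vs K ^+ N) by rewrite -psiX.
have sat r : I (vs K * r) -> I r.
  move=> Ir c; have [y ey] := surj0 (c * r); exists y => //.
  have [x Px ex] := Ir (c * vs K ^+ N').
  have xE : x = X * y.
    apply: psi_inj; rewrite rmorphM ex ey psiX.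
    have -> : c * vs K ^+ N' * (vs K * r) = vs K ^+ N * (c * r) by rewrite exprS; ring.
    by rewrite (hpartM _ _ wvs) subr0.
  by move: Px; rewrite xE => /pP[].
have Ipart w r : I r -> I (hpart w r).
  move=> Ir c; have [x Px ex] := Ir (hpart (0 - w) c); exists x => //.
  rewrite ex [c * _]mulrC (hpartM _ _ (weighted_hpart w r)).
  by rewrite (hpartM _ _ (weighted_hpart _ c)) !sub0r opprK mulrC.
have [h0 Ih0 h0I] := saturated_principal idI sat.
have [w [h [hh Ih hI]]] := weighted_generator Ih0 h0I Ipart.
have PI x : P x <-> I (psi x).
  split=> [Px c|/(_ 1)[y Py]].
    have [y ey] := surj0 c; exists (y * x); first exact: PM.
    by rewrite rmorphM ey [c * _]mulrC (hpartM _ _ (psi_wt x)) subr0 mulrC.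
  by rewrite mul1r hpart_id // => /psi_inj <-.
have PE : P = contract h.
  apply/seteqP; split=> x; first by move/PI/hI.
  by case=> g xg; apply/PI; rewrite xg mulrC; exact: IM.
have hs : ~ fdvd h (vs K).
  by move=> hs; apply: PX; rewrite PE /contract /= psiX exprS; exact: fdvdMr.
exists w, h; split=> //; apply: hirr_of => // [u v a b ha hb hab|h00].
  have [Ia|/existsNP[c Nc]] := pselect (I a); first by left; exact: hI.
  right; apply: hI => d; have [y ey] := surj0 (d * b); exists y => //.
  have [x ex] := surj0 (c * a).
  have Px : ~ P x by move=> Px; apply: Nc; exists x.
  suff : P (x * y) by case/pP.
  have Iab : I (a * b) by case: hab => g ->; rewrite mulrC; exact: IM.
  apply/PI; rewrite rmorphM ex ey ![_ * a]mulrC ![_ * b]mulrC !(hpartM _ _ ha) !(hpartM _ _ hb).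
  by rewrite mulrACA mulrC; exact: IM.
apply: x00; apply: psi_eq0; have : contract h x0 by rewrite -PE.
by case=> g ->; rewrite h00 mul0r.
Qed.

Lemma G_mulrN w : w *+ N = 0.
Proof. by rewrite Zp_mulrn; apply: val_inj; rewrite /= modnMl. Qed.

(** If s divides x, then x^N is a multiple of s^N = X. *)
Lemma prime_contains_vs (P : set T) : prime_ideal P -> P X -> contract (vs K) `<=` P.
Proof.
move=> [[P0 PD PM] P1 pP] PX x [g xg].
have hg : weighted (- inZp 1 : G) g.
  have [g' hg' e] := fdvd_weighted (@weighted_vs K N') (psi_wt x) (ex_intro _ g xg).
  by rewrite (fps_mulfI (@vs_neq0 K) (etrans (esym xg) e)) -sub0r.
have [y ey] : exists y, psi y = g ^+ N.
  by apply: psi_surj; have := weightedX (k := N) hg; rewrite G_mulrN.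
have : P (x ^+ N).
  have -> : x ^+ N = y * X by apply: psi_inj; rewrite rmorphXn rmorphM psiX ey xg exprMn mulrC.
  exact: PM.
elim: (N) => [|k IH]; first by rewrite expr0.
by rewrite exprS => /pP[].
Qed.

(** Every nonzero prime contains the contraction of a homogeneous prime element, and
    no such contraction lies strictly inside another one. *)
Lemma hirr_height w h : hirr w h -> height (contract h) 1.
Proof.
move=> hh; split.
  exists (fun i => if i == 0%N then [set 0] else contract h) => //; split.
    move=> [|i] _ /=; [exact: set0_prime | exact: hirr_prime hh].
  move=> [|i] //= _; split; first by move=> y ->; case: (contract_ideal h).
  by have [x hx x0] := hirr_nonzero hh => /(_ x hx).
move=> [Q [Qp Qlt] Q2]; have [Q01 nQ01] := Qlt 0%N isT; have [Q12 nQ12] := Qlt 1%N isT.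
have [x Q1x x0] : exists2 x, Q 1%N x & x <> 0.
  apply: contrapT => no; apply: nQ01 => y Qy; have [[Q00 _ _] _ _] := Qp 0%N isT.
  by have [->//|y0] := pselect (y = 0); case: no; exists y.
rewrite Q2 in Q12 nQ12; apply: nQ12; have Q1p := Qp 1%N isT.
have [QX|QX] := pselect (Q 1%N X).
  have vsQ := prime_contains_vs Q1p QX.
  apply: (subset_trans _ vsQ); apply: (contract_maximal hh (@hirr_vs K N')).
  exact: subset_trans vsQ Q12.
have [v [g [hg Qg _]]] := prime_contract Q1p QX (ex_intro2 _ _ x Q1x x0).
by rewrite Qg in Q12 *; apply: contract_maximal hh hg Q12.
Qed.

Lemma height1_irr (P : height1 T) : exists hw : R * G,
  [/\ hirr hw.2 hw.1, val P = contract hw.1 & val P X -> hw = (vs K, inZp 1)].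
Proof.
case: P => P /= /asboolP[pP [[Q [Qp Qlt] Q1] noQ]].
have [PX|PX] := pselect (P X).
  have vsP := prime_contains_vs pP PX.
  exists (vs K, inZp 1); split=> //=; first exact: hirr_vs.
  apply/seteqP; split=> //; apply: contrapT => nPvs; apply: noQ.
  exists (fun i => if i == 0%N then [set 0] else if i == 1%N then contract (vs K) else P) => //.
  split; first by move=> [|[|i]] _ //=;
    [exact: set0_prime | exact: hirr_prime (@hirr_vs K N')].
  move=> [|[|i]] //= _; split=> //; first by move=> y ->; case: (contract_ideal (vs K)).
  by have [x hx x0] := hirr_nonzero (@hirr_vs K N') => /(_ x hx).
have [Q01 nQ01] := Qlt 0%N isT; rewrite Q1 in Q01 nQ01.
have [w [h [hh PE hs]]] : exists w h, [/\ hirr (w : G) h, P = contract h & ~ fdvd h (vs K)].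
  apply: prime_contract => //; apply: contrapT => no; apply: nQ01 => y Py.
  have [[Q00 _ _] _ _] := Qp 0%N isT.
  by have [->//|y0] := pselect (y = 0); case: no; exists y.
by exists (h, w); split=> // /PX.
Qed.

Definition gen_irr := projT1 (choice height1_irr).
Definition irr_h (P : height1 T) : R := (gen_irr P).1.
Definition irr_w (P : height1 T) : G := (gen_irr P).2.

Lemma irrP (P : height1 T) : hirr (irr_w P) (irr_h P).
Proof. by case: (projT2 (choice height1_irr) P). Qed.
Lemma irr_contract (P : height1 T) : val P = contract (irr_h P).
Proof. by case: (projT2 (choice height1_irr) P). Qed.
Lemma irrX (P : height1 T) : val P X -> irr_h P = vs K /\ irr_w P = inZp 1.
Proof.
case: (projT2 (choice height1_irr) P) => _ _ H /H.
by rewrite /irr_h /irr_w /gen_irr => ->.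
Qed.

Definition mk_height1 w h (hh : hirr w h) : height1 T :=
  exist _ (contract h) (asboolT (conj (hirr_prime hh) (hirr_height hh))).

Definition P_vs := mk_height1 (@hirr_vs K N').

Lemma height1_inj (P Q : height1 T) : val P `<=` val Q -> P = Q.
Proof.
rewrite !irr_contract => PQ; apply: val_inj; rewrite !irr_contract.
by apply/seteqP; split=> //; exact: contract_maximal (irrP Q) (irrP P) PQ.
Qed.

Lemma P_vsX : val P_vs X.
Proof. by rewrite /= /contract /= psiX exprS; apply: fdvdMr; exact: fdvdxx. Qed.

Lemma P_vs_unique (P : height1 T) : val P X -> P = P_vs.
Proof. by move=> /irrX[e _]; apply: height1_inj; rewrite irr_contract e. Qed.

Lemma irr_P_vs : irr_h P_vs = vs K /\ irr_w P_vs = inZp 1.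
Proof. exact: irrX P_vsX. Qed.

(** For the converse, multiplication by homogeneous elements outside (h) brings both
    h and the cofactor of h^k to weight zero. *)
Lemma sympowE w h k x : hirr w h -> sympow (contract h) k x <-> fdvd (h ^+ k) (psi x).
Proof.
move=> hh; have [hw h0 h1 ph sep] := hh; split.
  case=> s ns ps; apply: (@hirrX_cancel _ _ _ _ _ _ _ _ _ hh (psi_wt s) (psi_wt x) ns).
  rewrite -rmorphM; move: ps => /(_ (contract (h ^+ k))); apply.
    exact: contract_ideal.
  move=> _ [l [<- lh ->]]; rewrite /contract /=.
  elim: l lh => [|y l IH] lh; first by rewrite big_nil expr0 rmorph1; exact: fdvdxx.
  rewrite big_cons rmorphM /= exprS; have [a ->] := lh y (mem_head _ _).
  have [|b ->] := IH; first by move=> z zl; apply: lh; rewrite in_cons zl orbT.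
  by exists (a * b); ring.
move=> hx; have [c hc nc] := sep (- w); have [d hd nd] := sep (w *+ k).
have [y ey] : exists y, psi y = h * c.
  by apply: psi_surj; rewrite -(subrr w); exact: weightedM.
have hck : weighted (- w *+ k) (c ^+ k) by exact: weightedX.
have [s es] : exists s, psi s = c ^+ k * d.
  by apply: psi_surj; rewrite -(subrr (w *+ k)) addrC -mulNrn; exact: weightedM.
have [g hg xg] := fdvd_weighted (weightedX hw) (psi_wt x) hx.
have [z ez] : exists z, psi z = g * d.
  by apply: psi_surj; rewrite -(addNr (w *+ k)) -sub0r; exact: weightedM.
exists s.
  by rewrite /contract /= es => /(ph _ _ _ _ hck hd)[|//]; exact: hprimeX hc nc.
have -> : s * x = z * y ^+ k.
  by apply: psi_inj; rewrite !rmorphM rmorphXn es ez ey xg /= exprMn; ring.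
have [_ _] := gen_idealP [set a | exists s : seq T,
    [/\ size s = k, (forall x, x \in s -> contract h x) & a = \prod_(x <- s) x]].
apply; apply: sub_gen_ideal; exists (nseq k y); split; first exact: size_nseq.
  by move=> t /nseqP[-> _]; exists c.
by rewrite big_nseq -Monoid.iteropE.
Qed.

Lemma fdvdX_le h j k r : (j <= k)%N -> fdvd (h ^+ k) r -> fdvd (h ^+ j) r.
Proof.
by move=> jk [g ->]; exists (h ^+ (k - j) * g); rewrite mulrA -exprD subnKC.
Qed.

Lemma val_atE w h k x : hirr w h -> sympow (contract h) k x ->
  ~ sympow (contract h) k.+1 x -> val_at (contract h) x = k.
Proof.
move=> hh; move=> s1 s2; apply: xget_unique => // j [].
move: s1 s2; rewrite !(sympowE _ _ hh) => s1 s2 s3 s4.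
apply/eqP; rewrite eqn_leq; apply/andP; split; rewrite leqNgt; apply/negP => lt.
  by apply: s2; exact: fdvdX_le lt s3.
by apply: s4; exact: fdvdX_le lt s1.
Qed.

Lemma val_at_fdvd w h k g x : hirr w h -> psi x = h ^+ k * g -> ~ fdvd h g ->
  val_at (contract h) x = k.
Proof.
move=> hh xg ng; apply: (val_atE hh); rewrite (sympowE _ _ hh) xg; first by exists g.
case=> y; rewrite exprSr -mulrA => /fps_mulfI e; apply: ng; exists y; apply: e.
case: hh => _ h0 _ _ _ hk; apply: h0; elim: k hk {xg} => [/eqP|k IH].
  by rewrite expr0 oner_eq0.
by rewrite exprS => /fps_mulf_eq0[].
Qed.

Lemma hirr_ndvd_prod w h (L : seq (height1 T)) (A : pred (height1 T)) v (u : R) :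
  hirr w h -> (forall P, A P -> ~ fdvd h (irr_h P)) -> weighted v u -> ~ fdvd h u ->
  ~ fdvd h (\prod_(P <- L | A P) irr_h P * u) /\
  exists v', weighted v' (\prod_(P <- L | A P) irr_h P * u).
Proof.
move=> hh nA hu nu; elim: L => [|P L [IH1 [v' IH2]]].
  by rewrite big_nil mul1r; split=> //; exists v.
rewrite big_cons; case: ifP => AP; last by split=> //; exists v'.
have [hP _ _ _ _] := irrP P; rewrite -mulrA; split; last first.
  by exists (irr_w P + v'); exact: weightedM.
case: hh => _ _ _ ph _ /(ph _ _ _ _ hP IH2)[|//]; exact: nA.
Qed.

Lemma unit_coef_ndvd w h (u : R) : hirr w h -> u 0%MM != 0 -> ~ fdvd h u.
Proof.
move=> [_ _ h1 _ _] u0 [g ug]; move: u0; rewrite ug fpsM0.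
by rewrite (nonunit_coef0 h1) mul0r eqxx.
Qed.

Lemma div_of_factorization x (L : seq (height1 T)) v (u : R) :
  psi x = \prod_(P <- L) irr_h P * u -> weighted v u -> u 0%MM != 0 ->
  is_div_of (\sum_(P <- L) << P >>) x.
Proof.
move=> xL hu u0 Q.
have -> : coeff Q (\sum_(P <- L) << P >>) = (count_mem Q L)%:Z.
  elim: L {xL} => [|P L IH]; first by rewrite big_nil coeff0.
  by rewrite big_cons coeffD IH coeffU mul1r /= PoszD; congr (_ + _); case: eqP.
congr Posz; apply/esym; rewrite irr_contract.
have hQ := irrP Q; pose rest := \prod_(P <- L | P != Q) irr_h P * u.
apply: (@val_at_fdvd _ _ _ rest _ hQ).
  rewrite xL (bigID (pred1 Q)) /= -mulrA; congr (_ * _).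
  rewrite -big_filter (eq_big_seq (fun=> irr_h Q)); last first.
    by move=> P; rewrite mem_filter => /andP[/eqP ->].
  by rewrite big_const_seq count_predT size_filter -Monoid.iteropE.
have nA P : P != Q -> ~ fdvd (irr_h Q) (irr_h P).
  move=> /eqP PQ hPQ; apply: PQ; apply: height1_inj; rewrite !irr_contract => y.
  exact: fdvd_trans.
by case: (hirr_ndvd_prod L hQ nA hu (unit_coef_ndvd hQ u0)).
Qed.

(** By induction on the least degree of a monomial that occurs, which division by a
    prime factor lowers. *)
Lemma factorization w r : weighted w r -> r <> 0 -> exists (L : seq (height1 T)) v (u : R),
  [/\ r = \prod_(P <- L) irr_h P * u, weighted v u & u 0%MM != 0].
Proof.
move=> hr r0; have [m rm] : exists m, r m != 0.
  by apply: contrapT => no; apply: r0; apply/fpsP => m; apply: contrapT => /eqP rm; apply: no; exists m.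
have [k mk] := ubnP (mdeg m); elim: k w r m hr r0 rm mk => // k IH w r m hr r0 rm mk.
have [r00|r00] := eqVneq (r 0%MM) 0; last first.
  by exists [::], w, r; rewrite big_nil mul1r.
have [|v [h [hh hd]]] := @hirr_factor K N' w r hr.
  by case=> y /fpsP/(_ 0%MM) /eqP; rewrite fps1 eqxx fpsM0 r00 mul0r oner_eq0.
have [hw h0 h1 ph sep] := hh.
pose P := mk_height1 hh.
have hP : fdvd (irr_h P) h.
  by apply: (contract_sub (irrP P) hh); rewrite -irr_contract.
have [hPw hP0 hP1 _ _] := irrP P.
have [x hx rx] := fdvd_weighted hPw hr (fdvd_trans hP hd).
have x0 : x <> 0 by move=> x0; apply: r0; rewrite rx x0 mulr0.
have [m' xm' m'k] : exists2 m', x m' != 0 & (mdeg m' < k)%N.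
  apply: contrapT => no; move: rm; rewrite rx => /eqP; apply.
  apply: (@ordgeM _ _ 1 k) => [l|l lk|]; last by rewrite add1n.
    by rewrite ltnS leqn0 mdeg_eq0 => /eqP ->; exact: nonunit_coef0.
  by apply: contrapT => /eqP xl; apply: no; exists l.
have [L [v' [u [xL hu u0]]]] := IH _ _ _ hx x0 xm' m'k.
by exists (P :: L), v', u; rewrite big_cons rx xL mulrA.
Qed.

Definition div_weight (D : weil_div T) : G :=
  fglift (fun P => irr_w P : ssrint.zmodule G) D.

Lemma div_weightU k P : div_weight << k *g P >> = irr_w P *~ k.
Proof. by rewrite /div_weight liftU. Qed.

Fact div_weight_additive : zmod_morphism div_weight.
Proof. by move=> D1 D2; apply: (lift_is_additive (fun P => irr_w P : ssrint.zmodule G)). Qed.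

HB.instance Definition _ := GRing.isZmodMorphism.Build _ _ div_weight div_weight_additive.

Lemma is_div_of_inj (D1 D2 : weil_div T) x : is_div_of D1 x -> is_div_of D2 x -> D1 = D2.
Proof. by move=> h1 h2; apply/eqP/freeg_eqP => P; rewrite h1 h2. Qed.

(** The weights of the prime factors of a series of weight zero add up to zero. *)
Lemma div_weight_principal D : principal_div D -> div_weight D = 0.
Proof.
move=> /(_ [set D | div_weight D = 0]); apply => /=; first exact: raddf0.
  by move=> D1 D2 w1 w2; rewrite raddfB /= w1 w2 subrr.
move=> x D1 x0 divx; have px0 : psi x <> 0 by move=> /psi_eq0.
have [L [v [u [xL hu u0]]]] := factorization (psi_wt x) px0.
rewrite (is_div_of_inj divx (div_of_factorization xL hu u0)) raddf_sum.
have v0 : v = 0 by rewrite -(hu _ u0) wt0.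
have hL : weighted (\sum_(P <- L) irr_w P) (\prod_(P <- L) irr_h P).
  elim: (L) => [|P L' IH]; first by rewrite !big_nil; exact: weighted1.
  by rewrite !big_cons; apply: weightedM => //; case: (irrP P).
have := weighted_uniq (psi_wt x) _ px0; rewrite {1}xL => /(_ _ (weightedM hL hu)).
rewrite v0 addr0 => e; transitivity (\sum_(P <- L) irr_w P); last by rewrite -e.
by apply: eq_bigr => P _; rewrite /= div_weightU mulr1z.
Qed.

Lemma principal_sub D1 D2 : principal_div D1 -> principal_div D2 ->
  principal_div (D1 - D2 : weil_div T).
Proof. by move=> p1 p2 H H0 HB Hd; apply: (HB); [exact: p1 | exact: p2]. Qed.
Lemma principal0 : principal_div (0 : weil_div T).
Proof. by move=> H H0 HB Hd. Qed.
Lemma principalD D1 D2 : principal_div D1 -> principal_div D2 ->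
  principal_div (D1 + D2 : weil_div T).
Proof.
move=> p1 p2; rewrite -[D2]opprK -[- D2]sub0r; apply: principal_sub => //.
exact: principal_sub principal0 p2.
Qed.
Lemma principal_mulz D k : principal_div D -> principal_div (D *~ k : weil_div T).
Proof.
move=> pD; have pn n : principal_div (D *+ n : weil_div T).
  elim: n => [|n IH]; first by rewrite mulr0n; exact: principal0.
  by rewrite mulrS; apply: principalD.
case: k => n; first by rewrite -pmulrn.
by rewrite NegzE mulrNz -sub0r; apply: principal_sub; [exact: principal0 | exact: pn].
Qed.
Lemma principal_div_of D x : x <> 0 -> is_div_of D x -> principal_div D.
Proof. by move=> x0 dx H H0 HB Hd; exact: Hd x D x0 dx. Qed.

(** Multiplying the equation of P by a power of s makes its weight zero. *)
Lemma principal_reduce (P : height1 T) : exists j : nat,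
  principal_div (<< P >> + << P_vs >> *+ j : weil_div T).
Proof.
exists (nat_of_ord (- irr_w P)); set j := nat_of_ord _.
have [hP hP0 _ _ _] := irrP P.
have hs : weighted (- irr_w P) (vs K ^+ j).
  by have := @weighted_mono K N' j 0; rewrite vsX /j inZpE inZp0 subr0.
have [x ex] : exists x, psi x = irr_h P * vs K ^+ j.
  by apply: psi_surj; rewrite -(subrr (irr_w P)); exact: weightedM.
have xL : psi x = \prod_(Q <- P :: nseq j P_vs) irr_h Q * 1.
  rewrite ex big_cons mulr1 big_nseq -Monoid.iteropE; case: irr_P_vs => -> _.
  by [].
have := div_of_factorization xL (@weighted1 K N').
rewrite fps1 eqxx oner_eq0 big_cons big_nseq => /(_ isT).
rewrite (_ : iter _ _ _ = << P_vs >> *+ j); last by elim: (j) => //= i ->; rewrite mulrS.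
apply: principal_div_of => x0; move: ex; rewrite x0 rmorph0 => /esym/fps_mulf_eq0[//|].
by elim: (j) => [/eqP|i IH]; rewrite ?expr0 ?oner_eq0 // exprS => /fps_mulf_eq0[/vs_neq0|].
Qed.

Lemma principal_N : principal_div (<< P_vs >> *+ N : weil_div T).
Proof.
have xL : psi X = \prod_(Q <- nseq N P_vs) irr_h Q * 1.
  by rewrite psiX mulr1 big_nseq -Monoid.iteropE; case: irr_P_vs => -> _.
have := div_of_factorization xL (@weighted1 K N').
rewrite fps1 eqxx oner_eq0 big_nseq => /(_ isT).
rewrite (_ : iter _ _ _ = << P_vs >> *+ N); last by elim: (N) => //= i ->; rewrite mulrS.
apply: principal_div_of => X0; have := psiX; rewrite X0 rmorph0 => /esym.
by elim: (N) => [/eqP|i IH]; rewrite ?expr0 ?oner_eq0 // exprS => /fps_mulf_eq0[/vs_neq0|].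
Qed.

Lemma principal_reduce_div D : exists k : int,
  principal_div (D - << P_vs >> *~ k : weil_div T).
Proof.
elim/freeg_ind_dom0: D => [|k P D _ _ [l pD]].
  by exists 0; rewrite mulr0z subr0; exact: principal0.
have [j pP] := principal_reduce P; exists (l - j%:Z * k).
have -> : << k *g P >> + D - << P_vs >> *~ (l - j%:Z * k) =
    (<< P >> + << P_vs >> *+ j) *~ k + (D - << P_vs >> *~ l) :> weil_div T.
  have -> : << k *g P >> = << P >> *~ k :> weil_div T by rewrite freegU_mulz intz.
  rewrite mulrzBr mulrzDl mulrzA -pmulrn opprB.
  by rewrite -!addrA; congr (_ + _); rewrite [RHS]addrCA.
by apply: principalD => //; exact: principal_mulz.
Qed.

(** Modulo principal divisors D is a multiple of the divisor of s, and N times the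
    latter is the divisor of X. *)
Lemma div_weight_eq0 D : div_weight D = 0 -> principal_div D.
Proof.
move=> D0; have [k pk] := principal_reduce_div D.
have wP : div_weight << P_vs >> = inZp 1.
  by rewrite div_weightU mulr1z; case: irr_P_vs.
have := div_weight_principal pk; rewrite raddfB /= raddfMz /= wP D0 sub0r => /eqP.
rewrite oppr_eq0 => /eqP k0.
have pN (i : nat) : (inZp 1 : G) *+ i = 0 -> principal_div (<< P_vs >> *+ i : weil_div T).
  rewrite Zp_mulrn => /(congr1 val) /=; rewrite modnMml mul1n => /eqP.
  move=> /dvdnP[l ->]; rewrite mulnC mulrnA pmulrn.
  exact: principal_mulz principal_N.
rewrite -[D](subrK (<< P_vs >> *~ k)); apply: principalD => //.
case: k k0 {pk} => i; first by rewrite -!pmulrn; exact: pN.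
rewrite NegzE !mulrNz => /eqP; rewrite oppr_eq0 -pmulrn => /eqP /pN pi.
by rewrite -sub0r; apply: principal_sub; [exact: principal0 | exact: pi].
Qed.

Definition Cl_weight (c : Cl T) : G := div_weight (repr c).

Lemma Cl_weight_pi (D : weil_div T) :
  Cl_weight (\pi_(Quotient.quot (principal_group T)) D)%qT = div_weight D.
Proof.
rewrite /Cl_weight; apply/eqP; rewrite -subr_eq0 -raddfB /=; apply/eqP.
apply: div_weight_principal.
have /eqP : (\pi_(Quotient.quot (principal_group T)) (repr
   (\pi_(Quotient.quot (principal_group T)) D)) = \pi_(Quotient.quot (principal_group T)) D)%qT.
  by rewrite reprK.
by rewrite -Quotient.idealrBE => /asboolP.
Qed.

Fact Cl_weight_additive : zmod_morphism Cl_weight.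
Proof.
move=> c d; rewrite -[c]reprK -[d]reprK -[X in Cl_weight X](raddfB (\pi_(Quotient.quot (principal_group T)))%qT).
by rewrite !Cl_weight_pi raddfB.
Qed.

HB.instance Definition _ := GRing.isZmodMorphism.Build _ _ Cl_weight Cl_weight_additive.

Lemma Cl_weight_bij : bijective Cl_weight.
Proof.
have inj : injective Cl_weight.
  move=> c d; rewrite -[c]reprK -[d]reprK !Cl_weight_pi => e.
  apply/eqP; rewrite -Quotient.idealrBE; apply/asboolP; apply: div_weight_eq0.
  by rewrite raddfB /= e subrr.
pose g (w : G) : Cl T := (\pi_(Quotient.quot (principal_group T)) (<< P_vs >> *+ nat_of_ord w : weil_div T))%qT.
have gK : cancel g Cl_weight.
  move=> w; rewrite Cl_weight_pi raddfMn /= div_weightU mulr1z.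
  case: irr_P_vs => _ ->; rewrite Zp_mulrn; apply: val_inj => /=.
  by rewrite modnMml mul1n modn_small.
by exists g => // c; apply: inj; rewrite gK.
Qed.

(** The divisor of y is m times that of s plus J, and it has weight zero. *)
Lemma Cl_weight_prime (J : height1 T) y (m : nat) g : J <> P_vs -> y <> 0 ->
  psi y = vs K ^+ m * g -> ~ fdvd (vs K) g ->
  sympow (val J) 1 y -> ~ sympow (val J) 2 y ->
  (forall P : height1 T, P <> P_vs -> val P y -> P = J) ->
  Cl_weight (prime_class J) = - inZp m.
Proof.
move=> JP y0 yg ng s1 s2 only.
have dv : is_div_of (<< P_vs >> *+ m + << J >>) y.
  move=> P; rewrite coeffD coeffMn !coeffU !mul1r.
  have [<-|/eqP PP] := P_vs =P P.
    move/eqP: JP => /negbTE ->; rewrite addr0 (val_at_fdvd (@hirr_vs K N') yg ng).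
    by rewrite -[RHS]natz.
  rewrite mul0rn add0r.
  have [<-|/eqP PJ] := J =P P.
    by rewrite irr_contract in s1 s2 *; rewrite (val_atE (irrP J) s1 s2).
  have Py : ~ val P y.
    by move=> /only e; case/eqP: PJ; rewrite e // => e'; rewrite e' eqxx in PP.
  by rewrite irr_contract in Py *; rewrite (@val_at_fdvd _ _ 0 _ y (irrP P) _ Py) // expr0 mul1r.
have := div_weight_principal (principal_div_of y0 dv).
rewrite raddfD /= raddfMn /= !div_weightU !mulr1z; case: irr_P_vs => _ -> e.
rewrite Cl_weight_pi div_weightU mulr1z; apply/eqP; rewrite -addr_eq0 addrC -e.
rewrite Zp_mulrn; apply/eqP; congr (_ + _).
by apply: val_inj; rewrite /= modnMml mul1n.
Qed.

End ClassGroupOfInvariants.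

(** * Noetherian rings and Krull's intersection theorem *)

Section IdealTools.
Variable A : comPzRingType.
Implicit Types (I J N : set A) (a b x : A) (s : seq A).

Lemma gen_ideal_min (X I : set A) : is_ideal I -> X `<=` I -> gen_ideal X `<=` I.
Proof. by move=> idI XI a; apply. Qed.

Lemma gen_ideal_sub (X Y : set A) : X `<=` gen_ideal Y -> gen_ideal X `<=` gen_ideal Y.
Proof. by apply: gen_ideal_min; exact: gen_idealP. Qed.

Lemma gen_ideal_id I : is_ideal I -> gen_ideal I = I.
Proof.
by move=> idI; apply/seteqP; split; [exact: gen_ideal_min | exact: sub_gen_ideal].
Qed.

Lemma ideal1 I : is_ideal I -> I 1 -> forall a, I a.
Proof. by case=> _ _ IM I1 a; rewrite -[a]mulr1; exact: IM. Qed.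

Lemma idealN I a : is_ideal I -> I a -> I (- a).
Proof. by case=> _ _ IM Ia; rewrite -mulN1r; exact: IM. Qed.

Lemma ideal_mulr I a b : is_ideal I -> I a -> I (a * b).
Proof. by case=> _ _ IM Ia; rewrite mulrC; exact: IM. Qed.

Definition adjoin I x : set A := [set a | exists b v, I v /\ a = b * x + v].

Lemma adjoin_ideal I x : is_ideal I -> is_ideal (adjoin I x).
Proof.
move=> [I0 ID IM]; split=> [|a a' [b [v [Iv ->]]] [b' [v' [Iv' ->]]]|c a [b [v [Iv ->]]]].
- by exists 0, 0; rewrite mul0r addr0.
- by exists (b + b'), (v + v'); split; [exact: ID | ring].
- by exists (c * b), (c * v); split; [exact: IM | ring].
Qed.

Lemma adjoin_sub I x : I `<=` adjoin I x.
Proof. by move=> v Iv; exists 0, v; rewrite mul0r add0r. Qed.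

Lemma adjoin_in I x : is_ideal I -> adjoin I x x.
Proof. by case=> I0 _ _; exists 1, 0; rewrite mul1r addr0. Qed.

Lemma adjoin_min I J x : is_ideal J -> I `<=` J -> J x -> adjoin I x `<=` J.
Proof. by move=> [_ JD JM] IJ Jx a [b [v [/IJ Jv ->]]]; apply: JD => //; exact: JM. Qed.

Lemma gen_ideal_adjoin (X : set A) x : gen_ideal (X `|` [set x]) = adjoin (gen_ideal X) x.
Proof.
apply/seteqP; split.
  apply: gen_ideal_min; first by apply: adjoin_ideal; exact: gen_idealP.
  by move=> y [Xy|->]; [apply: adjoin_sub; exact: sub_gen_ideal | apply: adjoin_in; exact: gen_idealP].
apply: adjoin_min; first exact: gen_idealP.
  by apply: gen_ideal_sub => y Xy; apply: sub_gen_ideal; left.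
by apply: sub_gen_ideal; right.
Qed.

Definition gens s : set A := gen_ideal [set x | x \in s].

Lemma gens_ideal s : is_ideal (gens s). Proof. exact: gen_idealP. Qed.
Lemma gens_in s x : x \in s -> gens s x. Proof. by move=> xs; apply: sub_gen_ideal. Qed.
Lemma gens_min s I : is_ideal I -> (forall x, x \in s -> I x) -> gens s `<=` I.
Proof. by move=> idI sI; apply: gen_ideal_min. Qed.
Lemma gens_nil : gens [::] = [set 0].
Proof.
apply/seteqP; split; last by move=> _ ->; case: (gens_ideal [::]).
apply: gens_min => //; split=> [|a b -> ->|a b ->] //=; by rewrite ?addr0 ?mulr0.
Qed.
Lemma gens_cons x s : gens (x :: s) = adjoin (gens s) x.
Proof.
rewrite -gen_ideal_adjoin /gens; congr gen_ideal; apply/seteqP; split=> y /=.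
  by rewrite in_cons => /orP[/eqP|]; [right | left].
by rewrite in_cons => -[->|->]; rewrite ?eqxx ?orbT.
Qed.

Definition noetherian := forall I, is_ideal I -> exists s, I = gens s.

Lemma noetherian_acc : noetherian -> forall C : nat -> set A,
  (forall k, is_ideal (C k)) -> (forall k, C k `<=` C k.+1) ->
  exists k, forall j, C j `<=` C k.
Proof.
move=> noA C idC incC.
have mono j k : (j <= k)%N -> C j `<=` C k.
  elim: k => [|k IH]; first by rewrite leqn0 => /eqP ->.
  by rewrite leq_eqVlt => /orP[/eqP -> //|]; rewrite ltnS => /IH jk a /jk; exact: incC.
pose U : set A := [set a | exists k, C k a].
have idU : is_ideal U.
  split=> [|a b [j Ca] [k Cb]|a b [k Cb]].
  - by exists 0%N; case: (idC 0%N).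
  - exists (maxn j k); case: (idC (maxn j k)) => _ ID _.
    by apply: ID; [exact: mono (leq_maxl _ _) _ Ca | exact: mono (leq_maxr _ _) _ Cb].
  - by exists k; case: (idC k) => _ _; apply.
have [s sU] := noA U idU.
have [k sk] : exists k, forall x, x \in s -> C k x.
  have : forall x, x \in s -> U x by rewrite sU; exact: gens_in.
  elim: (s) => [|x l IH] lU; first by exists 0%N.
  have [|k kl] := IH; first by move=> y yl; apply: lU; rewrite in_cons yl orbT.
  have [j jx] := lU x (mem_head _ _); exists (maxn j k) => y.
  rewrite in_cons => /orP[/eqP ->|/kl]; first exact: mono (leq_maxl _ _) _ jx.
  exact: mono (leq_maxr _ _) _.
exists k => j a Ca; have : U a by exists j.
by rewrite sU; apply: gens_min.
Qed.

Lemma noetherian_max : noetherian -> forall F : set (set A),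
  (forall I, F I -> is_ideal I) -> (exists I, F I) ->
  exists2 I, F I & forall J, F J -> I `<=` J -> J `<=` I.
Proof.
move=> noA F idF [I0 FI0]; apply: contrapT => no.
have step I : exists J, F I -> [/\ F J, I `<=` J & ~ (J `<=` I)].
  have [FI|nFI] := pselect (F I); last by exists I.
  apply: contrapT => noJ; apply: no; exists I => // J FJ IJ.
  by apply: contrapT => nJI; apply: noJ; exists J.
have [f fP] := choice step; pose C k := iter k f I0.
have FC k : F (C k) by elim: k => //= k IH; case: (fP _ IH).
have [k kmax] := noetherian_acc noA (fun k => idF _ (FC k))
  (fun k => let: And3 _ h _ := fP _ (FC k) in h).
by case: (fP _ (FC k)) => _ _; apply; exact: kmax k.+1.
Qed.

Lemma idpow_min (X I : set A) k : is_ideal I ->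
  (forall l, size l = k -> (forall x, x \in l -> X x) -> I (\prod_(x <- l) x)) ->
  idpow X k `<=` I.
Proof. by move=> idI h; apply: gen_ideal_min => // _ [l [sl lX ->]]; exact: h. Qed.

End IdealTools.

Section HilbertBasis.
Variable A : comNzRingType.
Implicit Types (J : set {poly A}) (f g : {poly A}).

(** Hilbert's basis theorem, through the ideals of leading coefficients. *)
Lemma noetherian_poly : noetherian A -> noetherian {poly A}.
Proof.
move=> noA J idJ; have [J0 JD JM] := idJ.
pose L d : set A := [set a | exists f, [/\ J f, (size f <= d.+1)%N & f`_d = a]].
have idL d : is_ideal (L d).
  split=> [|a b [f [Jf sf fa]] [g [Jg sg gb]]|a b [f [Jf sf fb]]].
  - by exists 0; split; rewrite ?size_poly0 ?coef0.
  - exists (f + g); split; [exact: JD | | by rewrite coefD fa gb].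
    by rewrite (leq_trans (size_polyD _ _)) // geq_max sf.
  - exists (a *: f); split; [by rewrite -mul_polyC; exact: JM | | by rewrite coefZ fb].
    exact: leq_trans (size_scale_leq _ _) sf.
have incL d : L d `<=` L d.+1.
  move=> a [f [Jf sf fa]]; exists (f * 'X); split; [by rewrite mulrC; exact: JM | | by rewrite coefMX].
  by have [->|f0] := eqVneq f 0; rewrite ?mul0r ?size_poly0 // size_mulX.
have [D DL] := noetherian_acc noA idL incL.
have [S SP] := choice (fun d => noA (L d) (idL d)).
have lift d a : exists f, L d a -> [/\ J f, (size f <= d.+1)%N & f`_d = a].
  by have [[f fP]|n] := pselect (L d a); [exists f | exists 0].
have [l lP] := choice (fun da : nat * A => lift da.1 da.2).
pose G := flatten [seq [seq l (d, a) | a <- S d] | d <- iota 0 D.+1].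
have SL d a : a \in S d -> L d a by move=> aS; rewrite (SP d); exact: gens_in.
have GJ f : f \in G -> J f.
  by move=> /flattenP[_ /mapP[d _ ->] /mapP[a aS ->]]; case: (lP (d, a) (SL d a aS)).
have lead e a : (e <= D)%N -> L e a -> exists f, [/\ gens G f, (size f <= e.+1)%N & f`_e = a].
  move=> eD; have [G0 GD GM] := gens_ideal G.
  suff sub : L e `<=` [set a | exists f, [/\ gens G f, (size f <= e.+1)%N & f`_e = a]].
    by move/sub.
  rewrite {1}(SP e); apply: gens_min => [|x xS /=].
    split=> [|a1 b [f [Jf sf fa]] [g [Jg sg gb]]|a1 b [f [Jf sf fb]]].
    - by exists 0; split; rewrite ?size_poly0 ?coef0.
    - exists (f + g); split; [exact: GD | | by rewrite coefD fa gb].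
      by rewrite (leq_trans (size_polyD _ _)) // geq_max sf.
    - exists (a1 *: f); split; [by rewrite -mul_polyC; exact: GM | | by rewrite coefZ fb].
      exact: leq_trans (size_scale_leq _ _) sf.
  exists (l (e, x)); case: (lP (e, x) (SL e x xS)) => _ h1 h2; split=> //.
  apply: gens_in; apply/flattenP; exists [seq l (e, a) | a <- S e]; last exact: map_f.
  by apply/mapP; exists e; rewrite // mem_iota.
exists G; apply/seteqP; split; last exact: gens_min.
suff main d f : (size f <= d)%N -> J f -> gens G f by move=> f; exact: main (leqnn _).
elim: d f => [|d IH] f sf Jf.
  move: sf; rewrite leqn0 size_poly_eq0 => /eqP ->.
  by case: (gens_ideal G).
have [e [ed eD ef]] : exists e, [/\ (e <= d)%N, (e <= D)%N & L e f`_d].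
  have Lf : L d f`_d by exists f.
  by have [dD|/ltnW Dd] := leqP d D; [exists d | exists D; split=> //; exact: DL Lf].
have [g [Gg sg ge]] := lead e _ eD ef.
have [_ GD GM] := gens_ideal G.
have Gg' : gens G ('X^(d - e) * g) by exact: GM.
rewrite -[f](subrK ('X^(d - e) * g)); apply: GD => //; apply: IH.
  have sz : (size (f - 'X^(d - e) * g)%R <= d.+1)%N.
    rewrite (leq_trans (size_polyD _ _)) // geq_max sf size_polyN.
    have [->|g0] := eqVneq g 0; first by rewrite mulr0 size_poly0.
    by rewrite mulrC size_mulXn // (leq_trans (leq_add (leqnn _) sg)) // addnS subnK.
  apply/leq_sizeP => j; rewrite leq_eqVlt => /orP[/eqP <-|dj].
    by rewrite coefB mulrC coefMXn ltnNge leq_subr /= subKn // ge subrr.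
  by move/leq_sizeP: sz => ->.
apply: (ideal_sub idJ) => //; move: Gg'; exact: gens_min.
Qed.

End HilbertBasis.

Section Krull.
Variable A : comNzRingType.
Implicit Types (I J N : set A) (a b x : A) (s l : seq A).
Notation mm := (@maxideal A).

Lemma nilpotent_gens s I : is_ideal I ->
  (forall x, x \in s -> exists k, I (x ^+ k)) ->
  exists k, forall l, size l = k -> (forall x, x \in l -> gens s x) -> I (\prod_(x <- l) x).
Proof.
move=> idI; have [I0 ID IM] := idI.
elim: s => [|x s IH] hs.
  exists 1%N => -[//|y [|//]] _ /(_ y (mem_head _ _)); rewrite gens_nil => /= ->.
  by rewrite big_seq1.
have [|k' hk'] := IH; first by move=> y ys; apply: hs; rewrite in_cons ys orbT.
have [k xk] := hs x (mem_head _ _).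
suff main j : exists K, forall l, size l = K -> (forall y, y \in l -> gens (x :: s) y) ->
    I (\prod_(y <- l) y * x ^+ (k - j)).
  by have [K KP] := main k; exists K => l ls lx; have := KP l ls lx; rewrite subnn mulr1.
elim: j => [|j [K KP]]; first by exists 0%N => l _ _; rewrite subn0; exact: IM.
have [kj|kj] := leqP k j.
  by exists K; have -> : (k - j.+1 = k - j)%N by lia.
exists (k' + K)%N => l ls lx.
rewrite -(cat_take_drop k' l) big_cat /=.
have [c [v [Iv ->]]] : exists c v, I v /\ \prod_(y <- take k' l) y = c * x + v.
  suff : exists c l', [/\ size l' = size (take k' l), (forall y, y \in l' -> gens s y)
      & \prod_(y <- take k' l) y = c * x + \prod_(y <- l') y].
    move=> [c [l' [sl' l's ->]]]; exists c, (\prod_(y <- l') y); split=> //.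
    by apply: hk' => //; rewrite sl' size_take ls; case: ltnP => //; lia.
  have : forall y, y \in take k' l -> gens (x :: s) y by move=> y /mem_take /lx.
  elim: (take k' l) => [|y r IHr] ry; first by exists 0, [::]; rewrite big_nil mul0r add0r.
  have [|c [l' [sl' l's e]]] := IHr; first by move=> z zr; apply: ry; rewrite in_cons zr orbT.
  have := ry y (mem_head _ _); rewrite gens_cons => -[b [w [sw yE]]].
  exists (c * (b * x + w) + b * \prod_(z <- l') z), (w :: l'); split.
  - by rewrite /= sl'.
  - by move=> z; rewrite in_cons => /orP[/eqP ->|/l's].
  - by rewrite !big_cons e yE; ring.
have -> : (c * x + v) * (\prod_(y <- drop k' l) y) * x ^+ (k - j.+1) =
    c * (\prod_(y <- drop k' l) y * x ^+ (k - j)) + \prod_(y <- drop k' l) y * x ^+ (k - j.+1) * v.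
  have -> : (k - j = (k - j.+1).+1)%N by lia.
  by move: (k - j.+1)%N (\prod_(_ <- _) _) => e q; rewrite [x ^+ e.+1]exprS; ring.
apply: ID; apply: IM => //; apply: KP; first by rewrite size_drop ls addKn.
by move=> y /mem_drop /lx.
Qed.

Hypothesis mm_ideal : is_ideal mm.
Hypothesis noA : noetherian A.

Lemma mm_proper : ~ mm 1.
Proof. by apply; exists 1; rewrite mulr1. Qed.

Lemma mm_unit a : mm a -> exists u, u * (1 - a) = 1.
Proof.
move=> ma; apply: contrapT => no; apply: mm_proper.
rewrite -[1](subrK a); case: mm_ideal => _ mD _; apply: mD => //.
by move=> [u au]; apply: no; exists u; rewrite mulrC.
Qed.

(** Nakayama's lemma; the last hypothesis says that N = m N + J. *)
Lemma nakayama J N : is_ideal J -> is_ideal N -> J `<=` N ->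
  (forall I, is_ideal I -> J `<=` I -> (forall m b, mm m -> N b -> I (m * b)) -> N `<=` I) ->
  N `<=` J.
Proof.
move=> idJ idN JN nak; have [s sN] := noA idN; have [_ mD mM] := mm_ideal.
pose H l := foldr (fun x I => adjoin I x) J l.
have idH l : is_ideal (H l) by elim: l => //= x l; exact: adjoin_ideal.
have JH l : J `<=` H l by elim: l => //= x l IH u /IH; exact: adjoin_sub.
suff main l : (forall x, x \in l -> N x) -> N `<=` H l -> N `<=` J.
  apply: (main s); rewrite sN; first exact: gens_in.
  apply: gens_min => //; elim: (s) => // x l IH y /=.
  rewrite in_cons => /orP[/eqP ->|/IH]; first exact: adjoin_in.
  exact: adjoin_sub.
elim: l => // x l IH lN NH; apply: IH => [y yl|]; first by apply: lN; rewrite in_cons yl orbT.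
have [H0 HD HM] := idH l; have [N0 ND NM] := idN.
have idI : is_ideal [set a | exists m v, [/\ mm m, H l v & a = m * x + v]].
  split=> [|a b [m [v [hm hv ->]]] [m' [v' [hm' hv' ->]]]|a b [m [v [hm hv ->]]]].
  - by exists 0, 0; split; rewrite ?mul0r ?addr0 //; case: mm_ideal.
  - by exists (m + m'), (v + v'); split; [exact: mD | exact: HD | ring].
  - by exists (a * m), (a * v); split; [exact: mM | exact: HM | ring].
have Nx : N x by apply: lN; exact: mem_head.
have [m [v [hm hv xE]]] : exists m v, [/\ mm m, H l v & x = m * x + v].
  apply: (nak _ idI) => // [u Ju|m b hm /NH[c [v [hv ->]]]].
    by exists 0, u; split; rewrite ?mul0r ?add0r //; [case: mm_ideal | exact: JH].
  by exists (m * c), (m * v); split; [rewrite mulrC; exact: mM | exact: HM | ring].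
have [u um] := mm_unit hm.
have Hx : H l x.
  have -> : x = u * v.
    have -> : v = (1 - m) * x by rewrite mulrBl mul1r {1}xE; ring.
    by rewrite mulrA um mul1r.
  exact: HM.
by move=> y /NH; apply: adjoin_min.
Qed.

(** With N the intersection of the J + m^k, an ideal I containing mN + J and
    maximal among those with the same trace on N contains a power of m, hence N.
    So N = mN + J, and N = J by Nakayama's lemma. *)
Lemma krull_intersection J a : is_ideal J ->
  (forall k, exists u v, [/\ J u, idpow mm k v & a = u + v]) -> J a.
Proof.
move=> idJ; have [J0 JD JM] := idJ.
pose N : set A := [set a | forall k, exists u v, [/\ J u, idpow mm k v & a = u + v]].
have idp k : is_ideal (idpow mm k) by exact: gen_idealP.
have idN : is_ideal N.
  split=> [k|b c Nb Nc k|b c Nc k]; have [p0 pD pM] := idp k.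
  - by exists 0, 0; rewrite addr0.
  - have [u [v [Ju pv ->]]] := Nb k; have [u' [v' [Ju' pv' ->]]] := Nc k.
    by exists (u + u'), (v + v'); split; [exact: JD | exact: pD | rewrite addrACA].
  - have [u [v [Ju pv ->]]] := Nc k.
    by exists (b * u), (b * v); split; [exact: JM | exact: pM | rewrite mulrDr].
have [N0 ND NM] := idN.
have JN : J `<=` N.
  by move=> u Ju k; exists u, 0; split; rewrite ?addr0 //; case: (idp k).
pose Q : set A := gen_ideal (J `|` [set c | exists m b, [/\ mm m, N b & c = m * b]]).
have idQ : is_ideal Q by exact: gen_idealP.
have JQ : J `<=` Q by move=> u Ju; apply: sub_gen_ideal; left.
have mNQ m b : mm m -> N b -> Q (m * b) by move=> hm Nb; apply: sub_gen_ideal; right; exists m, b.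
pose F : set (set A) := [set I | [/\ is_ideal I, Q `<=` I & forall b, I b -> N b -> Q b]].
have idF I : F I -> is_ideal I by case.
have [|I [idI QI IN] Imax] := noetherian_max noA idF; first by exists Q; split.
have [I0 ID IM] := idI.
have pw x : mm x -> exists k, I (x ^+ k).
  move=> mx; pose C k : set A := [set b | I (x ^+ k * b)].
  have idC k : is_ideal (C k).
    split=> [|b c Ib Ic|b c Ic]; rewrite /C /= ?mulr0 //; first by rewrite mulrDr; exact: ID.
    by rewrite mulrCA; exact: IM.
  have incC k : C k `<=` C k.+1.
    by move=> b Ib; rewrite /C /= exprS -mulrA; exact: IM.
  have [k kC] := noetherian_acc noA idC incC.
  exists k; apply: (Imax (adjoin I (x ^+ k))).
  - split; first exact: adjoin_ideal.
      by move=> u /QI; exact: adjoin_sub.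
    move=> e [b [i [Ii eE]]] Ne; apply: IN => //; rewrite eE; apply: ID => //.
    rewrite mulrC; apply: (kC k.+1); rewrite /C /= exprS.
    have -> : x * x ^+ k * b = x * e - x * i by rewrite eE; ring.
    by apply: (ideal_sub idI); [apply: QI; exact: mNQ | exact: IM].
  - exact: adjoin_sub.
  - exact: adjoin_in.
have [s sm] := noA mm_ideal.
have [k kI] : exists k, idpow mm k `<=` I.
  have [|k hk] := @nilpotent_gens s I idI; first by move=> x xs; apply: pw; rewrite sm; exact: gens_in.
  exists k; apply: idpow_min => // l sl lm; apply: hk => // x /lm.
  by rewrite {1}sm.
have NI : N `<=` I.
  move=> b /(_ k)[u [v [Ju pv ->]]]; apply: ID; last exact: kI.
  by apply: QI; exact: JQ.
have NQ : N `<=` Q by move=> b Nb; apply: IN => //; exact: NI.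
move=> Na; apply: (nakayama idJ idN JN) Na => I' idI' JI' mI' b /NQ.
apply: gen_ideal_min => // c [/JI'//|[m [b' [hm Nb' ->]]]].
exact: mI'.
Qed.

End Krull.

(** * The local ring of projective space at a point *)

Lemma mpoly_rmorph_eq (K : comNzRingType) n (C : comNzRingType)
    (f g : {rmorphism {mpoly K[n]} -> C}) :
  (forall c, f c%:MP = g c%:MP) -> (forall i, f 'X_i = g 'X_i) -> f =1 g.
Proof.
move=> fgC fgX P; rewrite [P]mpolyE !rmorph_sum; apply: eq_bigr => m _.
rewrite -mul_mpolyC !rmorphM fgC mpolyXE_id !rmorph_prod; congr (_ * _).
by apply: eq_bigr => i _; rewrite !rmorphXn fgX.
Qed.

Lemma cross_eq (E : fieldType) (a b c d : E) : b != 0 -> d != 0 -> a / b = c / d -> a * d = c * b.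
Proof. by move=> b0 d0 /eqP; rewrite eqr_div // => /eqP. Qed.

Section LocalRingP3.
Variables (K : fieldType) (p : 'I_4 -> K).
Hypothesis p0 : p != 0.
Notation S := {mpoly K[4]}.
Notation A := (localP3 p).
Notation mm := (@maxideal A).
Implicit Types (f g a b : A) (F G : S) (P Q : {mpoly K[3]}) (V W : fps 3 K).

Lemma lvD f g : localP3_val (f + g) = localP3_val f + localP3_val g. Proof. by []. Qed.
Lemma lvB f g : localP3_val (f - g) = localP3_val f - localP3_val g. Proof. by []. Qed.
Lemma lvM f g : localP3_val (f * g) = localP3_val f * localP3_val g. Proof. by []. Qed.
Lemma lv1 : localP3_val (1 : A) = 1. Proof. by []. Qed.
HB.instance Definition _ := GRing.isZmodMorphism.Build _ _ (@localP3_val K p) lvB.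
HB.instance Definition _ := GRing.isMonoidMorphism.Build _ _ (@localP3_val K p) (lv1, lvM).
Lemma lv_inj : injective (@localP3_val K p). Proof. exact: val_inj. Qed.

Fact cstP3_additive : zmod_morphism (@cstP3 K p).
Proof. by move=> c d; apply: lv_inj; rewrite lvB /= mpolyCB tofracB. Qed.
Fact cstP3_multiplicative : monoid_morphism (@cstP3 K p).
Proof.
split=> [|c d]; apply: lv_inj; first by rewrite /= mpolyC1 tofrac1.
by rewrite lvM /= mpolyCM tofracM.
Qed.
HB.instance Definition _ := GRing.isZmodMorphism.Build _ _ (@cstP3 K p) cstP3_additive.
HB.instance Definition _ := GRing.isMonoidMorphism.Build _ _ (@cstP3 K p) cstP3_multiplicative.

Definition quot_of f d F G :=
  [/\ F \is d.-homog, G \is d.-homog, G.@[p] != 0 &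
      localP3_val f = tofrac F / tofrac G].

Lemma quot_ex f : exists d F G, quot_of f d F G.
Proof.
by case: f => f /= fp; case/asboolP: (fp) => d [F [G h]]; exists d, F, G.
Qed.

Lemma quot_mk d F G : F \is d.-homog -> G \is d.-homog -> G.@[p] != 0 ->
  exists f, quot_of f d F G.
Proof.
move=> hF hG Gp; have fp : tofrac F / tofrac G \in local_pred p.
  by apply/asboolP; exists d, F, G.
by exists (LocalP3 fp).
Qed.

Lemma denom_neq0 G : G.@[p] != 0 -> tofrac G != 0.
Proof. by apply: contraNneq => /eqP; rewrite tofrac_eq0 => /eqP ->; rewrite meval0. Qed.

Lemma quot_cross f d F G d' F' G' : quot_of f d F G -> quot_of f d' F' G' ->
  F * G' = F' * G.
Proof.
move=> [_ _ /denom_neq0 nG e] [_ _ /denom_neq0 nG' e'].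
apply/eqP; rewrite -(tofrac_eq (F * G') (F' * G)) (tofracM F G') (tofracM F' G).
by apply/eqP; apply: (cross_eq nG nG'); rewrite -e -e'.
Qed.

Lemma ex_coord : exists i, p i != 0.
Proof.
apply: contrapT => no; case/eqP: p0; apply/funext => i.
by apply: contrapT => /eqP pi; apply: no; exists i.
Qed.

Definition i0 := projT1 (cid ex_coord).
Lemma p_i0 : p i0 != 0. Proof. exact: projT2 (cid ex_coord). Qed.

Definition affp i := p i / p i0.

(** Affine coordinates centred at the point, on the chart x_i0 = 1. *)
Definition dehom_var (i : 'I_4) : {mpoly K[3]} :=
  if unlift i0 i is Some j then 'X_j + (affp i)%:MP else 1.
Definition dehom : S -> {mpoly K[3]} := mmap (@mpolyC 3 K) dehom_var.
HB.instance Definition _ := GRing.RMorphism.on dehom.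

Lemma dehomC c : dehom c%:MP = c%:MP. Proof. exact: mmapC. Qed.
Lemma dehom_i0 : dehom 'X_i0 = 1.
Proof. by rewrite /dehom mmapX mmap1U /dehom_var unlift_none. Qed.
Lemma dehom_lift j : dehom 'X_(fintype.lift i0 j) = 'X_j + (affp (fintype.lift i0 j))%:MP.
Proof. by rewrite /dehom mmapX mmap1U /dehom_var liftK. Qed.

Lemma meval_homog d F : F \is d.-homog -> F.@[p] = p i0 ^+ d * F.@[affp].
Proof.
move=> hF; rewrite !mevalE mulr_sumr; apply: eq_big_seq => m mF.
have <- : mdeg m = d := dhomog_mf hF mF.
rewrite mdegE -prodrXr mulrCA -big_split /=; congr (_ * _).
by apply: eq_bigr => i _; rewrite -exprMn /affp mulrCA divff ?p_i0 ?mulr1.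
Qed.

Lemma dehom_coef0 F : (dehom F)@_0%MM = F.@[affp].
Proof.
apply: (@mpoly_rmorph_eq _ _ _ (mcoeff 0%MM \o dehom) (meval affp)) => [c|i] /=.
  by rewrite dehomC mcoeffC eqxx mulr1 mevalC.
rewrite mevalXU; have [j ->|->] := unliftP i0 i.
  by rewrite dehom_lift mcoeffD mcoeffX mcoeffC eqxx mulr1 mnm1_eq0 add0r.
by rewrite dehom_i0 mcoeff1 eqxx /affp divff ?p_i0.
Qed.

Lemma dehom_unit d G : G \is d.-homog -> (G.@[p] != 0) = ((dehom G)@_0%MM != 0).
Proof.
by move=> hG; rewrite dehom_coef0 (meval_homog hG) mulf_eq0 expf_eq0 (negbTE p_i0) andbF.
Qed.

Lemma std_param_proof j : tofrac ('X_(fintype.lift i0 j) - (affp (fintype.lift i0 j))%:MP * 'X_i0) /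
  tofrac ('X_i0 : S) \in local_pred p.
Proof.
have hX i : ('X_i : S) \is 1.-homog by rewrite dhomogX /= mdeg1.
apply/asboolP; exists 1%N, ('X_(fintype.lift i0 j) - (affp (fintype.lift i0 j))%:MP * 'X_i0), 'X_i0.
split=> //; last by rewrite mevalXU p_i0.
by rewrite mul_mpolyC; apply: rpredB => //; exact: rpredZ.
Qed.

Definition std_param j : A := LocalP3 (std_param_proof j).

Definition peval (x : 'I_3 -> A) : {mpoly K[3]} -> A := mmap (@cstP3 K p) x.
HB.instance Definition _ x := GRing.RMorphism.on (peval x).

Lemma pevalC x c : peval x c%:MP = cstP3 p c. Proof. exact: mmapC. Qed.
Lemma pevalX x m : peval x 'X_[m] = \prod_j x j ^+ m j.
Proof. by rewrite /peval mmapX. Qed.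
Lemma pevalU x j : peval x 'X_j = x j.
Proof. by rewrite /peval mmapX mmap1U. Qed.
Lemma pevalZ x c P : peval x (c *: P) = cstP3 p c * peval x P.
Proof. by rewrite -mul_mpolyC rmorphM /= pevalC. Qed.

Lemma homog_dehom d F : F \is d.-homog ->
  localP3_val (peval std_param (dehom F)) = tofrac F / tofrac ('X_i0 ^+ d).
Proof.
move=> hF; have X0 : tofrac ('X_i0 : S) != 0 by apply: denom_neq0; rewrite mevalXU p_i0.
pose lvm : {rmorphism A -> {fraction S}} := @localP3_val K p.
pose eta : S -> {fraction S} := mmap (@tofrac S \o @mpolyC 4 K) (fun i => tofrac 'X_i / tofrac 'X_i0).
pose etam : {rmorphism S -> {fraction S}} := mmap (@tofrac S \o @mpolyC 4 K) (fun i => tofrac 'X_i / tofrac 'X_i0).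
have -> : localP3_val (peval std_param (dehom F)) = eta F.
  apply: (@mpoly_rmorph_eq _ _ _ (lvm \o peval std_param \o dehom) etam) => [c|i] /=.
    by rewrite dehomC pevalC mmapC.
  rewrite mmapX mmap1U; have [j ->|->] := unliftP i0 i.
    rewrite dehom_lift rmorphD /= pevalU pevalC /= tofracB tofracM mulrBl mulfK //.
    by rewrite subrK.
  by rewrite dehom_i0 rmorph1 lv1 divff.
rewrite /eta /mmap [in RHS](mpolyE F) raddf_sum mulr_suml; apply: eq_big_seq => m mF /=.
rewrite -mul_mpolyC tofracM -mulrA; congr (_ * _).
have <- : mdeg m = d := dhomog_mf hF mF.
rewrite /mmap1 mdegE tofracXn -prodrXr (mpolyXE_id _ m) rmorph_prod -prodf_div.
by apply: eq_bigr => i _; rewrite rmorphXn expr_div_n.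
Qed.

Definition taylor_rel f V := exists d F G, quot_of f d F G /\
  V * fps_of_mpoly (dehom G) = fps_of_mpoly (dehom F).

Lemma fps_dehom_neq0 d G : G \is d.-homog -> G.@[p] != 0 -> fps_of_mpoly (dehom G) <> 0.
Proof.
move=> hG; rewrite (dehom_unit hG) => G0 /fpsP/(_ 0%MM) e.
by move: G0; rewrite [_@__]e eqxx.
Qed.

Lemma taylor_ex f : exists V, taylor_rel f V.
Proof.
have [d [F [G fG]]] := quot_ex f; have [hF hG Gp _] := fG.
have [u Gu] : exists u, fps_of_mpoly (dehom G) * u = 1.
  by apply: fps_unit; rewrite -(dehom_unit hG).
exists (fps_of_mpoly (dehom F) * u), d, F, G; split=> //.
by rewrite -mulrA [u * _]mulrC Gu mulr1.
Qed.

Lemma taylor_uniq f V W : taylor_rel f V -> taylor_rel f W -> V = W.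
Proof.
move=> [d [F [G [fG eV]]]] [d' [F' [G' [fG' eW]]]].
have /(congr1 dehom) := quot_cross fG fG'; rewrite !rmorphM => /(congr1 (@fps_of_mpoly 3 K)).
rewrite !rmorphM /= -eV -eW => e.
have [_ hG Gp _] := fG; have [_ hG' Gp' _] := fG'.
apply: (fps_mulfI (fps_dehom_neq0 hG Gp)); apply: (fps_mulfI (fps_dehom_neq0 hG' Gp')).
move: (fps_of_mpoly (dehom G)) (fps_of_mpoly (dehom G')) e => g g' e.
by transitivity (V * g * g'); [ring | rewrite e; ring].
Qed.

(** The expansion of F / G in the affine coordinates is the quotient of the
    dehomogenisations of F and G as power series. *)
Definition taylor0 : A -> fps 3 K := projT1 (choice taylor_ex).
Lemma taylor0P f : taylor_rel f (taylor0 f). Proof. exact: (projT2 (choice taylor_ex)). Qed.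
Lemma taylor0E f V : taylor_rel f V -> taylor0 f = V.
Proof. exact: taylor_uniq (taylor0P f). Qed.

Fact taylor0_additive : zmod_morphism taylor0.
Proof.
move=> f g; apply: taylor0E.
have [d [F [G [[hF hG Gp fG] eV]]]] := taylor0P f.
have [d' [F' [G' [[hF' hG' Gp' gG'] eW]]]] := taylor0P g.
exists (d + d')%N, (F * G' - F' * G), (G * G'); split; last first.
  by rewrite rmorphB !rmorphM rmorphB !rmorphM /= -eV -eW; ring.
split; [| exact: dhomogM | by rewrite mevalM mulf_neq0 |].
  by apply: rpredB; [|rewrite addnC]; apply: dhomogM.
by rewrite lvB fG gG' -mulNr addf_div ?denom_neq0 // mulNr -!tofracM -tofracB.
Qed.

Fact taylor0_multiplicative : monoid_morphism taylor0.
Proof.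
split=> [|f g]; apply: taylor0E.
  exists 0%N, 1, 1; split; last by rewrite !rmorph1 mulr1.
  by split; rewrite ?dhomog1 ?meval1 ?oner_neq0 // tofrac1 divr1.
have [d [F [G [[hF hG Gp fG] eV]]]] := taylor0P f.
have [d' [F' [G' [[hF' hG' Gp' gG'] eW]]]] := taylor0P g.
exists (d + d')%N, (F * F'), (G * G'); split; last first.
  by rewrite !rmorphM /= -eV -eW; ring.
split; [exact: dhomogM | exact: dhomogM | by rewrite mevalM mulf_neq0 |].
by rewrite lvM fG gG' mulf_div -!tofracM.
Qed.

HB.instance Definition _ := GRing.isZmodMorphism.Build _ _ taylor0 taylor0_additive.
HB.instance Definition _ := GRing.isMonoidMorphism.Build _ _ taylor0 taylor0_multiplicative.

Lemma taylor0_cst c : taylor0 (cstP3 p c) = cst c.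
Proof.
apply: taylor0E; exists 0%N, c%:MP, 1; split; last by rewrite rmorph1 mulr1 dehomC.
split; rewrite ?dhomog1 ?meval1 ?oner_neq0 ?tofrac1 ?divr1 //.
by rewrite -[c%:MP]mulr1 mul_mpolyC rpredZ // dhomog1.
Qed.

Lemma taylor0_param j : taylor0 (std_param j) = fps_of_mpoly 'X_j.
Proof.
have hX i : ('X_i : S) \is 1.-homog by rewrite dhomogX /= mdeg1.
apply: taylor0E; exists 1%N, ('X_(fintype.lift i0 j) - (affp (fintype.lift i0 j))%:MP * 'X_i0), 'X_i0.
split; last by rewrite dehom_i0 rmorph1 mulr1 rmorphB rmorphM /= dehom_lift dehomC dehom_i0 mulr1 addrK.
split=> //; last by rewrite mevalXU p_i0.
by rewrite mul_mpolyC; apply: rpredB => //; exact: rpredZ.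
Qed.

Lemma taylor0_peval P : taylor0 (peval std_param P) = fps_of_mpoly P.
Proof.
apply: (@mpoly_rmorph_eq _ _ _ (taylor0 \o peval std_param) (@fps_of_mpoly 3 K)) => [c|i] /=.
  by rewrite pevalC taylor0_cst.
by rewrite pevalU taylor0_param.
Qed.

(** The value of a germ at the point, as the constant term of its expansion. *)
Definition lev f : K := taylor0 f 0%MM.

Fact lev_additive : zmod_morphism lev.
Proof. by move=> f g; rewrite /lev raddfB fpsB. Qed.
Fact lev_multiplicative : monoid_morphism lev.
Proof. by split=> [|f g]; rewrite /lev ?rmorph1 ?fps1 ?eqxx // rmorphM fpsM0. Qed.
HB.instance Definition _ := GRing.isZmodMorphism.Build _ _ lev lev_additive.
HB.instance Definition _ := GRing.isMonoidMorphism.Build _ _ lev lev_multiplicative.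

Lemma lev_cst c : lev (cstP3 p c) = c.
Proof. by rewrite /lev taylor0_cst /cst /fps_of_mpoly mcoeffC eqxx mulr1. Qed.

Lemma lev_unit f : lev f != 0 -> exists g, f * g = 1.
Proof.
have [d [F [G [[hF hG Gp fG] e]]]] := taylor0P f => f0.
have Fp : F.@[p] != 0.
  rewrite (dehom_unit hF); have /fpsP/(_ 0%MM) := e; rewrite fpsM0 => e0.
  rewrite -[_@__]/(fps_of_mpoly _ _) -e0 mulf_neq0 //.
  by move: Gp; rewrite (dehom_unit hG).
have [g [_ _ _ gE]] := quot_mk hG hF Fp.
exists g; apply: lv_inj; rewrite lvM lv1 fG gE mulf_div [X in _ / X]mulrC divff //.
by rewrite mulf_neq0 ?denom_neq0.
Qed.

Lemma mmP f : mm f <-> lev f = 0.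
Proof.
split=> [nf|f0 [g fg]].
  by apply: contrapT => /eqP /lev_unit[g fg]; apply: nf; exists g.
by have /eqP := rmorphM lev f g; rewrite fg rmorph1 /= f0 mul0r oner_eq0.
Qed.

Lemma mm_ideal : is_ideal mm.
Proof.
split=> [|a b|a b]; rewrite !mmP ?rmorph0 ?rmorphD ?rmorphM //=.
  by move=> -> ->; rewrite addr0.
by move=> ->; rewrite mulr0.
Qed.

Lemma mm_split f : mm (f - cstP3 p (lev f)).
Proof. by rewrite mmP raddfB /= lev_cst subrr. Qed.

(** A form is determined by its dehomogenisation. *)
Lemma taylor0_eq0 h : taylor0 h = 0 -> h = 0.
Proof.
move=> h0.
have [d [F [G [[hF hG Gp fG] e]]]] := taylor0P h.
have F0 : dehom F = 0.
  by apply/mpolyP => m; have /fpsP/(_ m) := e; rewrite h0 mul0r mcoeff0.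
have := homog_dehom hF; rewrite F0 rmorph0 => /esym/eqP.
rewrite [X in _ == X](_ : _ = 0) // mulf_eq0 invr_eq0 tofracXn expf_eq0.
rewrite [tofrac ('X_ _)  == _](_ : _ = false) ?andbF ?orbF => [/eqP F00|].
  by apply: lv_inj; rewrite fG F00 mul0r.
by apply/negbTE; apply: denom_neq0; rewrite mevalXU p_i0.
Qed.

End LocalRingP3.

(** * Regular parameters and Taylor expansions *)

Section IdealPowers.
Variable A : comPzRingType.
Implicit Types (X : set A) (a b : A).

Lemma idpow_ideal X k : is_ideal (idpow X k). Proof. exact: gen_idealP. Qed.

Lemma idpow_prod X k l : size l = k -> (forall x, x \in l -> X x) -> idpow X k (\prod_(x <- l) x).
Proof. by move=> sl lX; apply: sub_gen_ideal; exists l. Qed.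

Lemma idpow0 X a : idpow X 0 a.
Proof.
apply: (ideal1 (idpow_ideal X 0)); rewrite -(big_nil 1 *%R xpredT id).
exact: (@idpow_prod X 0 [::]).
Qed.

Lemma idpow_mul X j k a b : idpow X j a -> idpow X k b -> idpow X (j + k) (a * b).
Proof.
move=> ha hb; have [I0 ID IM] := idpow_ideal X (j + k).
move: a ha; apply: idpow_min => [|l sl lX].
  split=> [|a a' /= h h'|c a /= h]; rewrite ?mul0r ?mulrDl //; first exact: ID.
  by rewrite -mulrA; exact: IM.
move: b hb; apply: idpow_min => [|r sr rX].
  split=> [|a a' /= h h'|c a /= h]; rewrite ?mulr0 ?mulrDr //; first exact: ID.
  by rewrite mulrCA; exact: IM.
rewrite -big_cat; apply: idpow_prod; first by rewrite size_cat sl sr.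
by move=> x; rewrite mem_cat => /orP[/lX|/rX].
Qed.

Lemma idpow_in X a : X a -> idpow X 1 a.
Proof.
move=> Xa; rewrite -[a](big_seq1 *%R a id); apply: idpow_prod => // x.
by rewrite inE => /eqP ->.
Qed.

Lemma idpowX X a k : X a -> idpow X k (a ^+ k).
Proof.
move=> Xa; elim: k => [|k IH]; first exact: idpow0.
by rewrite exprS; apply: (@idpow_mul _ 1) => //; exact: idpow_in.
Qed.

Lemma idpow_le X j k a : (j <= k)%N -> idpow X k a -> idpow X j a.
Proof.
move=> jk; move: a; apply: idpow_min; first exact: idpow_ideal.
move=> l sl lX; rewrite -(cat_take_drop j l) big_cat /=.
apply: (ideal_mulr _ (idpow_ideal X j)).
by apply: idpow_prod; [rewrite size_takel ?sl | move=> x /mem_take /lX].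
Qed.

End IdealPowers.

Section NoetherianTools.

Lemma noetherian_field (K : fieldType) : noetherian K.
Proof.
move=> I idI; have [[x Ix x0]|no] := pselect (exists2 x, I x & x <> 0).
  exists [:: 1]; apply/seteqP; split=> a _.
    by rewrite -[a]mulr1; case: (gens_ideal [:: (1 : K)]) => _ _; apply; apply: gens_in; exact: mem_head.
  rewrite -(@divfK _ x _ a); last exact/eqP.
  by case: idI => _ _; apply.
exists [::]; rewrite gens_nil; apply/seteqP; split=> a; last by move=> ->; case: idI.
by move=> Ia; apply: contrapT => a0; apply: no; exists a.
Qed.

(** For images and localisations: up to a unit every element of C comes from B. *)
Lemma noetherian_image (B C : comNzRingType) (phi : {rmorphism B -> C}) : noetherian B ->
  (forall c, exists b v w, v * w = 1 /\ phi b = v * c) -> noetherian C.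
Proof.
move=> noB onto I idI; have [I0 ID IM] := idI.
have idpI : is_ideal [set b | I (phi b)].
  split=> [|a b|a b] /=; rewrite ?rmorph0 ?rmorphD ?rmorphM //; [exact: ID | exact: IM].
have [s sI] := noB _ idpI.
exists (map phi s); apply/seteqP; split.
  move=> c Ic; have [b [v [w [vw bc]]]] := onto c.
  have [J0 JD JM] := gens_ideal (map phi s).
  suff : gens (map phi s) (phi b).
    by move=> h; rewrite -[c]mul1r -vw [v * w]mulrC -mulrA -bc; exact: JM.
  have : [set b | I (phi b)] b by rewrite /= bc; exact: IM.
  rewrite sI; apply: (@gens_min _ s [set b | gens (map phi s) (phi b)]) => [|x xs /=].
    split=> [|a b'|a b'] /=; rewrite ?rmorph0 ?rmorphD ?rmorphM //; [exact: JD | exact: JM].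
  by apply: gens_in; exact: map_f.
apply: gens_min => // _ /mapP[x xs ->].
suff : [set b | I (phi b)] x by [].
by rewrite sI; exact: gens_in.
Qed.

Variables (B C : comNzRingType) (f : {rmorphism B -> C}) (c : C).
Lemma ext_comm : commr_rmorph f c. Proof. by move=> b; exact: mulrC. Qed.
Definition ext : {poly B} -> C := horner_morph ext_comm.
HB.instance Definition _ := GRing.RMorphism.on ext.
Lemma extC b : ext b%:P = f b. Proof. exact: horner_morphC. Qed.
Lemma extX : ext 'X = c. Proof. exact: horner_morphX. Qed.

End NoetherianTools.

Lemma frac_cancel (E : fieldType) (a b c : E) : b != 0 -> a / c = (b / c) * (a / b).
Proof. by move=> b0; rewrite [a / b]mulrC mulrACA divff // mul1r mulrC. Qed.

Section RingIdentities.
Variable E : comNzRingType.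
Implicit Types a b u v t : E.
Lemma sub_sub_cancel a u v : u - v = (a - v) - (a - u). Proof. ring. Qed.
Lemma sub_exchange a b u v : a - b - (u - v) = (a - u) - (b - v). Proof. ring. Qed.
Lemma mul_approx a b u v t : a * b - t = b * (a - u) + u * (b - v) + (u * v - t).
Proof. ring. Qed.
End RingIdentities.

Section LocalCoordinates.
Variables (K : fieldType) (p : 'I_4 -> K).
Hypothesis p0 : p != 0.
Notation A := (localP3 p).
Notation mm := (@maxideal A).
Notation cstA := (@cstP3 K p).
Implicit Types (a b : A) (P Q : {mpoly K[3]}) (V W : fps 3 K) (x : 'I_3 -> A).

Let idmm : is_ideal mm := mm_ideal p0.

Lemma taylor0_idpow k a : idpow mm k a -> ordge k (taylor0 p0 a).
Proof.
move: a; apply: idpow_min => [|l sl lm].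
  split=> [|a b /= ha hb|a b /= hb]; rewrite ?rmorph0 ?rmorphD ?rmorphM //=.
    exact: ordgeD.
  exact: ordgeMl.
rewrite -{k}sl; elim: l lm => [|y l IH] lm //.
rewrite big_cons rmorphM /= -(add1n (size l)); apply: ordgeM; last first.
  by apply: IH => z zl; apply: lm; rewrite in_cons zl orbT.
move=> m; rewrite ltnS leqn0 mdeg_eq0 => /eqP ->.
by have /(mmP p0) := lm y (mem_head _ _).
Qed.

Lemma idpow_monomial x m : (forall j, mm (x j)) -> idpow mm (mdeg m) (peval x 'X_[m]).
Proof.
move=> xm; rewrite pevalX mdegE.
elim/big_ind2: _ => [|a i b j|i _]; [exact: idpow0 | exact: idpow_mul | exact: idpowX].
Qed.

Lemma peval_ordge x k P : (forall j, mm (x j)) -> ordge k (fps_of_mpoly P) ->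
  idpow mm k (peval x P).
Proof.
move=> xm oP; rewrite [P]mpolyE rmorph_sum; have [I0 ID IM] := idpow_ideal mm k.
elim/big_ind: _ => // m _; rewrite /= pevalZ.
have [km|mk] := leqP k (mdeg m); first by apply: IM; apply: (idpow_le km); apply: idpow_monomial.
by have := oP m mk; rewrite /fps_of_mpoly => ->; rewrite rmorph0 mul0r.
Qed.

(** Up to a power of a coordinate, F / G is the dehomogenisation of F divided by that
    of G. *)
Lemma germ_dehom a : exists u P W, a = u * peval (std_param p0) P /\
  fps_of_mpoly P = W * taylor0 p0 a.
Proof.
have [d [F [G [[hF hG Gp aE] e]]]] := taylor0P p0 a.
have hX : ('X_(i0 p0) : {mpoly K[4]}) ^+ d \is d.-homog.
  have h1 : ('X_(i0 p0) : {mpoly K[4]}) \is 1.-homog by rewrite dhomogX /= mdeg1.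
  by have := dhomogMn d h1; rewrite mul1n.
have X0 : tofrac ('X_(i0 p0) ^+ d : {mpoly K[4]}) != 0.
  by apply: (@denom_neq0 K p); rewrite rmorphXn /= mevalXU expf_neq0 // p_i0.
have [u [_ _ _ uE]] := quot_mk hX hG Gp.
exists u, (dehom p0 F), (fps_of_mpoly (dehom p0 G)); split; last by rewrite -e mulrC.
apply: lv_inj; rewrite lvM aE uE (homog_dehom p0 hF).
exact: frac_cancel.
Qed.

Lemma std_mm j : mm (std_param p0 j).
Proof. by apply/(mmP p0); rewrite /lev taylor0_param /fps_of_mpoly mcoeffX mnm1_eq0. Qed.

Definition lin x : set A := [set a | exists b : 'I_3 -> A, a = \sum_j b j * x j].

Lemma lin_ideal x : is_ideal (lin x).
Proof.
split=> [|_ _ [b ->] [c ->]|a _ [b ->]].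
- by exists (fun=> 0); rewrite big1 // => j _; rewrite mul0r.
- by exists (fun j => b j + c j); rewrite -big_split; apply: eq_bigr => j _; rewrite mulrDl.
- by exists (fun j => a * b j); rewrite mulr_sumr; apply: eq_bigr => j _; rewrite mulrA.
Qed.

Lemma lin_in x j : lin x (x j).
Proof.
exists (fun i => (i == j)%:R); rewrite (bigD1 j) //= eqxx mul1r big1 ?addr0 // => i /negbTE ->.
by rewrite mul0r.
Qed.

(** Regular parameters: generators of the maximal ideal, as many as the dimension. *)
Definition params x := (forall j, mm (x j)) /\ forall a, mm a -> lin x a.

(** Subtract the value, write the rest in terms of the parameters and repeat with the
    coefficients. *)
Lemma params_approx x k a : params x -> exists P, idpow mm k (a - peval x P).
Proof.
move=> [xm xg]; elim: k a => [|k IH] a; first by exists 0; exact: idpow0.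
have [b ab] := xg _ (@mm_split K p p0 a); have [Q QP] := choice (fun j => IH (b j)).
exists ((lev p0 a)%:MP + \sum_j Q j * 'X_j).
rewrite rmorphD rmorph_sum /= pevalC opprD addrA ab -sumrB.
have [I0 ID IM] := idpow_ideal mm k.+1.
elim/big_ind: _ => // j _; rewrite rmorphM /= pevalU -mulrBl -addn1.
by apply: idpow_mul => //; exact: idpow_in.
Qed.

Lemma params_std : params (std_param p0).
Proof.
split=> [|a ma]; first exact: std_mm.
have [I0 ID IM] := lin_ideal (std_param p0).
have [u [P [W [aE e]]]] := germ_dehom a; rewrite aE; apply: (IM).
have P0 : P@_0%MM = 0.
  have h : taylor0 p0 a 0%MM = 0 by apply/(mmP p0).
  by have /fpsP/(_ 0%MM) := e; rewrite fpsM0 h mulr0.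
rewrite [P]mpolyE rmorph_sum; elim/big_ind: _ => // m _; rewrite /= pevalZ.
have [->|m0] := eqVneq m 0%MM; first by rewrite P0 rmorph0 mul0r.
apply: (IM); have [j mj] : exists j, (U_(j) <= m)%MM.
  apply: contrapT => no; case/eqP: m0; apply/mnmP => j; rewrite mnm0E.
  by apply/eqP/negPn/negP => mj; apply: no; exists j; rewrite lep1mP.
by rewrite -(submK mj) mpolyXD rmorphM; apply: IM; rewrite /= pevalU; exact: lin_in.
Qed.

(** The monomials of degree less than k in the given parameters and in the standard
    ones are expressed through each other by square matrices, which are therefore
    inverse to each other. *)
Lemma params_indep x k P : params x -> idpow mm k (peval x P) -> ordge k (fps_of_mpoly P).
Proof.
move=> px hP; have [xm _] := px.
have [C CP] := choice (fun m : 'X_{1..3 < k} => params_approx k (peval (std_param p0) 'X_[m]) px).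
pose q := #|{: 'X_{1..3 < k}}|.
pose ev (i : 'I_q) : 'X_{1..3 < k} := enum_val i.
pose c : 'M[K]_q := \matrix_(i, j) (C (ev i))@_(ev j).
pose b : 'M[K]_q := \matrix_(i, j) taylor0 p0 (peval x 'X_[ev i]) (ev j).
have expand Q (m : 'X_{1..3 < k}) : taylor0 p0 (peval x Q) m =
    \sum_(i < q) Q@_(ev i) * taylor0 p0 (peval x 'X_[ev i]) m.
  pose Qk : {mpoly K[3]} := \sum_(l : 'X_{1..3 < k}) Q@_l *: 'X_[l].
  have oQ : ordge k (fps_of_mpoly (Q - Qk)).
    by move=> l lk; rewrite /fps_of_mpoly /Qk mcoeffB (mcoeff_mpoly (fun l => Q@_l) lk) subrr.
  have /taylor0_idpow/(_ m (bmdeg m)) := peval_ordge xm oQ.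
  rewrite !rmorphB fpsB => /eqP; rewrite subr_eq0 => /eqP ->.
  rewrite /Qk (raddf_sum (peval x)) (raddf_sum (taylor0 p0)) fps_sum /=.
  rewrite (reindex ev) /=; last by apply: onW_bij; exact: enum_val_bij.
  by apply: eq_bigr => i _; rewrite /= pevalZ rmorphM /= taylor0_cst cstM.
have cb : c *m b = 1%:M.
  apply/matrixP => i j; rewrite !mxE; set m := ev j.
  transitivity (taylor0 p0 (peval x (C (ev i))) m).
    by rewrite expand; apply: eq_bigr => l _; rewrite !mxE.
  have /taylor0_idpow/(_ m (bmdeg m)) := CP (ev i).
  rewrite rmorphB /= taylor0_peval fpsB => /eqP; rewrite subr_eq0 => /eqP <-.
  rewrite /fps_of_mpoly mcoeffX val_eqE.
  by rewrite (inj_eq enum_val_inj).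
pose v : 'rV[K]_q := \row_i P@_(ev i).
have vb : v *m b = 0.
  apply/matrixP => i j; rewrite !mxE.
  rewrite -[RHS](taylor0_idpow hP (bmdeg (ev j))) expand.
  by apply: eq_bigr => l _; rewrite !mxE.
have v0 : v = 0 by rewrite -[v]mulmx1 -(mulmx1C cb) mulmxA vb mul0mx.
move=> m mk; have := congr1 (fun u : 'rV[K]_q => u 0 (enum_rank (BMultinom mk : 'X_{1..3 < k}))) v0.
by rewrite !mxE /ev enum_rankK.
Qed.

Section Taylor.
Variable x : 'I_3 -> A.
Hypothesis px : params x.

Definition trel a V := forall k, idpow mm k (a - peval x (trunc k V)).

Lemma trel_ex a : exists V, trel a V.
Proof.
have [P PP] := choice (fun k => params_approx k a px).
exists (fun m => (P (mdeg m).+1)@_m) => k; set V : fps 3 K := fun m => _.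
have [I0 ID IM] := idpow_ideal mm k.
have -> : a - peval x (trunc k V) = a - peval x (P k) + peval x (P k - trunc k V).
  by rewrite rmorphB addrA subrK.
apply: ID => //; apply: peval_ordge; first by case: px.
move=> m mk; rewrite /fps_of_mpoly mcoeffB coeff_trunc mk /V.
have : idpow mm (mdeg m).+1 (peval x (P k - P (mdeg m).+1)).
  have -> : peval x (P k - P (mdeg m).+1) = (a - peval x (P (mdeg m).+1)) - (a - peval x (P k)).
    by rewrite rmorphB; exact: sub_sub_cancel.
  apply: (ideal_sub (idpow_ideal _ _)) => //; exact: idpow_le mk (PP k).
by move/(params_indep px)/(_ m (ltnSn _)); rewrite /fps_of_mpoly mcoeffB.
Qed.

Lemma trel_uniq a V W : trel a V -> trel a W -> V = W.
Proof.
move=> aV aW; apply/fpsP => m; have := (aV (mdeg m).+1, aW (mdeg m).+1) => -[h1 h2].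
have := ideal_sub (idpow_ideal _ _) h2 h1.
rewrite opprB addrC addrA subrK -rmorphB => /(params_indep px)/(_ m (ltnSn _)).
rewrite /fps_of_mpoly mcoeffB !coeff_trunc ltnSn => /eqP.
by rewrite subr_eq0 => /eqP.
Qed.

(** The coefficients exist by [params_approx], and [params_indep] makes them unique. *)
Definition taylor : A -> fps 3 K := projT1 (choice trel_ex).
Lemma taylorP a : trel a (taylor a). Proof. exact: (projT2 (choice trel_ex)). Qed.
Lemma taylorE a V : trel a V -> taylor a = V.
Proof. exact: trel_uniq (taylorP a). Qed.

Fact taylor_additive : zmod_morphism taylor.
Proof.
move=> a b; apply: taylorE => k.
have -> : trunc k (taylor a - taylor b) = trunc k (taylor a) - trunc k (taylor b).
  by apply/mpolyP => m; rewrite mcoeffB !coeff_trunc; case: ifP; rewrite ?subr0.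
rewrite rmorphB [X in idpow _ _ X]sub_exchange.
by apply: (ideal_sub (idpow_ideal _ _)); exact: taylorP.
Qed.

Lemma trel_peval P : trel (peval x P) (fps_of_mpoly P).
Proof.
move=> k; rewrite -rmorphB; apply: peval_ordge; first by case: px.
by move=> m mk; rewrite /fps_of_mpoly mcoeffB coeff_trunc mk subrr.
Qed.

Fact taylor_multiplicative : monoid_morphism taylor.
Proof.
split=> [|a b]; apply: taylorE; first by have := trel_peval 1; rewrite !rmorph1.
move=> k; have [I0 ID IM] := idpow_ideal mm k.
set Pa := trunc k (taylor a); set Pb := trunc k (taylor b).
rewrite [X in idpow _ _ X](mul_approx _ _ (peval x Pa) (peval x Pb)) -rmorphM -rmorphB.
apply: (ID); first by apply: ID; apply: IM; exact: taylorP.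
apply: peval_ordge; first by case: px.
move=> m mk; rewrite /fps_of_mpoly mcoeffB coeff_trunc mk.
by rewrite (fpsM_trunc _ _ mk) subrr.
Qed.

HB.instance Definition _ := GRing.isZmodMorphism.Build _ _ taylor taylor_additive.
HB.instance Definition _ := GRing.isMonoidMorphism.Build _ _ taylor taylor_multiplicative.

Lemma taylor_peval P : taylor (peval x P) = fps_of_mpoly P.
Proof. exact: taylorE (trel_peval P). Qed.

Lemma taylor_param j : taylor (x j) = fps_of_mpoly 'X_j.
Proof. by rewrite -taylor_peval pevalU. Qed.

Lemma taylor_cst c : taylor (cstA c) = cst c.
Proof. by rewrite /cst -taylor_peval pevalC. Qed.

Lemma taylor_idpow k a : idpow mm k a <-> ordge k (taylor a).
Proof.
rewrite -{1}[a](subrK (peval x (trunc k (taylor a)))).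
have h : idpow mm k (a - peval x (trunc k (taylor a))) by exact: taylorP.
 have [xm _] := px; have [I0 ID IM] := idpow_ideal mm k; split=> [ha|o].
  have : idpow mm k (peval x (trunc k (taylor a))).
    have := ideal_sub (idpow_ideal _ _) ha h; rewrite [X in idpow _ _ X -> _]addrC.
    by rewrite [X in idpow _ _ X -> _]addKr.
  move=> /(params_indep px) o m mk; have := o m mk.
  by rewrite /fps_of_mpoly coeff_trunc mk.
apply: ID => //; apply: peval_ordge => // m mk.
by rewrite /fps_of_mpoly coeff_trunc mk o.
Qed.

Lemma taylor_lev a : taylor a 0%MM = lev p0 a.
Proof.
have /(idpow_in (X := mm)) := @mm_split K p p0 a.
move=> /taylor_idpow/(_ 0%MM); rewrite mdeg0 => /(_ isT).
rewrite rmorphB /= taylor_cst fpsB /cst /fps_of_mpoly mcoeffC eqxx mulr1 => /eqP.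
by rewrite subr_eq0 => /eqP.
Qed.

End Taylor.

(** The ring is a localisation of an image of K[X,Y,Z]. *)
Lemma localP3_noetherian : noetherian A.
Proof.
pose e i : A := std_param p0 (inord i).
pose f1 : {rmorphism {poly K} -> A} := ext cstA (e 0%N).
pose f2 : {rmorphism {poly {poly K}} -> A} := ext f1 (e 1%N).
pose f3 : {rmorphism {poly {poly {poly K}}} -> A} := ext f2 (e 2%N).
have f1C c : f1 c%:P = cstA c := extC _ _ c.
have f2C c : f2 c%:P = f1 c := extC _ _ c.
have f3C c : f3 c%:P = f2 c := extC _ _ c.
have f1X : f1 'X = e 0%N := extX _ _.
have f2X : f2 'X = e 1%N := extX _ _.
have f3X : f3 'X = e 2%N := extX _ _.
apply: (@noetherian_image _ _ f3).
  by do 3! apply: noetherian_poly; exact: noetherian_field.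
have onto P : exists w, f3 w = peval (std_param p0) P.
  pose im (a : A) := exists w, f3 w = a.
  have imD a b : im a -> im b -> im (a + b).
    by move=> [a' <-] [b' <-]; exists (a' + b'); rewrite rmorphD.
  have imM a b : im a -> im b -> im (a * b).
    by move=> [a' <-] [b' <-]; exists (a' * b'); rewrite rmorphM.
  have imC c : im (cstA c) by exists c%:P%:P%:P; rewrite f3C f2C f1C.
  have imX j : im (std_param p0 j).
    have -> : j = inord (val j) by apply: val_inj; rewrite /= inordK.
    case: j => -[|[|[|//]]] /= _.
    - by exists ('X%:P%:P); rewrite f3C f2C f1X.
    - by exists ('X%:P); rewrite f3C f2X.
    - by exists 'X; rewrite f3X.
  rewrite [P]mpolyE rmorph_sum; apply: (big_ind im) => //.
    by have := imC 0; rewrite rmorph0.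
  move=> m _; rewrite /= pevalZ pevalX; apply: (imM) => //.
  apply: (big_ind im) => [|a b ha hb|j _]; first by have := imC 1; rewrite rmorph1.
    exact: imM.
  elim: (m j) => [|i IH]; first by have := imC 1; rewrite rmorph1 expr0.
  by rewrite exprS; exact: imM.
move=> a; have [d [F [G [hF hG Gp aE]]]] := quot_ex a.
have hX : ('X_(i0 p0) : {mpoly K[4]}) ^+ d \is d.-homog.
  have h1 : ('X_(i0 p0) : {mpoly K[4]}) \is 1.-homog by rewrite dhomogX /= mdeg1.
  by have := dhomogMn d h1; rewrite mul1n.
have Xp : (('X_(i0 p0) : {mpoly K[4]}) ^+ d).@[p] != 0.
  by rewrite rmorphXn /= mevalXU expf_neq0 // p_i0.
have [v [_ _ _ vE]] := quot_mk hG hX Xp; have [w [_ _ _ wE]] := quot_mk hX hG Gp.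
have [b bE] := onto (dehom p0 F); exists b, v, w; split; apply: lv_inj.
  have nX := denom_neq0 Xp; have nG := denom_neq0 Gp.
  by rewrite lvM lv1 vE wE -(@frac_cancel _ _ _ _ nG) (divff nX).
rewrite lvM bE (homog_dehom p0 hF) vE aE; apply: frac_cancel.
exact: denom_neq0 Gp.
Qed.

(** Krull's intersection theorem: ideals are closed for the topology of the powers of the maximal ideal. *)
Lemma closed_ideal (J : set A) a : is_ideal J ->
  (forall k, exists2 u, J u & idpow mm k (a - u)) -> J a.
Proof.
move=> idJ h; apply: (krull_intersection idmm localP3_noetherian idJ) => k.
by have [u Ju au] := h k; exists u, (a - u); split=> //; rewrite addrC subrK.
Qed.

End LocalCoordinates.

(** * Algebraic dependence of four germs *)

Section PrimeChains.
Variables (A B : comNzRingType) (f : {rmorphism B -> A}).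

(** The lowest nonzero coefficient of the relation is the required element, because a
    can be cancelled modulo Q. *)
Lemma relation_drop (Q Q' : set A) a P : prime_ideal Q -> is_ideal Q' -> Q `<=` Q' ->
  Q' a -> ~ Q a -> P != 0 -> Q (ext f a P) -> exists2 b, b != 0 & Q' (f b).
Proof.
move=> [_ _ pQ] [Q0 QD QM] QQ' Qa nQa.
elim/poly_ind: P => [|P c IH]; first by rewrite eqxx.
move=> Pc; rewrite rmorphD rmorphM /= extC extX.
have [c00|c0] := eqVneq c 0.
  rewrite c00 rmorph0 addr0 => /pQ[|//]; apply: IH.
  by apply: contraNneq Pc => ->; rewrite c00 mul0r add0r.
move=> /QQ' h; exists c => //.
rewrite -[f c](addKr (ext f a P * a)); apply: QD => //.
by rewrite -mulN1r; apply: (QM); exact: QM.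
Qed.

Definition opoly n (E : 'I_n -> B) : {poly B} := \sum_i (E i)%:P * 'X^i.

Lemma ext_opoly a n (E : 'I_n -> B) : ext f a (opoly E) = \sum_i f (E i) * a ^+ i.
Proof.
rewrite /opoly (raddf_sum (ext f a)); apply: eq_bigr => i _.
by rewrite /= rmorphM rmorphXn /= extC extX.
Qed.

Lemma opoly_neq0 n (E : 'I_n -> B) i : E i != 0 -> opoly E != 0.
Proof.
apply: contraNneq => /(congr1 (fun P : {poly B} => P`_i)).
rewrite coef0 coef_sum (bigD1 i) //= coefCM coefXn eqxx mulr1 big1 ?addr0 => [->//|j ji].
by rewrite coefCM coefXn eq_sym (inj_eq val_inj) (negbTE ji) mulr0.
Qed.

End PrimeChains.

Section AlgebraicDependence.
Variables (K : fieldType).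
Implicit Types (g h : {mpoly K[3]}) (V : fps 3 K).

Lemma msizeM_bound n (g h : {mpoly K[n]}) d e : (msize g <= d.+1)%N -> (msize h <= e.+1)%N ->
  (msize (g * h)%R <= (d + e).+1)%N.
Proof.
have [->|g0] := eqVneq g 0; first by rewrite mul0r msize0.
have [->|h0] := eqVneq h 0; first by rewrite mulr0 msize0.
rewrite msizeM_proper ?mulf_neq0 ?mleadc_eq0 //; lia.
Qed.

Lemma msizeX_bound n (g : {mpoly K[n]}) d k : (msize g <= d.+1)%N ->
  (msize (g ^+ k)%R <= (d * k).+1)%N.
Proof.
move=> sg; elim: k => [|k IH]; first by rewrite expr0 msize1.
by rewrite exprS mulnS; exact: msizeM_bound.
Qed.

Lemma linear_dependence (I : finType) (H : I -> {mpoly K[3]}) B :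
  (forall i, (msize (H i) <= B)%N) -> (B ^ 3 < #|I|)%N ->
  exists c : I -> K, (exists i, c i != 0) /\ \sum_i c i *: H i = 0.
Proof.
move=> sH BI; pose J := ('I_B * 'I_B * 'I_B)%type.
have cJ : #|{: J}| = (B ^ 3)%N by rewrite !card_prod !card_ord !expnS expn0 muln1 mulnA.
pose mn (j : J) := mnm3 j.1.1 j.1.2 j.2.
pose M : 'M[K]_(#|I|, #|{: J}|) := \matrix_(i, j) (H (enum_val i))@_(mn (enum_val j)).
have kM : kermx M != 0.
  rewrite kermx_eq0 /row_free neq_ltn (leq_ltn_trans (rank_leq_col M)) //.
  by rewrite cJ.
pose v := nz_row (kermx M).
have v0 : v != 0 by rewrite nz_row_eq0.
have vM : v *m M = 0 by apply/sub_kermxP; exact: nz_row_sub.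
exists (fun i => v 0 (enum_rank i)); split.
  have [i vi] : exists i, v 0 i != 0.
    apply: contrapT => no; case/eqP: v0; apply/rowP => i; rewrite mxE.
    by apply: contrapT => /eqP vi; apply: no; exists i.
  by exists (enum_val i); rewrite enum_valK.
apply/mpolyP => m; rewrite mcoeff0 raddf_sum /=.
have [|mB] := boolP [&& m (inord 0) < B, m (inord 1) < B & m (inord 2) < B]%N; last first.
  rewrite big1 // => i _; rewrite mcoeffZ memN_msupp_eq0 ?mulr0 //.
  apply: msize_mdeg_ge; apply: leq_trans (sH i) _.
  by rewrite (mnm3P m) mdeg3; move: mB; rewrite !negb_and -!leqNgt; lia.
case/and3P=> h0 h1 h2; pose j : J := (Ordinal h0, Ordinal h1, Ordinal h2).
have := congr1 (fun w : 'rV[K]__ => w 0 (enum_rank j)) vM; rewrite !mxE => e.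
rewrite -[RHS]e (reindex (@enum_val I predT)) /=; last by apply: onW_bij; exact: enum_val_bij.
apply: eq_bigr => i _; rewrite mcoeffZ mxE enum_rankK enum_valK; congr (_ * (H _)@__).
by rewrite [LHS]mnm3P.
Qed.

Lemma quartic_bound e : exists D, ((4 * D * e).+1 ^ 3 < D ^ 4)%N.
Proof.
have h D : (0 < D)%N -> ((4 * D * e).+1 <= D * (4 * e).+1)%N by nia.
have [s sE] : exists s, ((4 * e).+1 ^ 3)%N = s by eexists.
(* For D > (4 e + 1)^3, the product D^3 (4 e + 1)^3 is less than D^4. *)
exists s.+1.
have le3 : ((4 * s.+1 * e).+1 ^ 3 <= (s.+1 * (4 * e).+1) ^ 3)%N by rewrite leq_exp2r ?h.
apply: leq_ltn_trans le3 _.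
by rewrite expnMn sE [X in (_ < X)%N]expnSr ltn_pmul2l ?expn_gt0.
Qed.

Notation I4 D := ('I_D * 'I_D * 'I_D * 'I_D)%type.
Definition idx4 D (i : I4 D) (t : nat) : 'I_D :=
  nth i.2 [:: i.1.1.1; i.1.1.2; i.1.2; i.2] t.

Lemma sum_I4 (G : nmodType) D (F : I4 D -> G) :
  \sum_x F x = \sum_i \sum_j \sum_k \sum_l F (i, j, k, l).
Proof. by rewrite !pair_bigA; apply: eq_bigr => -[[[i j] k] l]. Qed.

(** The D^4 monomials in V with exponents less than D become polynomials of degree
    O(D) after multiplication with a power of the common denominator g, and these
    lie in a space of dimension O(D^3). *)
Lemma fps_dependence (V : 'I_4 -> fps 3 K) (g : {mpoly K[3]}) (h : 'I_4 -> {mpoly K[3]}) :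
  g != 0 -> (forall t, V t * fps_of_mpoly g = fps_of_mpoly (h t)) ->
  exists D (c : I4 D -> K), (exists i, c i != 0) /\
    \sum_i cst (c i) * \prod_t V t ^+ idx4 i t = 0.
Proof.
move=> g0 Vg.
pose e := (msize g + \sum_t msize (h t))%N.
have [D [B [hB hD]]] : exists D B, (4 * D * e).+1 = B /\ (B ^ 3 < D ^ 4)%N.
  by have [D hD] := quartic_bound e; exists D, (4 * D * e).+1; split=> //; exact: hD.
pose H (i : I4 D) : {mpoly K[3]} := \prod_t (h t ^+ idx4 i t * g ^+ (D - idx4 i t)).
have sH i : (msize (H i) <= B)%N.
  rewrite -hB.
  have sg : (msize g <= e.+1)%N by rewrite /e; lia.
  have sh t : (msize (h t) <= e.+1)%N by rewrite /e (bigD1 t) //=; lia.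
  have -> : (4 * D * e = \sum_(t < 4) D * e)%N by rewrite sum_nat_const card_ord mulnA.
  rewrite /H; apply: (big_ind2 (fun (x : {mpoly K[3]}) (y : nat) => msize x <= y.+1)%N) => [|x y x' y' h1 h2|t _].
  - by rewrite msize1.
  - exact: msizeM_bound.
  have -> : (D * e = e * idx4 i t + e * (D - idx4 i t))%N.
    by rewrite -mulnDr subnKC 1?mulnC // ltnW.
  by apply: msizeM_bound; exact: msizeX_bound.
have hI : (B ^ 3 < #|{: I4 D}|)%N.
  rewrite !card_prod !(card_ord D) -!mulnA -[X in (_ < X)%N]/(D ^ 4)%N.
  exact hD.
have [c [c0 cH]] := linear_dependence sH hI.
exists D, c; split; first exact: c0.
have gne : fps_of_mpoly g <> 0.
  move=> /fpsP g00; case/eqP: g0; apply/mpolyP => m; rewrite mcoeff0; exact: g00.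
have gD : \prod_(t < 4) fps_of_mpoly g ^+ D <> 0.
  rewrite prodr_const; elim: #|_| => [/eqP|k IH]; rewrite ?expr0 ?oner_eq0 //.
  rewrite exprS => /fps_mulf_eq0[|//]; elim: (D) => [/eqP|l IH2]; rewrite ?expr0 ?oner_eq0 //.
  by rewrite exprS => /fps_mulf_eq0[].
apply: (fps_mulfI gD); rewrite mulr0 mulr_sumr.
transitivity (fps_of_mpoly (\sum_i c i *: H i)); last by rewrite cH rmorph0.
rewrite rmorph_sum; apply: eq_bigr => i _ /=.
rewrite -mul_mpolyC rmorphM mulrCA; congr (_ * _).
rewrite /H rmorph_prod -big_split; apply: eq_bigr => t _ /=.
rewrite rmorphM !rmorphXn /= -Vg exprMn -mulrA -exprD subnKC 1?mulrC //.
exact: ltnW.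
Qed.

End AlgebraicDependence.

(** * Chains of primes and linear parts *)

Section Restriction.
Variables (n : nat) (K : idomainType).
Implicit Types (S : pred 'I_n) (V W : fps n K) (m : 'X_{1..n}).

Definition off S m := [forall j, S j ==> (m j == 0%N)].

(** The restriction to the coordinate subspace on which the coordinates in S vanish. *)
Definition restr S V : fps n K := fun m => if off S m then V m else 0.

Lemma offD S m k : off S (m + k)%MM = off S m && off S k.
Proof.
apply/forallP/andP => [h|[/forallP h1 /forallP h2] j].
  by split; apply/forallP => j; have := h j; rewrite mnmDE; case: (S j) => //=; rewrite addn_eq0 => /andP[].
by have := h1 j; have := h2 j; rewrite mnmDE; case: (S j) => //= /eqP -> /eqP ->.
Qed.

Fact restr_additive S : zmod_morphism (restr S).
Proof. by move=> V W; apply/fpsP => m; rewrite fpsB /restr fpsB; case: ifP; rewrite ?subr0. Qed.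

Fact restr_multiplicative S : monoid_morphism (restr S).
Proof.
split=> [|V W]; apply/fpsP => m.
  rewrite /restr fps1; case: ifPn => //; case: eqP => // -> /forallP[] j.
  by rewrite mnm0E implybT.
rewrite {1}/restr !(fpsM_sum _ _ (ltnSn _)); case: ifPn => om.
  apply: eq_bigr => -[/= k kd] km; rewrite -(submK km) offD in om.
  by case/andP: om => o1 o2; rewrite /restr o1 o2.
rewrite big1 // => -[/= k kd] km; rewrite -(submK km) offD negb_and in om.
by rewrite /restr; case/orP: om => /negbTE ->; rewrite ?mulr0 ?mul0r.
Qed.

HB.instance Definition _ S := GRing.isZmodMorphism.Build _ _ (restr S) (restr_additive S).
HB.instance Definition _ S := GRing.isMonoidMorphism.Build _ _ (restr S) (restr_multiplicative S).

Lemma restr_mono S m : ~~ off S m -> restr S (mono K m) = 0.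
Proof.
move=> om; apply/fpsP => k; rewrite /restr monoE; case: ifPn => // ok.
by case: eqP => // mk; rewrite mk ok in om.
Qed.

Lemma restr_var S j : S j -> restr S (fps_of_mpoly 'X_j) = 0.
Proof.
move=> Sj; apply: restr_mono; apply/negP => /forallP/(_ j).
by rewrite Sj mnm1E eqxx.
Qed.

Lemma restr1_eq0 j V : restr (pred1 j) V = 0 -> exists W, V = fps_of_mpoly 'X_j * W.
Proof.
move=> V0; exists (fun m => V (U_(j) + m)%MM); apply/fpsP => m; rewrite monoM.
case: ifPn => jm; first by rewrite addmC submK.
have /fpsP/(_ m) := V0; rewrite /restr ifT //; apply/forallP => i; apply/implyP => /eqP ->.
by move: jm; rewrite lep1mP negbK.
Qed.

Lemma restr2_eq0 i j V : restr (pred2 i j) V = 0 ->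
  exists W1 W2, V = fps_of_mpoly 'X_i * W1 + fps_of_mpoly 'X_j * W2.
Proof.
move=> V0; have [|W1 e1] := @restr1_eq0 i (V - restr (pred1 i) V).
  rewrite raddfB /=; apply/fpsP => m; rewrite fpsB /restr.
  by case: ifP => _; rewrite subrr.
have [|W2 e2] := @restr1_eq0 j (restr (pred1 i) V).
  apply/fpsP => m; rewrite /restr fps0; case: ifP => // oj; case: ifP => // oi.
  have /fpsP/(_ m) := V0; rewrite /restr ifT //; apply/forallP => l; apply/implyP.
  by move=> /orP[/eqP ->|/eqP ->]; [have /forallP/(_ i) := oi | have /forallP/(_ j) := oj]; rewrite /= eqxx.
by exists W1, W2; rewrite -e1 -e2 subrK.
Qed.

End Restriction.

Lemma sum3 (E : nzRingType) (v w : 'I_3 -> E) : \sum_j v j * w j =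
  v (inord 0) * w (inord 0) + v (inord 1) * w (inord 1) + v (inord 2) * w (inord 2).
Proof.
rewrite !big_ord_recl big_ord0 addr0 addrA.
by congr (v _ * w _ + v _ * w _ + v _ * w _); apply: val_inj; rewrite /= inordK.
Qed.

Section LocalGeometry.
Variables (K : fieldType) (p : 'I_4 -> K).
Hypothesis p0 : p != 0.
Notation A := (localP3 p).
Notation mm := (@maxideal A).
Notation cstA := (@cstP3 K p).
Implicit Types (a b f g h : A) (P Q : {mpoly K[3]}) (V W : fps 3 K) (x : 'I_3 -> A).

Let idmm : is_ideal mm := mm_ideal p0.

Lemma localP3_mulf_eq0 a b : a * b = 0 -> a = 0 \/ b = 0.
Proof.
move=> ab; have := rmorphM (taylor0 p0) a b; rewrite ab rmorph0 => /esym/fps_mulf_eq0.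
by case=> /taylor0_eq0; [left | right].
Qed.

Lemma localP3_set0_prime : prime_ideal ([set 0] : set A).
Proof.
split; first by split=> [|a b -> ->|a b ->] //=; rewrite ?addr0 ?mulr0.
- by move=> /= /eqP; rewrite oner_eq0.
- by move=> a b /= /localP3_mulf_eq0.
Qed.

Lemma unit_ideal (I : set A) a : is_ideal I -> I a -> ~ mm a -> I 1.
Proof.
move=> idI Ia na; have a0 : lev p0 a != 0 by apply/eqP => /(mmP p0).
have [b <-] := lev_unit a0.
exact: ideal_mulr.
Qed.

Lemma proper_sub_mm (I : set A) : is_ideal I -> ~ I 1 -> I `<=` mm.
Proof. by move=> idI I1 a Ia; apply: contrapT => na; apply: I1; exact: unit_ideal na. Qed.

(** Elements of successive differences of a chain of five primes satisfy a polynomial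
    relation by [fps_dependence], and four applications of [relation_drop] turn it
    into a nonzero constant in the last prime. *)
Lemma prime_chain_bound : ~ exists Q : nat -> set A, prime_chain Q 4.
Proof.
move=> [Q [Qp Qlt]].
have el i : (i < 4)%N -> exists2 a, Q i.+1 a & ~ Q i a.
  move=> i4; have [_ n] := Qlt i i4; apply: contrapT => no; apply: n => a Qa.
  by apply: contrapT => na; apply: no; exists a.
have [a1 Qa1 nQa1] := el 0%N isT; have [a2 Qa2 nQa2] := el 1%N isT.
have [a3 Qa3 nQa3] := el 2%N isT; have [a4 Qa4 nQa4] := el 3%N isT.
pose f1 : {rmorphism {poly K} -> A} := ext cstA a4.
pose f2 : {rmorphism {poly {poly K}} -> A} := ext f1 a3.
pose f3 : {rmorphism {poly {poly {poly K}}} -> A} := ext f2 a2.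
pose f4 : {rmorphism {poly {poly {poly {poly K}}}} -> A} := ext f3 a1.
have idQ i : (i <= 4)%N -> is_ideal (Q i) by move=> i4; case: (Qp i i4).
suff [P P0 QP] : exists2 P, P != 0 & Q 0%N (f4 P).
  have s i : (i < 4)%N -> Q i `<=` Q i.+1 by move=> i4; case: (Qlt i i4).
  have [P3 P30 QP3] := relation_drop (Qp 0%N isT) (idQ 1%N isT) (s 0%N isT) Qa1 nQa1 P0 QP.
  have [P2 P20 QP2] := relation_drop (Qp 1%N isT) (idQ 2%N isT) (s 1%N isT) Qa2 nQa2 P30 QP3.
  have [P1 P10 QP1] := relation_drop (Qp 2%N isT) (idQ 3%N isT) (s 2%N isT) Qa3 nQa3 P20 QP2.
  have [c c0 Qc] := relation_drop (Qp 3%N isT) (idQ 4%N isT) (s 3%N isT) Qa4 nQa4 P10 QP1.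
  have [_ Q1 _] := Qp 4%N isT; apply: Q1; apply: (unit_ideal (idQ 4%N isT) Qc).
  by move/(mmP p0); rewrite lev_cst => e; rewrite e eqxx in c0.
pose a (t : 'I_4) := nth 0 [:: a1; a2; a3; a4] t.
have frac b : exists gh : {mpoly K[3]} * {mpoly K[3]}, gh.1 != 0 /\
    taylor0 p0 b * fps_of_mpoly gh.1 = fps_of_mpoly gh.2.
  have [d [F [G [[_ hG Gp _] e]]]] := taylor0P p0 b.
  exists (dehom p0 G, dehom p0 F); split=> //=.
  by move: Gp; rewrite (dehom_unit p0 hG); apply: contraNneq => ->; rewrite mcoeff0.
have [gh ghP] := choice (fun t => frac (a t)).
pose g := \prod_t (gh t).1; pose h t := (gh t).2 * \prod_(u | u != t) (gh u).1.
have g0 : g != 0 by apply/prodf_neq0 => t _; case: (ghP t).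
have Vg t : taylor0 p0 (a t) * fps_of_mpoly g = fps_of_mpoly (h t).
  rewrite /g /h (bigD1 t) //= !rmorphM /= mulrA; congr (_ * _).
  by case: (ghP t).
have [D [c [[[[[i j] k] l] c0] cV]]] := fps_dependence g0 Vg.
pose P := opoly (fun i => opoly (fun j => opoly (fun k => opoly (fun l => c (i, j, k, l))))).
exists P; first by apply: (opoly_neq0 (i := i)); apply: (opoly_neq0 (i := j)); apply: (opoly_neq0 (i := k)); apply: (opoly_neq0 (i := l)).
suff -> : f4 P = 0 by case: (idQ 0%N isT).
apply: (taylor0_eq0 (p0 := p0)); rewrite -[RHS]cV.
rewrite sum_I4.
rewrite [f4 P]ext_opoly (raddf_sum (taylor0 p0)); apply: eq_bigr => i' _.
rewrite [f3 _]ext_opoly mulr_suml (raddf_sum (taylor0 p0)); apply: eq_bigr => j' _.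
rewrite [f2 _]ext_opoly !mulr_suml (raddf_sum (taylor0 p0)); apply: eq_bigr => k' _.
rewrite [f1 _]ext_opoly !mulr_suml (raddf_sum (taylor0 p0)); apply: eq_bigr => l' _.
rewrite /= !rmorphM !rmorphXn /= taylor0_cst !big_ord_recl big_ord0 mulr1 /a /idx4 /=.
by rewrite -!mulrA; congr (_ * _); rewrite !mulrA; ring.
Qed.

Notation vec3 a b c := (fun j : 'I_3 => nth 0 [:: a; b; c] j).

Lemma lin3P a b c u : lin (vec3 a b c) u <-> exists i j k, u = i * a + j * b + k * c.
Proof.
split=> [[v ->]|[i [j [k ->]]]].
  by exists (v (inord 0)), (v (inord 1)), (v (inord 2)); rewrite sum3 !inordK.
by exists (vec3 i j k); rewrite sum3 !inordK.
Qed.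

Lemma lin_min x (I : set A) : is_ideal I -> (forall j, I (x j)) -> lin x `<=` I.
Proof.
move=> [I0 ID IM] Ix _ [b ->]; elim/big_ind: _ => // j _.
exact: IM.
Qed.

(** Nakayama's lemma modulo the square of the maximal ideal. *)
Lemma params_nak x : (forall j, mm (x j)) ->
  (forall a, mm a -> exists2 u, lin x u & idpow mm 2 (a - u)) -> params x.
Proof.
move=> xm h; split=> //; have idl := lin_ideal x; have [l0 lD lM] := idl.
apply: (nakayama idmm (localP3_noetherian p0) idl idmm) => [|I idI lI mI a ma].
  exact: lin_min.
have [u lu au] := h a ma; rewrite -[a](subrK u); case: (idI) => _ ID _.
apply: ID; last exact: lI.
move: au; apply: idpow_min => // -[//|b [//|c [|//]]] _ bc.
rewrite big_cons big_seq1; apply: mI; apply: bc; rewrite !inE eqxx ?orbT //.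
Qed.

Lemma idpow2_mul a b : mm a -> mm b -> idpow mm 2 (a * b).
Proof. by move=> ma mb; apply: (@idpow_mul _ mm 1 1); exact: idpow_in. Qed.

Section Linear.
Variable x : 'I_3 -> A.
Hypothesis px : params x.

Definition lpart j a : K := taylor p0 px a U_(j)%MM.

Lemma lpart_sum (b : 'I_3 -> A) j : lpart j (\sum_i b i * x i) = lev p0 (b j).
Proof.
rewrite /lpart (raddf_sum (taylor p0 px)) fps_sum (bigD1 j) //= big1 ?addr0 => [|i ij].
  rewrite rmorphM /= taylor_param mulrC (monoM U_(j)%MM) lepm_refl -{1}[U_(j)%MM]add0m addmK.
  by rewrite taylor_lev.
rewrite rmorphM /= taylor_param mulrC (monoM U_(i)%MM) lep1mP mnm1E (eq_sym j i).
by rewrite (negbTE ij).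
Qed.

Lemma idpow2_lpart a : idpow mm 2 a <-> mm a /\ forall j, lpart j a = 0.
Proof.
rewrite (taylor_idpow p0 px); split=> [o|[ma la] m].
  split; last by move=> j; apply: o; rewrite mdeg1.
  by apply/(mmP p0); rewrite -(taylor_lev p0 px); apply: o; rewrite mdeg0.
rewrite ltnS leq_eqVlt ltnS leqn0 => /orP[/mdeg1P[j /eqP ->]|]; first exact: la.
by rewrite mdeg_eq0 => /eqP ->; rewrite taylor_lev; apply/mmP.
Qed.

Lemma params_expand a : mm a -> exists b : 'I_3 -> A, a = \sum_i b i * x i /\
  forall j, lpart j a = lev p0 (b j).
Proof. by case: px => _ h /h[b ->]; exists b; split=> // j; rewrite lpart_sum. Qed.

End Linear.

(** Truncating the cofactors V_i approximates a by elements of I to every order. *)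
Lemma taylor_mem x (px : params x) (I : set A) a g h l V1 V2 V3 : is_ideal I -> I g -> I h -> I l ->
  taylor p0 px a = V1 * taylor p0 px g + V2 * taylor p0 px h + V3 * taylor p0 px l -> I a.
Proof.
move=> idI Ig Ih Il e; have [I0 ID IM] := idI; apply: (closed_ideal p0 idI) => k.
pose t (V : fps 3 K) := peval x (trunc k V).
exists (t V1 * g + t V2 * h + t V3 * l); first by do 2? [apply: (ID)]; apply: IM.
apply/(taylor_idpow p0 px); rewrite raddfB /= !raddfD /= !rmorphM /= e /t !taylor_peval.
have o V : ordge k (V - fps_of_mpoly (trunc k V)) by exact: ordge_trunc.
move: (taylor p0 px g) (taylor p0 px h) (taylor p0 px l) => G H L.
have -> : V1 * G + V2 * H + V3 * L + (- (fps_of_mpoly (trunc k V1) * G) -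
    fps_of_mpoly (trunc k V2) * H - fps_of_mpoly (trunc k V3) * L) =
  G * (V1 - fps_of_mpoly (trunc k V1)) + H * (V2 - fps_of_mpoly (trunc k V2)) +
  L * (V3 - fps_of_mpoly (trunc k V3)) by ring.
by do 2? [apply: ordgeD]; apply: ordgeMl.
Qed.

Definition principal f : set A := [set a | exists b, a = b * f].

Lemma principal_ideal f : is_ideal (principal f).
Proof.
split=> [|_ _ [b ->] [c ->]|a _ [b ->]]; first by exists 0; rewrite mul0r.
  by exists (b + c); rewrite mulrDl.
by exists (a * b); rewrite mulrA.
Qed.

(** This is the kernel of the restriction of expansions to the plane x_j = 0. *)
Lemma principal_param_prime x (px : params x) j : prime_ideal (principal (x j)).
Proof.
have rE a b : a = b * x j -> restr (pred1 j) (taylor p0 px a) = 0.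
  by move=> ->; rewrite !rmorphM /= taylor_param restr_var ?mulr0 //= eqxx.
have back a : restr (pred1 j) (taylor p0 px a) = 0 -> principal (x j) a.
  move=> /restr1_eq0[W e].
  apply: (@taylor_mem x px _ a (x j) (x j) (x j) W 0 0 (principal_ideal _)); try by exists 1; rewrite mul1r.
  by rewrite e taylor_param !mul0r !addr0 mulrC.
split; first exact: principal_ideal.
  by move=> [b /rE]; rewrite !rmorph1 => /eqP; rewrite oner_eq0.
move=> a b [c /rE]; rewrite !rmorphM /= => /fps_mulf_eq0.
by case=> /back; [left | right].
Qed.

(** Any of the standard parameters occurring in the linear part of f can be replaced
    by f. *)
Lemma complete_params f : mm f -> ~ idpow mm 2 f -> exists j x, params x /\ x j = f.
Proof.
move=> mf nf; pose e := std_param p0; have pe : params e := params_std p0.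
have [j lj] : exists j, lpart pe j f != 0.
  apply: contrapT => no; apply: nf; apply/(idpow2_lpart pe); split=> // j.
  by apply: contrapT => /eqP lj; apply: no; exists j.
have [b [fb lb]] := params_expand pe mf.
have bj : lev p0 (b j) != 0 by rewrite -lb.
have [u bu] := lev_unit bj; have [e1 em] := pe.
exists j, (fun i => if i == j then f else e i); rewrite eqxx; split=> //.
set x := (fun i => _); have idl := lin_ideal x; have [l0 lD lM] := idl.
split=> [i|a /em]; first by rewrite /x; case: eqP.
apply: lin_min => // i; have [->|ij] := eqVneq i j; last first.
  by have := lin_in x i; rewrite /x (negbTE ij).
have -> : e j = u * (f - \sum_(i | i != j) b i * e i).
  by rewrite fb (bigD1 j) //= addrK mulrA [u * _]mulrC bu mul1r.
apply: (lM); apply: (ideal_sub idl); first by have := lin_in x j; rewrite /x eqxx.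
elim/big_ind: _ => // i' ij'; apply: (lM).
by have := lin_in x i'; rewrite /x (negbTE ij').
Qed.

Lemma principal_prime f : mm f -> ~ idpow mm 2 f -> prime_ideal (principal f).
Proof.
by move=> mf nf; have [j [x [px <-]]] := complete_params mf nf; exact: (principal_param_prime px j).
Qed.

(** Otherwise the three linear parts of the standard parameters, which are
    independent, would be combinations of two. *)
Lemma embdim_gt2 t1 t2 : mm t1 -> mm t2 ->
  ~ (forall a, mm a -> exists b c, idpow mm 2 (a - (b * t1 + c * t2))).
Proof.
move=> m1 m2 h; pose e := std_param p0; have pe : params e := params_std p0.
have [e1 em] := pe.
have [b1 [t1E l1]] := params_expand pe m1; have [b2 [t2E l2]] := params_expand pe m2.
have [bc bcP] := choice (fun i => h (e i) (e1 i)).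
have [c cP] := choice bcP.
pose U : 'M[K]_(3, 2) := \matrix_(i, j) if j == 0 then lev p0 (bc i) else lev p0 (c i).
pose T : 'M[K]_(2, 3) := \matrix_(i, j) if i == 0 then lpart pe j t1 else lpart pe j t2.
have UT : U *m T = 1%:M.
  apply/matrixP => i j; rewrite !mxE !big_ord_recl big_ord0 addr0 !mxE /=.
  have [_ /(_ j)] := (idpow2_lpart pe _).1 (cP i).
  rewrite /lpart raddfB /= raddfD /= !rmorphM /= taylor_param !fpsB fpsD => /eqP.
  rewrite subr_eq0 => /eqP; rewrite /fps_of_mpoly mcoeffXU => ->.
  have lM a t : mm t -> (taylor p0 pe a * taylor p0 pe t) U_(j)%MM = lev p0 a * lpart pe j t.
    move=> mt; have [b [tE lb]] := params_expand pe mt.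
    rewrite -rmorphM -/(lpart _ _ _) /= lb [in LHS]tE mulr_sumr.
    under eq_bigr do rewrite mulrA.
    by have := lpart_sum pe (fun i => a * b i) j; rewrite /lpart /= rmorphM => ->.
  by rewrite !lM.
have := mulmx_max_rank U T; rewrite UT mxrank1.
by [].
Qed.

End LocalGeometry.

(** * Germs of smooth curves and surfaces *)

Section QuotientMap.
Variables (A : comPzRingType) (X : set A).

Fact quot_pi_additive : zmod_morphism (quot_pi X).
Proof.
move=> a b; have e : quot_pi X (a - b) + quot_pi X b = quot_pi X a.
  by rewrite -quot_piD subrK.
by rewrite -e addrK.
Qed.
Fact quot_pi_multiplicative : monoid_morphism (quot_pi X).
Proof. by split=> // a b; exact: quot_piM. Qed.
HB.instance Definition _ := GRing.isZmodMorphism.Build _ _ (quot_pi X) quot_pi_additive.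
HB.instance Definition _ := GRing.isMonoidMorphism.Build _ _ (quot_pi X) quot_pi_multiplicative.

Lemma quot_pi_eq0 a : quot_pi X a = 0 <-> gen_ideal X a.
Proof. by rewrite -(rmorph0 (quot_pi X)) quot_piE subr0. Qed.

Lemma quot_ind (z : quotring X) : exists a, z = quot_pi X a.
Proof. by exists (repr z); rewrite quot_piK. Qed.

Lemma preim_ideal (I : set (quotring X)) : is_ideal I -> is_ideal [set a | I (quot_pi X a)].
Proof.
move=> [I0 ID IM]; split=> [|a b|a b] /=; rewrite ?rmorph0 ?rmorphD ?rmorphM //.
  exact: ID.
exact: IM.
Qed.

Lemma preim_sub (I : set (quotring X)) : is_ideal I -> gen_ideal X `<=` [set a | I (quot_pi X a)].
Proof. by move=> [I0 _ _] a /quot_pi_eq0 /= ->. Qed.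

Lemma preim_prime (Q : set (quotring X)) : prime_ideal Q -> prime_ideal [set a | Q (quot_pi X a)].
Proof.
move=> [idQ Q1 pQ]; split; first exact: preim_ideal.
  by rewrite /= rmorph1.
by move=> a b /=; rewrite rmorphM => /pQ.
Qed.

Lemma preim_lt (I J : set (quotring X)) : I `<` J ->
  [set a | I (quot_pi X a)] `<` [set a | J (quot_pi X a)].
Proof.
move=> [IJ nJI]; split=> [a /IJ //|h]; apply: nJI => z.
by have [a ->] := quot_ind z; exact: h.
Qed.

End QuotientMap.

Section SmoothGerms.
Variables (K : fieldType) (p : 'I_4 -> K).
Hypothesis p0 : p != 0.
Notation A := (localP3 p).
Notation mm := (@maxideal A).
Implicit Types (a b f g h t : A) (J P S : set A).

Let idmm : is_ideal mm := mm_ideal p0.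

Lemma quot_maxideal J a : gen_ideal J `<=` mm ->
  (maxideal (quot_pi J a) <-> mm a).
Proof.
move=> Jm; split=> [na [b ab]|ma [z]].
  by apply: na; exists (quot_pi J b); rewrite -rmorphM ab rmorph1.
have [b ->] := quot_ind z; rewrite -rmorphM -(rmorph1 (quot_pi J)).
move=> /quot_piE /Jm h; apply: (@mm_proper A).
have -> : 1 = a * b - (a * b - 1) by rewrite opprB addrC subrK.
by apply: (ideal_sub idmm) => //; rewrite mulrC; case: idmm => _ _; apply.
Qed.

Lemma prime_chain_sub_mm J n (Q : nat -> set (quotring J)) : prime_chain Q n ->
  gen_ideal J `<=` mm.
Proof.
move=> [Qp _]; have [idQ Q1 _] := preim_prime (Qp 0%N isT).
apply: subset_trans (preim_sub (let: And3 h _ _ := Qp 0%N isT in h)) _.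
exact: (proper_sub_mm p0 idQ Q1).
Qed.

Lemma regular_curve J : is_ideal J -> regular_local (quotring J) 1 ->
  J `<=` mm /\ exists2 t, mm t & forall a, mm a -> exists b, J (a - b * t).
Proof.
move=> idJ [[[Q Qc] _] [[//|s [|//]] _ smax]].
have Jm := prime_chain_sub_mm Qc.
have [t st] := quot_ind s; subst s.
rewrite (gen_ideal_id idJ) in Jm; split=> //.
have Jm' : gen_ideal J `<=` mm by rewrite gen_ideal_id.
exists t.
  by apply/(quot_maxideal t Jm'); rewrite smax; apply: sub_gen_ideal; exact: mem_head.
move=> a /(quot_maxideal a Jm'); rewrite smax.
move=> /(_ [set z | exists b, z = quot_pi J (b * t)]); case.
- split=> [|_ _ [b ->] [c ->]|z _ [b ->]].
  + by exists 0; rewrite mul0r rmorph0.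
  + by exists (b + c); rewrite mulrDl rmorphD.
  + have [c ->] := quot_ind z; exists (c * b).
    rewrite -mulrA.
    by rewrite -rmorphM.
- by move=> z /=; rewrite inE => /eqP ->; exists 1; rewrite mul1r.
by move=> b /quot_piE; rewrite gen_ideal_id // => h; exists b.
Qed.

(** A regular local ring of dimension two has its maximal ideal generated by two
    elements, so some f in J has a nonzero linear part.  If (f) were smaller than J,
    then 0, (f) and a chain of three primes containing J would be too long a chain. *)
Lemma smooth_surface J : smooth_surface_germ J ->
  exists f, [/\ mm f, ~ idpow mm 2 f & J = principal f].
Proof.
move=> [idJ [[[Q Qc] _] [[//|s1 [//|s2 [|//]]] _ smax]]].
have Jm := prime_chain_sub_mm Qc.
have [t1 st] := quot_ind s1; subst s1; have [t2 st] := quot_ind s2; subst s2.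
have m1 : mm t1.
  by apply/(quot_maxideal t1 Jm); rewrite smax; apply: sub_gen_ideal; exact: mem_head.
have m2 : mm t2.
  by apply/(quot_maxideal t2 Jm); rewrite smax; apply: sub_gen_ideal; rewrite /= !inE eqxx orbT.
have span a : mm a -> exists b c, J (a - (b * t1 + c * t2)).
  move=> /(quot_maxideal a Jm); rewrite smax.
  move=> /(_ [set z | exists b c, z = quot_pi J (b * t1 + c * t2)]); case.
  - split=> [|_ _ [b [c ->]] [b' [c' ->]]|z _ [b [c ->]]].
    + by exists 0, 0; rewrite !mul0r addr0 rmorph0.
    + by exists (b + b'), (c + c'); rewrite -rmorphD !mulrDl addrACA.
    + by have [d ->] := quot_ind z; exists (d * b), (d * c); rewrite -!mulrA -mulrDr; rewrite -rmorphM.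
  - move=> z /=; rewrite !inE => /orP[/eqP ->|/eqP ->].
      by exists 1, 0; rewrite mul1r mul0r addr0.
    by exists 0, 1; rewrite mul1r mul0r add0r.
  by move=> b [c /quot_piE]; rewrite gen_ideal_id // => h; exists b, c.
rewrite (gen_ideal_id idJ) in Jm.
have [f Jf nf] : exists2 f, J f & ~ idpow mm 2 f.
  apply: contrapT => no; apply: (embdim_gt2 p0 m1 m2) => a /span[b [c h]].
  by exists b, c; apply: contrapT => n; apply: no; exists (a - (b * t1 + c * t2)).
have mf : mm f by exact: Jm.
exists f; split=> //; apply/seteqP; split; last first.
  by move=> _ [b ->]; case: idJ => _ _; apply.
apply: contrapT => nJ; apply: (prime_chain_bound p0); have [Qp Qlt] := Qc.
exists (fun i => if i is i'.+1 then if i' is i''.+1 then [set a | Q i'' (quot_pi J a)]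
  else principal f else [set 0]); split=> [[|[|i]] i4|[|[|i]] i4].
- exact: (localP3_set0_prime p0).
- exact: principal_prime.
- exact: preim_prime (Qp i i4).
- split; first by move=> _ ->; exists 0; rewrite mul0r.
  move=> h; apply: nf; have -> : f = 0 by apply: h; exists 1; rewrite mul1r.
  by case: (idpow_ideal mm 2).
- have JQ : J `<=` [set a | Q 0%N (quot_pi J a)].
    by rewrite -{1}(gen_ideal_id idJ); apply: preim_sub; case: (Qp 0%N isT).
  split; first by move=> _ [b ->]; apply: JQ; case: idJ => _ _; apply.
  by move=> h; apply: nJ; exact: subset_trans JQ h.
- by apply: preim_lt; exact: Qlt.
Qed.

(** If f had order j < q along the curve with parameter t, then every ideal of the
    quotient would be generated by some t^i with i <= j, and the chain of length q
    could not be strict. *)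
Lemma length_order P t f q : is_ideal P -> P `<=` mm -> mm t ->
  (forall a, mm a -> exists b, P (a - b * t)) ->
  has_length (quotring (P `|` principal f)) q -> exists a, P (f - a * t ^+ q).
Proof.
move=> idP Pm mt Pt [I [I0 Iq idI Ilt]]; have [P0 PD PM] := idP.
pose O i a := exists b, P (a - b * t ^+ i).
have Olt i a b : P (a - b * t ^+ i) -> mm b -> O i.+1 a.
  move=> h /Pt[c hc]; exists c.
  have -> : a - c * t ^+ i.+1 = (a - b * t ^+ i) + t ^+ i * (b - c * t).
    by rewrite exprS mulrBr addrA [t ^+ i * b]mulrC subrK [t ^+ i * _]mulrC mulrA.
  by apply: PD => //; exact: PM.
have Ounit i a (C : set A) : is_ideal C -> P `<=` C -> C a -> O i a -> ~ O i.+1 a -> C (t ^+ i).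
  move=> idC PC Ca [b h] nO; have [C0 CD CM] := idC.
  have nb : ~ mm b by move=> mb; apply: nO; exact: Olt h mb.
  have b0 : lev p0 b != 0 by apply/eqP => /(mmP p0).
  have [u bu] := lev_unit b0.
  have -> : t ^+ i = u * (a - (a - b * t ^+ i)) by rewrite opprB addrC subrK mulrA [u * b]mulrC bu mul1r.
  by apply: CM; apply: (ideal_sub idC) => //; exact: PC.
apply: contrapT => nq.
have [j jq [Oj nOj]] : exists2 j, (j < q)%N & O j f /\ ~ O j.+1 f.
  elim: q nq {Iq idI Ilt} => [|q IH] nq.
    by case: nq; exists f; rewrite expr0 mulr1 subrr.
  have [Oq|nOq] := pselect (O q f); first by exists q.
  by have [j jq h] := IH nOq; exists j => //; exact: ltnW.
pose X := P `|` principal f.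
have PX : P `<=` gen_ideal X by move=> a Pa; apply: sub_gen_ideal; left.
have Xf : gen_ideal X f by apply: sub_gen_ideal; right; exists 1; rewrite mul1r.
have Xt : gen_ideal X (t ^+ j) := Ounit j f _ (gen_idealP X) PX Xf Oj nOj.
pose C i : set A := [set a | I i (quot_pi X a)].
have idC i : (i <= q)%N -> is_ideal (C i) by move=> iq; apply: preim_ideal; exact: idI.
have XC i : (i <= q)%N -> gen_ideal X `<=` C i by move=> iq; apply: preim_sub; exact: idI.
have main i : (i <= j)%N -> forall a, C (q - i)%N a -> O i a.
  elim: i => [|i IH] ij a; first by move=> _; exists a; rewrite expr0 mulr1 subrr.
  move=> Ca; apply: contrapT => nO.
  have iq : (q - i.+1 < q)%N by lia.
  have [Clt _] := Ilt (q - i.+1)%N iq; have e : ((q - i.+1).+1 = q - i)%N by lia.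
  have [sub nsub] := preim_lt Clt; rewrite e in sub nsub.
  have PC : P `<=` C (q - i.+1)%N by apply: subset_trans PX _; apply: XC; lia.
  have idC' : is_ideal (C (q - i.+1)%N) by apply: idC; lia.
  have Cti := Ounit i a _ idC' PC Ca (IH (ltnW ij) a (sub a Ca)) nO.
  apply: nsub => b /(IH (ltnW ij))[c h]; have [_ CD CM] := idC'.
  rewrite /= -[b](subrK (c * t ^+ i)); apply: CD; last exact: CM.
  exact: PC.
have C0 i : C i `<=` gen_ideal X -> (i <= q)%N -> (0 < i)%N -> False.
  case: i => // i Ci iq _; have [Clt _] := Ilt i iq; have [_ nsub] := preim_lt Clt.
  apply: nsub => a /Ci h; apply: (XC i) => //; exact: ltnW.
apply: (C0 (q - j)%N); [|lia|lia].
move=> a /(main j (leqnn j))[b h]; have [_ XD XM] := gen_idealP X.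
rewrite -[a](subrK (b * t ^+ j)); apply: XD; [exact: PX | exact: XM].
Qed.

End SmoothGerms.

(** * Coordinates adapted to the two curves *)

Section TwoGenerators.
Variable A : comPzRingType.
Implicit Types (I : set A) (a b c f g x y z : A).

Definition ideal2 a b : set A := [set u | exists i j, u = i * a + j * b].

Lemma ideal2_ideal a b : is_ideal (ideal2 a b).
Proof.
split=> [|_ _ [i [j ->]] [k [l ->]]|c _ [i [j ->]]].
- by exists 0, 0; rewrite !mul0r addr0.
- by exists (i + k), (j + l); rewrite !mulrDl addrACA.
by exists (c * i), (c * j); rewrite mulrDr !mulrA.
Qed.

Lemma ideal2_l a b : ideal2 a b a.
Proof. by exists 1, 0; rewrite mul1r mul0r addr0. Qed.

Lemma ideal2_r a b : ideal2 a b b.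
Proof. by exists 0, 1; rewrite mul1r mul0r add0r. Qed.

Lemma ideal2_min a b I : is_ideal I -> I a -> I b -> ideal2 a b `<=` I.
Proof. by move=> [_ ID IM] Ia Ib _ [i [j ->]]; apply: ID; exact: IM. Qed.

Lemma ideal2_eq a b c d : ideal2 c d a -> ideal2 c d b -> ideal2 a b c -> ideal2 a b d ->
  ideal2 a b = ideal2 c d.
Proof. by move=> ha hb hc hd; apply/seteqP; split; apply: ideal2_min => //; exact: ideal2_ideal. Qed.

Lemma ideal2C a b : ideal2 a b = ideal2 b a.
Proof. by apply: ideal2_eq; (exact: ideal2_l || exact: ideal2_r). Qed.

Lemma ideal2_comb a b i j : ideal2 a b (i * a + j * b).
Proof. by exists i, j. Qed.

Lemma ideal2_Ml a b c : ideal2 a b (c * a).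
Proof. by exists c, 0; rewrite mul0r addr0. Qed.

Lemma ideal2_Mr a b c : ideal2 a b (c * b).
Proof. by exists 0, c; rewrite mul0r add0r. Qed.

Lemma gen_principal_adjoin (K : fieldType) f g :
  gen_ideal ([set a | exists b, a = b * f] `|` [set g]) = ideal2 f g.
Proof.
apply/seteqP; split.
  apply: gen_ideal_min; first exact: ideal2_ideal.
  by move=> a [[b ->]|->]; [exact: ideal2_Ml | exact: ideal2_r].
apply: ideal2_min; [exact: gen_idealP | |]; apply: sub_gen_ideal; last by right.
by left; exists 1; rewrite mul1r.
Qed.

Lemma ideal_subX I a b k : is_ideal I -> I (a - b) -> I (a ^+ k - b ^+ k).
Proof. by move=> idI h; rewrite subrXX; apply: ideal_mulr. Qed.

End TwoGenerators.

Section NormalForm.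
Variables (K : fieldType) (p : 'I_4 -> K).
Hypothesis p0 : p != 0.
Notation A := (localP3 p).
Notation mm := (@maxideal A).
Implicit Types (a b f g h t : A) (J P S Z : set A).
Notation vec3 a b c := (fun j : 'I_3 => nth 0 [:: a; b; c] j).

Let idmm : is_ideal mm := mm_ideal p0.

Lemma unit_of a : ~ mm a -> exists u, u * a = 1.
Proof.
move=> na; have [u au] : exists u, a * u = 1 by apply: contrapT.
by exists u; rewrite mulrC.
Qed.

Lemma vec3_mm a b c : mm a -> mm b -> mm c -> forall j, mm (vec3 a b c j).
Proof. by move=> ma mb mc [[|[|[|//]]] j3]. Qed.

Lemma lin3_ind a b c (I : set A) : is_ideal I -> I a -> I b -> I c ->
  lin (vec3 a b c) `<=` I.
Proof. by move=> idI Ia Ib Ic; apply: lin_min => // -[[|[|[|//]]] j3]. Qed.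

Lemma lin3_0 a b c : lin (vec3 a b c) a.
Proof. by apply/lin3P; exists 1, 0, 0; rewrite mul1r !mul0r !addr0. Qed.
Lemma lin3_1 a b c : lin (vec3 a b c) b.
Proof. by apply/lin3P; exists 0, 1, 0; rewrite mul1r !mul0r add0r addr0. Qed.
Lemma lin3_2 a b c : lin (vec3 a b c) c.
Proof. by apply/lin3P; exists 0, 0, 1; rewrite mul1r !mul0r !add0r. Qed.

Lemma ideal2_lin a b c : ideal2 a b `<=` lin (vec3 a b c).
Proof.
apply: ideal2_min; [exact: lin_ideal | exact: lin3_0 | exact: lin3_1].
Qed.

Lemma curve_params f g t : ideal2 f g `<=` mm -> mm t ->
  (forall a, mm a -> exists b, ideal2 f g (a - b * t)) -> params (vec3 f g t).
Proof.
move=> Pm mt Pt; split=> [|a /Pt[b [i [j e]]]].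
  by apply: vec3_mm => //; apply: Pm; [exact: ideal2_l | exact: ideal2_r].
by apply/lin3P; exists i, j, b; rewrite -e subrK.
Qed.

Lemma lpart_tangent x (px : params x) j : tangent set0 (lpart p0 px j : A -> K^o).
Proof.
split=> [f g|c f||f g mf mg|//]; rewrite /lpart.
- by rewrite rmorphD.
- by rewrite rmorphM /= taylor_cst cstM.
- by rewrite rmorph1 fps1 -mdeg_eq0 mdeg1.
have /(idpow2_lpart p0 px)[_ h] := idpow2_mul mf mg; exact: h.
Qed.

(** If f2 had no component along t1, every tangent functional would vanish on f2,
    being a sum of one which kills f1 and g1 and one which kills f2. *)
Lemma transverse_params f1 g1 t1 f2 : params (vec3 f1 g1 t1) ->
  transverse (ideal2 f1 g1) (principal f2) -> mm f2 -> ~ idpow mm 2 f2 ->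
  params (vec3 f1 g1 f2).
Proof.
move=> px tr m2 n2; have [mx px'] := px.
have m1 : mm f1 by exact: (mx ord0).
have mg : mm g1 by have := mx (inord 1); rewrite inordK.
have mt : mm t1 by have := mx (inord 2); rewrite inordK.
have [i [j [k e]]] : exists i j k, f2 = i * f1 + j * g1 + k * t1 by apply/lin3P; exact: px'.
have nk : ~ mm k.
  move=> mk; apply: n2; apply/(idpow2_lpart p0 px); split=> // l.
  have [D1 [D2 [[D1D _ _ D1M D1P] [_ _ _ _ D2f] eD]]] := tr _ (lpart_tangent px l).
  have -> : lpart p0 px l f2 = D1 f2 + D2 f2 by rewrite eD.
  rewrite D2f ?addr0; last by exists 1; rewrite mul1r.
  rewrite e D1D D1M // addr0; apply: D1P; exact: ideal2_comb.
have [u uk] := unit_of nk.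
split; first exact: vec3_mm.
move=> a /px'; apply: lin3_ind; [exact: lin_ideal|exact: lin3_0|exact: lin3_1|].
apply/lin3P; exists (- (u * i)), (- (u * j)), u.
by rewrite e !mulrDr !mulrA uk mul1r !mulNr -opprD addKr.
Qed.

(** Otherwise f1 would be a multiple of f2 modulo the square of the maximal ideal. *)
Lemma coef_unit f1 g1 f2 b c g w : params (vec3 f1 g1 f2) -> f1 = b * f2 + c * g + w ->
  mm g -> idpow mm 2 w -> ~ mm c.
Proof.
move=> px e mg w2 mc.
have /(idpow2_lpart p0 px)[_ /(_ (inord 0))] : idpow mm 2 (1 * f1 + 0 * g1 + - b * f2).
  rewrite e mul1r mul0r addr0 mulNr -!addrA addrC addrA addrNK.
  by have [_ ID _] := idpow_ideal mm 2; apply: ID => //; exact: idpow2_mul.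
have -> : 1 * f1 + 0 * g1 + - b * f2 = \sum_i vec3 1 0 (- b) i * vec3 f1 g1 f2 i.
  by rewrite sum3 !inordK.
by rewrite lpart_sum inordK //= rmorph1 => /eqP; rewrite oner_eq0.
Qed.

Lemma order_bound P2 g2 f2 t2 f1 q M : P2 = ideal2 f2 g2 -> P2 `<=` mm -> mm t2 ->
  (forall a, mm a -> exists b, P2 (a - b * t2)) ->
  tangency_order P2 (principal f1) q -> leq_inf M q ->
  exists a b c, f1 = b * f2 + c * g2 + a * t2 ^+ M.
Proof.
move=> eP Pm mt Pt to Mq; have idP : is_ideal P2 by rewrite eP; exact: ideal2_ideal.
suff [a] : exists a, P2 (f1 - a * t2 ^+ M).
  by rewrite eP => -[b [c e]]; exists a, b, c; rewrite -e subrK.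
case: q to Mq => [q|] /= to Mq.
  have [a h] := length_order p0 idP Pm mt Pt to.
  by exists (a * t2 ^+ (q - M)); rewrite -mulrA -exprD subnK.
by exists 0; rewrite mul0r subr0; apply: to; exists 1; rewrite mul1r.
Qed.

(** By transversality the equations f1 and g1 of C_1 and the equation f2 of S_2 are
    parameters.  On C_2 the germ f1 has order at least M = max(m, 2); measured by
    g1, which is a parameter of C_2 since f1 is, modulo squares, a combination of
    the equations of C_2, this gives f1 = a g1^M + b f2 + c g2 with c a unit.  So
    x = g1, y = f1 - a g1^M and z = f2 have the required properties. *)
Lemma normal_form P1 P2 S1 S2 Z1 Z2 m n q : is_ideal P1 -> is_ideal P2 ->
  regular_local (quotring P1) 1 -> regular_local (quotring P2) 1 ->
  smooth_surface_germ S1 -> smooth_surface_germ S2 ->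
  cartier_multiple m S1 P1 Z1 -> cartier_multiple n S2 P2 Z2 ->
  (0 < m)%N -> (0 < n)%N ->
  transverse P1 S2 -> tangency_order P2 S1 q -> leq_inf 2 q -> leq_inf m q ->
  exists x y z, [/\ params (vec3 x y z), P1 = ideal2 x y, P2 = ideal2 y z,
    Z1 = ideal2 y (x ^+ m) & Z2 = ideal2 z (y ^+ n)].
Proof.
move=> id1 id2 r1 r2 s1 s2 [g1 eP1 eZ1] [g2 eP2 eZ2] m0 n0 tr to q2 qm.
have [f1 [mf1 nf1 eS1]] := smooth_surface p0 s1.
have [f2 [mf2 nf2 eS2]] := smooth_surface p0 s2.
subst S1 S2; rewrite (gen_principal_adjoin K) in eP1 eP2 eZ1 eZ2.
rewrite (gen_principal_adjoin K) in eZ1; rewrite (gen_principal_adjoin K) in eP2; rewrite (gen_principal_adjoin K) in eZ2.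
have [Pm1 [t1 mt1 Pt1]] := regular_curve p0 id1 r1.
have [Pm2 [t2 mt2 Pt2]] := regular_curve p0 id2 r2.
subst P1.
have px1 := curve_params Pm1 mt1 Pt1.
have px := transverse_params px1 tr mf2 nf2.
have mg1 : mm g1 by apply: Pm1; exact: ideal2_r.
have mg2 : mm g2 by apply: Pm2; rewrite eP2; exact: ideal2_r.
pose M := maxn m 2.
have M2 : (2 <= M)%N by exact: leq_maxr.
have Mm : (m <= M)%N by exact: leq_maxl.
have Mq : leq_inf M q by case: (q) q2 qm => //= q' h1 h2; rewrite geq_max h2.
have mmM t : mm t -> forall a, idpow mm 2 (a * t ^+ M).
  move=> mt a; have [_ _ IM] := idpow_ideal mm 2; apply: IM.
  by apply: (idpow_le M2); exact: idpowX.
(* The parameter t2 of C_2 will be replaced by g1. *)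
have [a [b [c e1]]] := order_bound eP2 Pm2 mt2 Pt2 to Mq.
have nc : ~ mm c := coef_unit px e1 mg2 (mmM t2 mt2 a).
have px2 : params (vec3 f2 g2 g1).
  apply: params_nak => //; first exact: vec3_mm.
  have L : is_ideal [set u | exists2 v, lin (vec3 f2 g2 g1) v & idpow mm 2 (u - v)].
    have [l0 lD lM] := lin_ideal (vec3 f2 g2 g1); have [i0 iD iM] := idpow_ideal mm 2.
    split=> [|u u' [v lv iv] [v' lv' iv']|u u' [v lv iv]].
    - by exists 0; rewrite ?subr0.
    - by exists (v + v'); [exact: lD | rewrite opprD addrACA; exact: iD].
    - by exists (u * v); [exact: lM | rewrite -mulrBr; exact: iM].
  have sub u : lin (vec3 f2 g2 g1) u -> exists2 v, lin (vec3 f2 g2 g1) v & idpow mm 2 (u - v).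
    by move=> lu; exists u => //; rewrite subrr; case: (idpow_ideal mm 2).
  move=> u /(px.2) hu; apply: (lin3_ind L _ _ _ hu) => /=.
  - exists (b * f2 + c * g2); first by apply: ideal2_lin; exact: ideal2_comb.
    by rewrite e1 addrC addKr; exact: mmM.
  - by apply: sub; exact: lin3_2.
  - by apply: sub; exact: lin3_0.
have [b2 [c2 [e et]]] : exists i j k, t2 = i * f2 + j * g2 + k * g1 by apply/lin3P; exact: px2.2.
have tM : P2 (t2 ^+ M - (e * g1) ^+ M).
  apply: ideal_subX => //; rewrite et addrK eP2; exact: ideal2_comb.
have [a' [b' [c' e2]]] : exists a' b' c', f1 = b' * f2 + c' * g2 + a' * g1 ^+ M.
  exists (a * e ^+ M).
  have : P2 (a * (t2 ^+ M - (e * g1) ^+ M)) by case: id2 => _ _; apply.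
  rewrite eP2 => -[b3 [c3 e3]]; exists (b + b3), (c + c3).
  rewrite !mulrDl addrACA -e3 mulrBr exprMn mulrA e1 -!addrA; congr (_ + (_ + _)).
  by rewrite addNr addr0.
have nc' : ~ mm c' := coef_unit px e2 mg2 (mmM g1 mg1 a').
have [v vc] := unit_of nc'.
pose y := b' * f2 + c' * g2.
have ey : f1 = y + a' * g1 ^+ M by [].
have hM k z : (k <= M)%N -> ideal2 z (g1 ^+ k) (a' * g1 ^+ M).
  by move=> kM; rewrite -(subnK kM) exprD mulrA; exact: ideal2_Mr.
have hy k : (k <= M)%N -> ideal2 f1 (g1 ^+ k) = ideal2 y (g1 ^+ k).
  move=> kM; apply: ideal2_eq; try exact: ideal2_r.
    have [_ iD _] := ideal2_ideal y (g1 ^+ k); rewrite ey.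
    by apply: iD; [exact: ideal2_l | exact: hM].
  have -> : y = f1 - a' * g1 ^+ M by rewrite ey addrK.
  by apply: (ideal_sub (ideal2_ideal _ _)); [exact: ideal2_l | exact: hM].
exists g1, y, f2; split.
- split; first by apply: vec3_mm => //; rewrite /y; case: idmm => _ iD iM; apply: iD; exact: iM.
  move=> u /(px.2); apply: lin3_ind; [exact: lin_ideal| |exact: lin3_0|exact: lin3_2].
  have [_ iD iM] := lin_ideal (vec3 g1 y f2); rewrite ey; apply: iD; first exact: lin3_1.
  rewrite -(subnK (ltnW M2)) exprD expr1 mulrA; apply: iM; exact: lin3_0.
- by have := hy 1%N (ltnW M2); rewrite expr1 ideal2C => ->; rewrite ideal2C.
- rewrite eP2; apply: ideal2_eq; [exact: ideal2_r | | exact: ideal2_comb | exact: ideal2_l].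
  exists v, (- (v * b')); rewrite /y mulrDr !mulrA vc mul1r mulNr.
  by rewrite [v * b' * f2 + _]addrC addrK.
- by rewrite eZ1; exact: hy.
- rewrite eZ2.
  have pow I : is_ideal I -> I f2 -> I (y ^+ n - (c' * g2) ^+ n).
    move=> idI If2; apply: ideal_subX => //; rewrite /y addrK.
    by case: idI => _ _; apply.
  have idl : is_ideal (ideal2 f2 (y ^+ n)) := ideal2_ideal _ _.
  have idr : is_ideal (ideal2 f2 (g2 ^+ n)) := ideal2_ideal _ _.
  apply: ideal2_eq; try exact: ideal2_l.
    have -> : g2 ^+ n = v ^+ n * (y ^+ n - (y ^+ n - (c' * g2) ^+ n)).
      by rewrite opprB addrC subrK exprMn mulrA -exprMn vc expr1n mul1r.
    case: (idl) => _ _; apply; apply: (ideal_sub idl); [exact: ideal2_r|].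
    by apply: pow => //; exact: ideal2_l.
  have -> : y ^+ n = (y ^+ n - (c' * g2) ^+ n) + c' ^+ n * g2 ^+ n by rewrite exprMn subrK.
  case: (idr) => _ iD _; apply: iD; last exact: ideal2_Mr.
  by apply: pow => //; exact: ideal2_l.
Qed.

End NormalForm.

(** * The ideal of the union of the multiplicity structures *)

Section ThreeGenerators.
Variable A : comPzRingType.
Implicit Types (a b c : A).

Definition ideal3 a b c : set A := [set u | exists i j k, u = i * a + j * b + k * c].

Lemma ideal3_facts a b c : is_ideal (ideal3 a b c) /\
  [/\ ideal3 a b c a, ideal3 a b c b & ideal3 a b c c].
Proof.
split.
  split=> [|_ _ [b1 [b2 [b3 ->]]] [c1 [c2 [c3 ->]]]|e _ [b1 [b2 [b3 ->]]]].
  - by exists 0, 0, 0; rewrite !mul0r !addr0.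
  - exists (b1 + c1), (b2 + c2), (b3 + c3).
    by rewrite !mulrDl addrACA; congr (_ + _); rewrite addrACA.
  - by exists (e * b1), (e * b2), (e * b3); rewrite !mulrDr !mulrA.
split; [exists 1, 0, 0 | exists 0, 1, 0 | exists 0, 0, 1];
  by rewrite mul1r !mul0r ?addr0 ?add0r.
Qed.

End ThreeGenerators.

Section Stalks.
Variables (K : fieldType) (p : 'I_4 -> K).
Hypothesis p0 : p != 0.
Notation S := {mpoly K[4]}.
Notation A := (localP3 p).
Notation mm := (@maxideal A).
Notation cstA := (@cstP3 K p).
Implicit Types (a b f g h t x y z : A) (I J : set S) (F G : S).
Notation vec3 a b c := (fun j : 'I_3 => nth 0 [:: a; b; c] j).

Lemma stalk_ideal I : is_ideal I -> is_ideal (stalk p I).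
Proof.
move=> [I0 ID IM]; split.
- exists 0%N, 0, 1; rewrite rpred0 dhomog1 meval1 oner_neq0 tofrac0 mul0r; split=> //.
- move=> f g [d [F [G [Fd Gd Gp IF e]]]] [d' [F' [G' [Fd' Gd' Gp' IF' e']]]].
  exists (d + d')%N, (F * G' + F' * G), (G * G'); split.
  + by apply: rpredD; [|rewrite addnC]; apply: dhomogM.
  + exact: dhomogM.
  + by rewrite mevalM mulf_neq0.
  + by apply: ID; [rewrite mulrC|rewrite mulrC]; apply: IM.
  + by rewrite lvD e e' tofracD !tofracM; apply: addf_div; [exact: denom_neq0 Gp | exact: denom_neq0 Gp'].
move=> f g [d' [F' [G' [Fd' Gd' Gp' IF' e']]]].
have [d [F [G [Fd Gd Gp e]]]] := quot_ex f.
exists (d + d')%N, (F * F'), (G * G'); split; try exact: dhomogM.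
- by rewrite mevalM mulf_neq0.
- exact: IM.
by rewrite lvM e e' mulf_div -!tofracM.
Qed.

Lemma stalkI I J : is_ideal I -> is_ideal J ->
  stalk p (I `&` J) = stalk p I `&` stalk p J.
Proof.
move=> [_ _ IM] [_ _ JM]; apply/seteqP; split=> f.
  by move=> [d [F [G [Fd Gd Gp [IF JF] e]]]]; split; exists d, F, G.
move=> [[d [F [G [Fd Gd Gp IF e]]]] [d' [F' [G' [Fd' Gd' Gp' JF e']]]]].
have FF : F * G' = F' * G by apply: (@quot_cross _ p f d F G d' F' G').
exists (d + d')%N, (F * G'), (G * G'); split; try exact: dhomogM.
- by rewrite mevalM mulf_neq0.
- by split; [rewrite mulrC; exact: IM | rewrite FF mulrC; exact: JM].
by rewrite e !tofracM -mulf_div divff ?mulr1 // (denom_neq0 Gp').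
Qed.

Section Monomials.
Variables x y z : A.
Hypothesis px : params (vec3 x y z).
Notation E := (taylor p0 px).

Lemma taylor_monomial i j k : E (x ^+ i * y ^+ j * z ^+ k) = mono K (mnm3 i j k).
Proof.
rewrite !rmorphM !rmorphXn /=.
have h l : E (vec3 x y z (inord l)) = mono K U_(inord l)%MM by rewrite taylor_param.
have := (h 0%N, h 1%N, h 2%N); rewrite !inordK //= U3E0 U3E1 U3E2 => -[[-> ->] ->].
by rewrite !mono_exp -!monoD !mnm3Mn !mnm3D !mul0n !mul1n !addn0 !add0n.
Qed.

Lemma taylor_yz : E (y * z) = mono K (mnm3 0 1 1).
Proof. by rewrite -taylor_monomial expr0 mul1r !expr1. Qed.
Lemma taylor_yn n : E (y ^+ n) = mono K (mnm3 0 n 0).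
Proof. by rewrite -taylor_monomial !expr0 mul1r mulr1. Qed.
Lemma taylor_xm m : E (x ^+ m) = mono K (mnm3 m 0 0).
Proof. by rewrite -taylor_monomial !expr0 !mulr1. Qed.
Lemma taylor_xz m : E (x ^+ m * z) = mono K (mnm3 m 0 1).
Proof. by rewrite -taylor_monomial expr0 mulr1 expr1. Qed.
Lemma taylor_y : E y = mono K (mnm3 0 1 0).
Proof. by rewrite -(taylor_yn 1). Qed.
Lemma taylor_z : E z = mono K (mnm3 0 0 1).
Proof. by rewrite -taylor_monomial !expr0 !mul1r expr1. Qed.

Lemma mono3M (a b c : nat) (V : fps 3 K) i j k : (mono K (mnm3 a b c) * V) (mnm3 i j k) =
  if [&& (a <= i)%N, (b <= j)%N & (c <= k)%N] then V (mnm3 (i - a) (j - b) (k - c)) else 0.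
Proof. by rewrite monoM mnm3_le mnm3B. Qed.

(** A monomial lies in both ideals only if y z, y^n or x^m z divides it. *)
Lemma monomial_inter m n a : (0 < n)%N ->
  ideal2 y (x ^+ m) a -> ideal2 z (y ^+ n) a -> ideal3 (y * z) (y ^+ n) (x ^+ m * z) a.
Proof.
move=> n0 [i [j e1]] [k [l e2]].
have V1 (b c : nat) : (b < m)%N -> E a (mnm3 b 0 c) = 0.
  move=> bm; rewrite e1 rmorphD !rmorphM /= taylor_y taylor_xm fpsD ![E _ * _]mulrC.
  by rewrite !mono3M /= leqNgt bm /= addr0.
have V2 (b c : nat) : (c < n)%N -> E a (mnm3 b c 0) = 0.
  move=> cn; rewrite e2 rmorphD !rmorphM /= taylor_z taylor_yn fpsD ![E _ * _]mulrC.
  by rewrite !mono3M /= (leqNgt n) cn /= addr0.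
have [id3 [in1 in2 in3]] := ideal3_facts (y * z) (y ^+ n) (x ^+ m * z).
pose V : fps 3 K := E a.
apply: (@taylor_mem _ p p0 _ px _ a _ _ _
  (fun u => V (u + mnm3 0 1 1)%MM)
  (fun u => if u (inord 2) == 0%N then V (u + mnm3 0 n 0)%MM else 0)
  (fun u => if u (inord 1) == 0%N then V (u + mnm3 m 0 1)%MM else 0) id3 in1 in2 in3).
rewrite taylor_yz taylor_yn taylor_xz; apply/fpsP => u.
rewrite (mnm3P u); move: (u (inord 0)) (u (inord 1)) (u (inord 2)) => b c d.
rewrite !fpsD ![_ * mono K _]mulrC !mono3M !mnm3D !mnmE23 !leq0n !subn0 /= !addn0 !andbT.
case: d => [|d].
  rewrite !ltn0 !andbF add0r addr0 /=; case: (leqP n c) => [nc|cn]; last exact: V2.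
  by rewrite subnK.
case: c => [|c].
  rewrite (leqNgt n) n0 /= !add0r !subSS subn0 addn1 andbT.
  by case: (leqP m b) => [mb|bm]; [rewrite subnK | exact: V1].
by rewrite /= !subSS !subn0 !addn1 !if_same !addr0.
Qed.

Lemma taylor_combination m n (al be ga : A) :
  E (al * (y * z) + be * y ^+ n + ga * (x ^+ m * z)) =
  mono K (mnm3 0 1 1) * E al + mono K (mnm3 0 n 0) * E be + mono K (mnm3 m 0 1) * E ga.
Proof.
rewrite 2!rmorphD /= (rmorphM E al) (rmorphM E be) (rmorphM E ga) /=.
by rewrite taylor_yz taylor_yn taylor_xz ![E _ * _]mulrC.
Qed.

Lemma mnm3_0 : mnm3 0 0 0 = 0%MM.
Proof. by apply/mnmP => -[[|[|[|//]]] i3]; rewrite !mnmE. Qed.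

Section Coefficients.
Variables (m n : nat) (al be ga : A).
Hypotheses (m0 : (0 < m)%N) (n1 : (1 < n)%N).
Let f := al * (y * z) + be * y ^+ n + ga * (x ^+ m * z).

(** The values of al, be and ga at the point are coefficients of the expansion of f,
    hence linear in f. *)
Lemma coef_yz : E f (mnm3 0 1 1) = lev p0 al.
Proof.
rewrite /f taylor_combination !fpsD !mono3M /= (leqNgt n) n1 leqn0 (gtn_eqF m0) /=.
by rewrite !subnn !addr0 mnm3_0 taylor_lev.
Qed.

Lemma coef_yn : E f (mnm3 0 n 0) = lev p0 be.
Proof.
rewrite /f taylor_combination !fpsD !mono3M /= !andbF leqnn /=.
by rewrite !subnn !addr0 add0r mnm3_0 taylor_lev.
Qed.

Lemma coef_xz : E f (mnm3 m 0 1) = lev p0 ga.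
Proof.
rewrite /f taylor_combination !fpsD !mono3M /= leqnn leqn0 (gtn_eqF (ltnW n1)) /=.
by rewrite !subnn !add0r mnm3_0 taylor_lev.
Qed.

End Coefficients.
End Monomials.

(** A tangent functional vanishing on y is determined by its values on x and z.  With
    n = 1 the parameter y would lie in the ideals of both multiplicity structures. *)
Lemma tangent_dim_lt3 x y z (J : set A) : params (vec3 x y z) -> J y ->
  ~ has_dim (tangent J) 3.
Proof.
move=> px Jy [b [bV buniq]].
have [mx px'] := px.
have mmx : mm x by exact: (mx ord0).
have mmy : mm y by have := mx (inord 1); rewrite inordK.
have mmz : mm z by have := mx (inord 2); rewrite inordK.
have Dlin D a e : tangent J D -> mm e -> D (a * e) = lev p0 a *: D e.
  move=> [DD DZ _ DM _] me.
  rewrite -{1}[a](subrK (cstA (lev p0 a))) mulrDl DD DM ?add0r ?DZ //.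
  exact: mm_split.
have Deq D D' : tangent J D -> tangent J D' -> D x = D' x -> D z = D' z -> D = D'.
  move=> tD tD' ex ez; apply/funext => a.
  rewrite -[a](subrK (cstA (lev p0 a))).
  have [i [j [k ->]]] : exists i j k, a - cstA (lev p0 a) = i * x + j * y + k * z.
    by apply/lin3P; apply: px'; exact: mm_split.
  have [DD DZ D1 _ DJ] := tD; have [DD' DZ' D1' _ DJ'] := tD'.
  rewrite -[cstA _]mulr1 !DD !DD' !DZ !DZ' D1 D1' !(Dlin _ _ _ tD) // !(Dlin _ _ _ tD') //.
  by rewrite ex ez (DJ _ Jy) (DJ' _ Jy).
pose M : 'M[K]_(3, 2) := \matrix_(i, j) (if j == 0 then b i x else b i z).
have : kermx M != 0.
  by rewrite -mxrank_eq0 mxrank_ker subn_eq0 -ltnNge; apply: leq_ltn_trans (rank_leq_col M) _.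
move=> /rowV0Pn[v /sub_kermxP vM v0].
have v00 : lincomb b (fun i => v ord0 i) = lincomb b (fun=> 0).
  apply: Deq; try exact: bV.
    have /matrixP /(_ ord0 0) := vM; rewrite !mxE => h.
    rewrite /lincomb !fct_sumE [RHS]big1 => [|i _]; last by rewrite scale0r.
    by rewrite -[RHS]h; apply: eq_bigr => i _; rewrite !mxE.
  have /matrixP /(_ ord0 1) := vM; rewrite !mxE => h.
  rewrite /lincomb !fct_sumE [RHS]big1 => [|i _]; last by rewrite scale0r.
  by rewrite -[RHS]h; apply: eq_bigr => i _; rewrite !mxE.
have [c [_ cu]] := buniq _ (bV (fun=> 0)).
case/eqP: v0; apply/rowP => i; rewrite mxE.
by have /(congr1 (fun w => w i)) := etrans (esym (cu _ (esym v00))) (cu _ erefl).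
Qed.

End Stalks.

(** * The completed local ring of a surface *)

Lemma telescope_step (E : comNzRingType) (a s b c v : E) :
  a + (s + (b - c - v)) - b = (a + s - c) - v.
Proof. ring. Qed.

Section Factor.
Variables (E T C : comPzRingType) (f : {rmorphism E -> T}) (g : {rmorphism E -> C}).
Hypothesis f_surj : forall t, exists e, f e = t.
Hypothesis f_ker : forall e, f e = 0 -> g e = 0.

Definition factor (t : T) : C := g (projT1 (cid (f_surj t))).

Lemma factorE e : factor (f e) = g e.
Proof.
rewrite /factor; case: cid => e' /= h; apply/eqP; rewrite -subr_eq0 -rmorphB; apply/eqP.
by apply: f_ker; rewrite rmorphB h subrr.
Qed.

Fact factor_additive : zmod_morphism factor.
Proof.
move=> s t; have [a <-] := f_surj s; have [b <-] := f_surj t.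
by rewrite -rmorphB !factorE rmorphB.
Qed.
Fact factor_multiplicative : monoid_morphism factor.
Proof.
split=> [|s t]; first by rewrite -(rmorph1 f) factorE rmorph1.
have [a <-] := f_surj s; have [b <-] := f_surj t.
by rewrite -rmorphM !factorE rmorphM.
Qed.
HB.instance Definition _ := GRing.isZmodMorphism.Build _ _ factor factor_additive.
HB.instance Definition _ := GRing.isMonoidMorphism.Build _ _ factor factor_multiplicative.

Lemma factor_inj : (forall e, g e = 0 -> f e = 0) -> injective factor.
Proof.
move=> h s t; have [a <-] := f_surj s; have [b <-] := f_surj t.
rewrite !factorE => e; apply/eqP; rewrite -subr_eq0 -rmorphB; apply/eqP; apply: h.
by rewrite rmorphB e subrr.
Qed.

Lemma factor_bij : (forall e, g e = 0 -> f e = 0) -> (forall c, exists e, g e = c) ->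
  bijective factor.
Proof.
move=> h gs; have inj := factor_inj h.
pose k c : T := f (projT1 (cid (gs c))).
have kK c : factor (k c) = c by rewrite factorE /k; case: cid.
by exists k => // t; apply: inj; rewrite kK.
Qed.

Definition factor_morphism : {rmorphism T -> C} := factor.

End Factor.

Section ToCompletion.
Variables (A : comPzRingType) (J : set A).

Fact to_completion_additive : zmod_morphism (to_completion J).
Proof.
move=> a b; rewrite /to_completion -[RHS](rmorphB (quot_pi _)).
by congr (quot_pi _ _); apply: val_inj.
Qed.
Fact to_completion_multiplicative : monoid_morphism (to_completion J).
Proof.
split=> [|a b]; rewrite /to_completion.
  by rewrite -[RHS](rmorph1 (quot_pi _)); congr (quot_pi _ _); apply: val_inj.
by rewrite -[RHS](rmorphM (quot_pi _)); congr (quot_pi _ _); apply: val_inj.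
Qed.
HB.instance Definition _ := GRing.isZmodMorphism.Build _ _ (to_completion J) to_completion_additive.
HB.instance Definition _ := GRing.isMonoidMorphism.Build _ _ (to_completion J) to_completion_multiplicative.

Variables (B : comPzRingType) (X : set B).

Definition complete_germ (b : B) : completion (@maxideal (quotring X)) :=
  to_completion (@maxideal (quotring X)) (quot_pi X b).

End ToCompletion.

HB.instance Definition _ (B : comPzRingType) (X : set B) :=
  GRing.RMorphism.copy (@complete_germ B X) (to_completion (@maxideal (quotring X)) \o quot_pi X).

Section CompletionOfQuotient.
Variables (K : fieldType) (p : 'I_4 -> K).
Hypothesis p0 : p != 0.
Notation A := (localP3 p).
Notation mm := (@maxideal A).
Notation cstA := (@cstP3 K p).
Variables (xv : 'I_3 -> A) (X : set A) (f0 : A).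
Hypothesis px : params xv.
Notation E := (taylor p0 px).
Hypothesis genX : gen_ideal X = principal f0.
Hypothesis mm_f0 : mm f0.
Notation B := (quotring X).
Notation M := (@maxideal B).
Notation T := (completion M).
Notation pi := (quot_pi X).
Notation ev := (peval xv).
Implicit Types (a b u : A) (P Q : {mpoly K[3]}) (V W : fps 3 K).

Lemma genX_mm : gen_ideal X `<=` mm.
Proof. by rewrite genX => _ [b ->]; case: (mm_ideal p0) => _ _ IM; apply: IM; exact: mm_f0. Qed.

Lemma idpow_pi k a : idpow mm k a -> idpow M k (pi a).
Proof.
apply: (@idpow_min _ mm [set a | idpow M k (pi a)]); first exact: preim_ideal (idpow_ideal _ _).
move=> l sl lm /=; rewrite rmorph_prod /=.
rewrite -[k]sl -(size_map pi) -(big_map pi xpredT id); apply: idpow_prod => //.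
by move=> _ /mapP[a' /lm ma ->]; apply/(quot_maxideal p0 a' genX_mm).
Qed.

Lemma idpow_piP k a : idpow M k (pi a) -> exists2 u, gen_ideal X u & idpow mm k (a - u).
Proof.
move=> h; have : exists2 b, pi a = pi b & idpow mm k b.
  move: h; apply: (@idpow_min _ M [set z | exists2 b, z = pi b & idpow mm k b]).
    have [i0 iD iM] := idpow_ideal mm k.
    split=> [|_ _ [b -> hb] [c -> hc]|z _ [b -> hb]].
    - by exists 0; rewrite ?rmorph0.
    - by exists (b + c); [rewrite rmorphD | exact: iD].
    - by have [c ->] := quot_ind z; exists (c * b); [rewrite rmorphM | exact: iM].
  move=> l; elim: l k => [|z l IH] k.
    by move=> <- _; exists 1; rewrite ?big_nil ?rmorph1 //; exact: idpow0.
  case: k => // k [sl] lm; have [b eb hb] := IH k sl (fun y yl => lm y (@mem_behead _ (z :: l) y yl)).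
  have [c ec] := quot_ind z; have := lm z (mem_head _ _); rewrite ec => /(quot_maxideal p0 c genX_mm) mc.
  exists (c * b); first by rewrite rmorphM /= -ec -eb big_cons.
  by rewrite -[k.+1]add1n; apply: idpow_mul => //; exact: idpow_in.
move=> [b /quot_piE h' hb]; exists (a - b) => //.
by rewrite opprB addrC subrK.
Qed.

Lemma cohseqM (u v : cohseq M) n : cohseq_val (u * v) n = cohseq_val u n * cohseq_val v n.
Proof. by []. Qed.

Let null : set (cohseq M) := [set u | forall n, idpow M n (cohseq_val u n)].

Lemma null_ideal : is_ideal null.
Proof.
split=> [n|u v hu hv n|u v hv n]; have [i0 iD iM] := idpow_ideal M n.
- exact: i0.
- exact: iD (hu n) (hv n).
- rewrite cohseqM; exact: iM (hv n).
Qed.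

Lemma completionP (u v : cohseq M) : (quot_pi null u : T) = quot_pi null v <->
  forall n, idpow M n (cohseq_val u n - cohseq_val v n).
Proof.
have h : gen_ideal null (u - v) <-> null (u - v) by rewrite (gen_ideal_id null_ideal).
split; first by move=> /quot_piE /h.
by move=> e; apply/quot_piE/h.
Qed.

Definition theta_seq V : nat -> B := fun k => pi (ev (trunc k V)).

Lemma ev_idpow k P : ordge k (fps_of_mpoly P) -> idpow mm k (ev P).
Proof. by apply: peval_ordge; case: px. Qed.

Lemma trunc_ordge d e V : (d <= e)%N -> ordge d (fps_of_mpoly (trunc d V) - fps_of_mpoly (trunc e V)).
Proof.
move=> de m md; rewrite fpsB /fps_of_mpoly !coeff_trunc md (leq_trans md de).
by rewrite subrr.
Qed.

Lemma theta_coherent V : theta_seq V \in coherent M.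
Proof.
apply/coherentP => k; rewrite /theta_seq -rmorphB; apply: idpow_pi; rewrite -rmorphB.
apply: ev_idpow; rewrite rmorphB -opprB; apply: ordgeN; exact: trunc_ordge.
Qed.

(** The value of a power series at the parameters. *)
Definition theta V : T := quot_pi null (CohSeq (theta_coherent V)).

Fact theta_additive : zmod_morphism theta.
Proof.
move=> V W; rewrite /theta -[LHS]/(quot_pi null _ : T) -rmorphB; apply/completionP => n /=.
change (idpow M n (theta_seq (V - W) n - (theta_seq V n - theta_seq W n))).
rewrite /theta_seq -!rmorphB; apply: idpow_pi; apply: ev_idpow.
move=> m mn; rewrite /fps_of_mpoly !mcoeffB !coeff_trunc mn fpsB.
by rewrite subrr.
Qed.
Fact theta_multiplicative : monoid_morphism theta.
Proof.
split=> [|V W].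
  rewrite /theta -[LHS]/(quot_pi null _ : T) -(rmorph1 (quot_pi null)); apply/completionP => n /=.
  change (idpow M n (theta_seq 1 n - 1)).
  rewrite /theta_seq -(rmorph1 pi) -rmorphB -(rmorph1 ev); apply: idpow_pi; rewrite -rmorphB; apply: ev_idpow.
  by move=> m mn; rewrite /fps_of_mpoly !mcoeffB !coeff_trunc mn fps1 mcoeff1 subrr.
rewrite /theta -[LHS]/(quot_pi null _ : T) -rmorphM; apply/completionP => n /=.
change (idpow M n (theta_seq (V * W) n - theta_seq V n * theta_seq W n)).
rewrite /theta_seq -rmorphM -rmorphB; apply: idpow_pi; rewrite -rmorphM -rmorphB; apply: ev_idpow.
by move=> m mn; rewrite /fps_of_mpoly !mcoeffB !coeff_trunc mn (fpsM_trunc _ _ mn) subrr.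
Qed.
HB.instance Definition _ := GRing.isZmodMorphism.Build _ _ theta theta_additive.
HB.instance Definition _ := GRing.isMonoidMorphism.Build _ _ theta theta_multiplicative.

Lemma theta_taylor a : theta (E a) = complete_germ X a.
Proof.
rewrite /theta /complete_germ /to_completion; apply/completionP => n /=.
rewrite /theta_seq -rmorphB; apply: idpow_pi; rewrite -opprB.
by have [_ _ iM] := idpow_ideal mm n; rewrite -mulN1r; apply: iM; exact: (@taylorP _ _ p0 _ px a n).
Qed.

Lemma complete_germ_f0 : complete_germ X f0 = 0.
Proof.
rewrite /complete_germ; have /quot_pi_eq0 -> : gen_ideal X f0 by rewrite genX; exists 1; rewrite mul1r.
rewrite /to_completion -(rmorph0 (quot_pi null)); apply/completionP => n /=.
by rewrite subrr; case: (idpow_ideal M n).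
Qed.

(** A coherent sequence of classes modulo f0 lifts to a Cauchy sequence of germs:
    its differences are corrected by multiples of f0 one after the other. *)
Lemma theta_surj t : exists V, theta V = t.
Proof.
have [[u cu] ->] := quot_ind t; have /coherentP cu' := cu.
have [a ua] : exists a : nat -> A, forall k, u k = pi (a k).
  by have [a h] := choice (fun k => quot_ind (u k)); exists a.
have [v hv] : exists v : nat -> A, forall k, gen_ideal X (v k) /\ idpow mm k (a k.+1 - a k - v k).
  suff h k : exists w, gen_ideal X w /\ idpow mm k (a k.+1 - a k - w) by have [v hv] := choice h; exists v.
  have := cu' k; rewrite !ua -rmorphB => /idpow_piP[w Xw hw]; by exists w.
pose w k := a k.+1 - a k - v k.
have [V0 hV0] := series_lim (c := fun k => E (w k)) (fun k => proj1 (taylor_idpow p0 px k (w k)) (hv k).2).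
exists (E (a 0%N) + V0); rewrite /theta; apply/completionP => n /=.
rewrite /theta_seq ua.
pose b := a 0%N + \sum_(i < n) w i.
have Xb : gen_ideal X (b - a n).
  have [XX0 XXD XXM] := gen_idealP X; rewrite /b.
  elim: (n) => [|k IH]; first by rewrite big_ord0 addr0 subrr.
  rewrite big_ord_recr /= /w; set s := \sum_(_ < _) _ in IH *.
  rewrite telescope_step.
  by apply: (ideal_sub (gen_idealP X)) => //; exact: (hv k).1.
have -> : pi (a n) = pi b by apply/esym/quot_piE.
rewrite -rmorphB; apply: idpow_pi.
have hb : ordge n (E (a 0%N) + V0 - E b).
  by rewrite /b rmorphD rmorph_sum /= opprD addrACA subrr add0r; exact: hV0.
have -> : trunc n (E (a 0%N) + V0) = trunc n (E b).
  apply/mpolyP => m; rewrite !coeff_trunc; case: ifP => // /hb /eqP.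
  by rewrite fpsB subr_eq0 => /eqP.
rewrite -opprB -mulN1r; have [_ _ iM] := idpow_ideal mm n; apply: iM.
exact: (@taylorP _ _ p0 _ px b n).
Qed.

Lemma theta_f0M W : theta (E f0 * W) = 0.
Proof. by rewrite rmorphM /= theta_taylor complete_germ_f0 mul0r. Qed.

(** If theta V = 0, then V is approximated to every order by multiples of the
    expansion of f0, which g kills. *)
Lemma theta_ker r (g : {rmorphism fps 3 K -> fps r K}) V :
  (forall k W, ordge k W -> ordge k (g W)) -> g (E f0) = 0 -> theta V = 0 -> g V = 0.
Proof.
move=> gk g0; have -> : (0 : T) = quot_pi null 0 by rewrite rmorph0.
move=> /completionP h; apply: ordge_eq0 => k.
have := h k; rewrite /= subr0 => /idpow_piP[u]; rewrite genX => -[c ->].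
move=> /(taylor_idpow p0 px); rewrite rmorphB rmorphM /= taylor_peval => o.
have -> : V = (V - fps_of_mpoly (trunc k V)) + (fps_of_mpoly (trunc k V) - E c * E f0)
   + E c * E f0 by rewrite addrA subrK subrK.
rewrite rmorphD [g (E c * _)]rmorphM /= g0 mulr0 addr0.
by apply: gk; apply: ordgeD => //; exact: ordge_trunc.
Qed.

End CompletionOfQuotient.

(** * The class of the second curve *)

Lemma mono_neq0 (K : comNzRingType) n (k : 'X_{1..n}) : mono K k <> 0.
Proof. by move/fpsP/(_ k) => /eqP; rewrite monoE eqxx fps0 oner_eq0. Qed.

Section ClassOfSecondCurve.
Variables (K : fieldType) (N' : nat) (T : comPzRingType).
Notation N := N'.+1.
Notation R := (fps 2 K).
Variable psi : {rmorphism T -> R}.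
Hypothesis psi_inj : injective psi.
Hypothesis psi_wt : forall x, weighted (0 : 'I_N) (psi x).
Hypothesis psi_surj : forall r, weighted (0 : 'I_N) r -> exists x, psi x = r.
Variable X : T.
Hypothesis psiX : psi X = vs K ^+ N.
Notation Pvs := (P_vs psi_inj psi_wt psi_surj psiX).
Notation weight := (Cl_weight psi_inj psi_wt psi_surj psiX).

Lemma Cl_weight_P_vs : weight (prime_class Pvs) = inZp 1.
Proof.
rewrite Cl_weight_pi div_weightU mulr1z.
by case: (irr_P_vs psi_inj psi_wt psi_surj psiX).
Qed.

Lemma prime_height1 (P : set T) : prime_ideal P -> ~ P X ->
  (exists2 x, P x & x <> 0) -> exists J : height1 T, val J = P.
Proof.
move=> pP PX Px; have [w [h [hh e _]]] := prime_contract psi_inj psi_wt psi_surj psiX pP PX Px.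
have h1 : height P 1 by rewrite e; exact: (hirr_height psi_inj psi_wt psi_surj psiX hh).
by exists (exist _ P (asboolT (conj pP h1))).
Qed.

Variables (m n : nat) (Z y z a b c : T).
Hypotheses (m0 : (0 < m)%N) (n1 : (1 < n)%N) (mnN : (m * n)%N = N).
Hypothesis psiZ : psi Z = vs K * vt K.
Hypothesis ye : y = a * X - c * Z ^+ m.
Hypothesis c_unit : (psi c) 0%MM != 0.
Hypothesis Xz : X * z = b * y ^+ n.
Hypothesis J_prime : prime_ideal (ideal2 y z).
Hypothesis JX : ~ ideal2 y z X.

Let g : R := psi a * vs K ^+ (N - m) - psi c * vt K ^+ m.

Lemma psi_y : psi y = vs K ^+ m * g.
Proof.
have mN : (m <= N)%N by rewrite -mnN leq_pmulr // ltnW.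
rewrite ye rmorphB !rmorphM rmorphXn psiX psiZ /= exprMn /g mulrBr.
by rewrite -{1}(subnKC mN) exprD; congr (_ - _); rewrite mulrCA.
Qed.

Lemma vs_ndvd_g : ~ fdvd (vs K) g.
Proof.
have Nm : (0 < N - m)%N by rewrite subn_gt0 -mnN -{1}[m]muln1 ltn_pmul2l.
move=> sg; have : fdvd (vs K) (psi c * vt K ^+ m).
  have -> : psi c * vt K ^+ m = psi a * vs K ^+ (N - m) - g by rewrite /g opprB addrC subrK.
  apply: fdvdB => //; apply: fdvdMl; rewrite -(prednK Nm) exprS; apply: fdvdMr; exact: fdvdxx.
case/vs_prime; last exact: vs_ndvd_vt.
have [u cu] := fps_unit c_unit; move=> sc; apply: (@vs_ndvd_vt K 0).
by rewrite expr0 -cu; apply: fdvdMr.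
Qed.

Lemma y_neq0 : y <> 0.
Proof.
move=> y0; apply: vs_ndvd_g; have : vs K ^+ m * g = 0 by rewrite -psi_y y0 rmorph0.
case/fps_mulf_eq0 => [e|->]; last exact: fdvd0.
by case: (mono_neq0 (etrans (esym (vsX K m)) e)).
Qed.

Lemma ideal2_X u : ideal2 y z u -> exists v, X * u = y * v.
Proof.
move=> [i [j ->]]; exists (i * X + j * b * y ^+ n.-1).
rewrite mulrDr [X * (j * z)]mulrCA Xz -{1}(prednK (ltnW n1)) exprS.
ring.
Qed.

(** The divisor of y is m times C_1 plus C_2: at the generic point of C_2 the germ X
    is invertible, and X z = b y^n shows that y alone generates the maximal ideal;
    a prime containing y contains z or X by the same equation. *)
Lemma second_class : exists J : height1 T, val J = ideal2 y z /\
  weight (prime_class J) = - inZp m.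
Proof.
have [idJ J1 pJ] := J_prime; have [_ JD JM] := idJ.
have [J vJ] : exists J : height1 T, val J = ideal2 y z.
  by apply: prime_height1 => //; exists y; [exact: ideal2_l | exact: y_neq0].
exists J; split=> //; apply: (Cl_weight_prime _ y_neq0 psi_y vs_ndvd_g); rewrite ?vJ.
- by move=> e; apply: JX; rewrite -vJ e; exact: P_vsX.
- by exists 1 => //; rewrite mul1r; apply: idpow_in; exact: ideal2_l.
- move=> [s ns /(@idpow_min _ _ [set u | exists v, X ^+ 2 * u = y ^+ 2 * v]) h].
  case: h.
  + split=> [|u u' [v e] [v' e']|u u' [v e]]; first by exists 0; rewrite !mulr0.
      by exists (v + v'); rewrite !mulrDr e e'.
    by exists (u * v); rewrite mulrCA e mulrCA.
  + move=> [|u1 [|u2 [|//]]] // _ lJ.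
    have [v1 e1] := ideal2_X (lJ u1 (mem_head _ _)).
    have [v2 e2] : exists v, X * u2 = y * v by apply: ideal2_X; apply: lJ; rewrite !inE eqxx orbT.
    exists (v1 * v2); rewrite !big_cons big_nil mulr1 !expr2.
    by rewrite mulrACA e1 e2 mulrACA.
  move=> v e; have : X ^+ 2 * s = y * v.
    apply: (T_mulfI psi_inj y_neq0); by rewrite /= mulrCA [y * s]mulrC e expr2 mulrA.
  move=> e'; have : ideal2 y z (X ^+ 2 * s) by rewrite e' mulrC; exact: ideal2_Ml.
  by case/pJ => //; rewrite expr2 => /pJ[].
move=> P PP Py; apply/esym; apply: (height1_inj psi_inj psi_wt psi_surj psiX); rewrite vJ.
have [[idP P1 pP] _] := asboolW (valP P).
apply: ideal2_min => //.
have : val P (X * z) by rewrite Xz -(prednK (ltnW n1)) exprSr mulrA; case: idP => _ _; apply.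
by case/pP => // PX; case: PP; apply: P_vs_unique.
Qed.

End ClassOfSecondCurve.

(** * The singularity of a surface with prescribed germ *)

Section CompletingTheProduct.
Variable A : comNzRingType.
Implicit Types (al be ga x y z a b : A).

Lemma homogeneous_factor x y al ga n : (1 < n)%N ->
  exists q1 q2, \sum_(i < n) (al * y) ^+ (n.-1 - i) * (ga * x) ^+ i = q1 * y + q2 * x.
Proof.
move=> n1; apply: (big_ind (ideal2 y x)) => [|a b|[[|i] i_n] _] /=.
- by case: (ideal2_ideal y x).
- by case: (ideal2_ideal y x) => _ ID _; exact: ID.
- rewrite expr0 mulr1 subn0; case: n n1 {i_n} => [|[|n]] // _.
  by rewrite /= exprSr mulrA; exact: ideal2_Ml.
- by rewrite exprSr !mulrA; exact: ideal2_Mr.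
Qed.

(** Completing the product: al y + ga x^m divides (al y)^n - (- ga x^m)^n, so
    be y^n contributes a multiple of x^(m n) and a change of the second factor. *)
Lemma complete_product al al' be ga x y z m n : al * al' = 1 -> (0 < m)%N -> (1 < n)%N ->
  exists q1 q2, al * (y * z) + be * y ^+ n + ga * (x ^+ m * z) =
    (al * y + ga * x ^+ m) * (z + (q1 * y + q2 * x)) -
    (- (be * al' ^+ n * (- ga) ^+ n)) * x ^+ (m * n).
Proof.
move=> ala m0 n1.
have [q1 [q2 e]] := homogeneous_factor (x ^+ m) y al (- ga) n1.
exists (be * al' ^+ n * q1), (be * al' ^+ n * q2 * x ^+ m.-1).
have -> : be * al' ^+ n * q1 * y + be * al' ^+ n * q2 * x ^+ m.-1 * x =
  be * al' ^+ n * (q1 * y + q2 * x ^+ m).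
  by rewrite -{2}(prednK m0) [x ^+ _.+1]exprSr; ring.
rewrite -e exprM.
have h : be * y ^+ n = be * al' ^+ n * ((al * y + ga * x ^+ m) *
    (\sum_(i < n) (al * y) ^+ (n.-1 - i) * (- ga * x ^+ m) ^+ i)) +
    be * al' ^+ n * (- ga) ^+ n * x ^+ m ^+ n.
  have -> : al * y + ga * x ^+ m = al * y - (- ga * x ^+ m) by rewrite mulNr opprK.
  rewrite -subrXX -[_ * (- ga) ^+ n * _]mulrA -exprMn -mulrDr subrK exprMn mulrA -[be * _ * _]mulrA.
  by rewrite -exprMn [al' * al]mulrC ala expr1n mulr1.
by rewrite h; ring.
Qed.

End CompletingTheProduct.

Lemma gen_image_ideal2 (A B : comPzRingType) (g : {rmorphism A -> B}) a b :
  gen_ideal (g @` ideal2 a b) = ideal2 (g a) (g b).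
Proof.
apply/seteqP; split.
  apply: gen_ideal_min; first exact: ideal2_ideal.
  by move=> _ [_ [i [j ->]] <-]; rewrite rmorphD !rmorphM; exact: ideal2_comb.
apply: ideal2_min; [exact: gen_idealP| |]; apply: sub_gen_ideal.
  by exists a => //; exact: ideal2_l.
by exists b => //; exact: ideal2_r.
Qed.

Lemma fps_unit_coef0 n (K : fieldType) (u v : fps n K) : u * v = 1 -> u 0%MM != 0.
Proof.
move=> /(congr1 (fun h : fps n K => h 0%MM)); rewrite fpsM0 fps1 eqxx => e.
by apply/eqP => u0; move/eqP: e; rewrite u0 mul0r eq_sym oner_eq0.
Qed.

Lemma inZp_complement (N' m k : nat) : (m + k)%N = N'.+1 -> - inZp m = inZp k :> 'I_N'.+1.
Proof.
move=> e; apply/eqP; rewrite eq_sym -addr_eq0 addrC -inZpD e; apply/eqP/val_inj.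
by rewrite /= modnn.
Qed.

Section TypeA.
Variables (K : fieldType) (p : 'I_4 -> K).
Hypothesis p0 : p != 0.
Notation A := (localP3 p).
Notation mm := (@maxideal A).
Notation vec3 a b c := (fun j : 'I_3 => nth 0 [:: a; b; c] j).
Variables (x y z al be ga : A) (m n N' : nat) (I : set A).
Hypothesis px : params (vec3 x y z).
Hypotheses (m0 : (0 < m)%N) (n1 : (1 < n)%N) (mnN : (m * n)%N = N'.+1).
Hypotheses (al_unit : ~ mm al) (be_unit : ~ mm be) (ga_unit : ~ mm ga).
Let f := al * (y * z) + be * y ^+ n + ga * (x ^+ m * z).
Hypothesis genI : gen_ideal I = principal f.
Notation T := (completion (@maxideal (quotring I))).
Notation t := (complete_germ I).

Let mmx : mm x. Proof. by have := px.1 (inord 0); rewrite inordK. Qed.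
Let mmy : mm y. Proof. by have := px.1 (inord 1); rewrite inordK. Qed.
Let mmz : mm z. Proof. by have := px.1 (inord 2); rewrite inordK. Qed.

(** By [complete_product], after division by the unit in front of x^(m n). *)
Lemma type_A_coordinates : exists X Y w w' al' : A,
  [/\ params (vec3 X Y x), gen_ideal I = principal (X * Y - x ^+ N'.+1),
      w' * w = 1, al' * al = 1 & X = w' * (al * y + ga * x ^+ m)].
Proof.
have [al' ala] := unit_of al_unit.
have ala' : al * al' = 1 by rewrite mulrC.
have [q1 [q2 e]] := complete_product be ga x y z ala' m0 n1.
set w := - (_ * _ * _) in e.
have w_unit : ~ mm w.
  have pr (a b : A) : ~ mm a -> ~ mm b -> ~ mm (a * b).
    move=> na nb /(mmP p0) h; have := h; rewrite rmorphM => /eqP; rewrite mulf_eq0.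
    by case/orP => /eqP /(mmP p0).
  have pw (a : A) k : ~ mm a -> ~ mm (a ^+ k).
    by move=> na; elim: k => [|k IH]; [rewrite expr0; exact: mm_proper | rewrite exprS; exact: pr].
  have ng a : ~ mm a -> ~ mm (- a).
    move=> na h; apply: na; rewrite -[a]opprK; exact: idealN (mm_ideal p0) h.
  have nal' : ~ mm al'.
    move=> h; apply: (@mm_proper A); rewrite -ala; exact: (@ideal_mulr _ mm _ _ (mm_ideal p0) h).
  by apply: (ng); apply: (pr); [apply: (pr) => //; exact: pw | apply: (pw); exact: (ng)].
have [w' ww] := unit_of w_unit.
pose X1 := al * y + ga * x ^+ m.
exists (w' * X1), (z + (q1 * y + q2 * x)), w, w', al'; split=> //.
- have [m1 mD mM] := mm_ideal p0.
  have mX : mm X1.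
    apply: (mD); first exact: (mM).
    by rewrite -(prednK m0) exprSr mulrA; exact: mM.
  split; first by apply: vec3_mm => //; [exact: mM | apply: (mD) => //; apply: (mD); exact: mM].
  move=> u /(px.2) hu; set L := lin _; move: hu.
  have idL : is_ideal L by exact: lin_ideal.
  have [l0 lD lM] := idL.
  have lx : L x by exact: lin3_2.
  have ly : L y.
    have -> : y = al' * (w * (w' * X1) - ga * x ^+ m.-1 * x).
      rewrite mulrA [w * w']mulrC ww mul1r -mulrA -exprSr (prednK m0) /X1 addrK.
      by rewrite mulrA ala mul1r.
    apply: (lM); apply: (ideal_sub (lin_ideal _)); last exact: lM.
    by apply: (lM); exact: lin3_0.
  apply: (lin3_ind idL lx ly).
  rewrite -[z](addrK (q1 * y + q2 * x)); apply: (ideal_sub (lin_ideal _)); first exact: lin3_1.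
  by apply: (lD); exact: lM.
- rewrite genI -mnN.
  have e' : w' * X1 * (z + (q1 * y + q2 * x)) - x ^+ (m * n) = w' * f.
    by rewrite /f e mulrBr !mulrA ww mul1r.
  rewrite e'; apply/seteqP; split=> _ [b ->].
    by exists (b * w); rewrite mulrA -[b * w * w']mulrA [w * w']mulrC ww mulr1.
  by exists (b * w'); rewrite mulrA.
Qed.

Let mmf : mm f.
Proof.
have [_ mD mM] := mm_ideal p0; apply: (mD); first apply: (mD).
- by apply: (mM); exact: mM.
- by rewrite -(prednK (ltnW n1)) exprSr mulrA; exact: mM.
- by apply: (mM); exact: mM.
Qed.

Notation E := (taylor p0 px).

(** The restriction to the x-axis, which is C_2; by [axis_ideal] its kernel is the
    ideal of C_2. *)
Let axis : {rmorphism fps 3 K -> fps 3 K} := restr (pred2 (inord 1) (inord 2)).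

Lemma axis_mono i j k : (0 < j)%N || (0 < k)%N -> axis (mono K (mnm3 i j k)) = 0.
Proof.
move=> jk; apply: restr_mono; apply/negP => /forallP h.
have := (h (inord 1), h (inord 2)); rewrite /= !mnmE23 !eqxx orbT /= => -[/eqP j0 /eqP k0].
by move: jk; rewrite j0 k0.
Qed.

Lemma axis_f : axis (E f) = 0.
Proof.
rewrite taylor_combination !rmorphD !rmorphM /= !axis_mono ?orbT ?(ltnW n1) //.
by rewrite !mul0r !addr0.
Qed.

Lemma axis_unit u v : u * v = 1 -> axis (E u) <> 0.
Proof.
move=> uv h; have : axis (E (u * v)) = 0 by rewrite !rmorphM /= h mul0r.
by rewrite uv !rmorph1 => /eqP; rewrite oner_eq0.
Qed.

Let th : {rmorphism fps 3 K -> T} := theta p0 px genI mmf.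
Let th_surj u : exists V, th V = u. Proof. exact: (theta_surj p0 px genI mmf). Qed.

Lemma th_axis V : th V = 0 -> axis V = 0.
Proof.
apply: theta_ker; last exact: axis_f.
by move=> k W Wk m' mk; rewrite /= /restr; case: ifP => // _; exact: Wk.
Qed.

Lemma th_param i : th (fps_of_mpoly 'X_i) = t (vec3 x y z i).
Proof. by rewrite -(taylor_param p0 px) /th /= theta_taylor. Qed.

Lemma axis_ideal V : axis V = 0 <-> ideal2 (t y) (t z) (th V).
Proof.
split=> [/restr2_eq0[W1 [W2 ->]]|].
  rewrite rmorphD !rmorphM /= !th_param !inordK //= ![_ * th _]mulrC; exact: ideal2_comb.
move=> [i [j e]]; have [V1 e1] := th_surj i; have [V2 e2] := th_surj j.
have : th (V - (V1 * fps_of_mpoly 'X_(inord 1) + V2 * fps_of_mpoly 'X_(inord 2))) = 0.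
  by rewrite rmorphB rmorphD !rmorphM /= !th_param !inordK //= e e1 e2 subrr.
move=> /th_axis; rewrite rmorphB rmorphD !rmorphM /= !restr_var ?mulr0 ?addr0 ?subr0 //=.
all: by rewrite eqxx ?orbT.
Qed.

(** It is the kernel of a morphism to an integral domain. *)
Lemma second_ideal_prime : prime_ideal (ideal2 (t y) (t z)).
Proof.
split; first exact: ideal2_ideal.
  rewrite -(rmorph1 th) -axis_ideal rmorph1 => /eqP; by rewrite oner_eq0.
move=> u v; have [U <-] := th_surj u; have [V <-] := th_surj v.
by rewrite -rmorphM -!axis_ideal rmorphM => /fps_mulf_eq0.
Qed.

Lemma second_ideal_proper w w' : w' * w = 1 ->
  ~ ideal2 (t y) (t z) (t (w' * (al * y + ga * x ^+ m))).
Proof.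
move=> ww; rewrite -[t (_ * _)](theta_taylor p0 px genI mmf) -[theta _ _ _ _ _]/(th _) -axis_ideal.
rewrite !rmorphM => /fps_mulf_eq0[|]; first exact: axis_unit ww.
rewrite !rmorphD !rmorphM /= taylor_y axis_mono // mulr0 add0r.
have [ga' gaE] := unit_of ga_unit.
case/fps_mulf_eq0; first by apply: axis_unit; rewrite mulrC; exact: gaE.
rewrite taylor_xm => /fpsP/(_ (mnm3 m 0 0)); rewrite /restr.
have -> : off (pred2 (inord 1) (inord 2)) (mnm3 m 0 0).
  by apply/forallP => j; apply/implyP => /orP[] /eqP ->; rewrite mnmE23.
by rewrite monoE eqxx => /eqP; rewrite oner_eq0.
Qed.

Theorem type_A_normal_form :
  (exists2 phi : {rmorphism T -> A_ring K N'}, bijective phi &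
    forall c : K, phi (t (cstP3 p c)) = quot_pi _ (fps_of_mpoly c%:MP)) /\
  exists2 phi : {additive Cl T -> 'I_N'.+1}, bijective phi &
    exists P1 P2 : height1 T,
      [/\ val P1 = gen_ideal (t @` ideal2 x y), val P2 = gen_ideal (t @` ideal2 y z),
          phi (prime_class P1) = inZp 1 & phi (prime_class P2) = inZp (m * n - m)].
Proof.
have [X [Y [w [w' [al' [px1 genI1 ww ala eX]]]]]] := type_A_coordinates.
set f1 := X * Y - _ in genI1.
have mmf1 : mm f1.
  have [_ _ mM] := mm_ideal p0; apply: (ideal_sub (mm_ideal p0)).
    by rewrite mulrC; apply: (mM); exact: (px1.1 ord0).
  by rewrite exprSr; exact: mM.
have Ef1 : taylor p0 px1 f1 = A_eq K N'.+1.
  rewrite A_eqE -(taylor_monomial p0 px1 1 1 0) -(taylor_monomial p0 px1 0 0 N'.+1) -rmorphB.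
  by rewrite !expr0 !expr1 !mulr1 mul1r.
pose th1 : {rmorphism fps 3 K -> T} := theta p0 px1 genI1 mmf1.
have th1E a : th1 (taylor p0 px1 a) = t a by exact: theta_taylor.
have surj1 : forall u, exists V, th1 V = u by exact: (theta_surj p0 px1 genI1 mmf1).
have N0 : (0 < N'.+1)%N by [].
pose tor : {rmorphism fps 3 K -> fps 2 K} := toric_morphism K N0.
have ker1 V : th1 V = 0 -> tor V = 0.
  apply: theta_ker; first by move=> k W Wk; exact: push_ordge.
  by rewrite Ef1 /= subst_A_eq.
have ker2 V : tor V = 0 -> th1 V = 0.
  by move=> /(subst_toric_ker N0)[W ->]; rewrite -Ef1; exact: theta_f0M.
pose psi : {rmorphism T -> fps 2 K} := factor_morphism surj1 ker1.
have psiE V : psi (th1 V) = tor V by exact: (factorE surj1 ker1 V).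
split.
  pose q : {rmorphism fps 3 K -> A_ring K N'} := quot_pi [set A_eq K N'.+1].
  have qk V : q V = 0 -> th1 V = 0.
    move=> /quot_pi_eq0 h; apply: ker2; move: h; apply: (@gen_ideal_min _ _ [set V | tor V = 0]).
      split=> [|a b ha hb|a b hb]; first exact: (rmorph0 tor).
        have {}ha : tor a = 0 := ha; have {}hb : tor b = 0 := hb.
        by apply: etrans (rmorphD tor a b) _; rewrite ha hb addr0.
      have {}hb : tor b = 0 := hb.
      by apply: etrans (rmorphM tor a b) _; rewrite hb mulr0.
    by move=> _ ->; exact: (subst_A_eq K N0).
  have kq V : th1 V = 0 -> q V = 0.
    move=> /ker1 /(subst_toric_ker N0)[W ->]; apply/quot_pi_eq0.
    have h : gen_ideal [set A_eq K N'.+1] (A_eq K N'.+1) by exact: sub_gen_ideal.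
    exact: (@ideal_mulr _ _ _ W (gen_idealP _) h).
  exists (factor_morphism surj1 kq).
    by apply: factor_bij => // c; have [V ->] := quot_ind c; exists V.
  move=> c; rewrite -th1E taylor_cst.
  exact: (factorE surj1 kq).
have psi_inj : injective psi by exact: factor_inj.
have psi_wt u : weighted (0 : 'I_N'.+1) (psi u).
  have [V <-] := surj1 u; rewrite psiE => k /subst_toric_support e.
  by rewrite /wt; apply/eqP; rewrite subr_eq0; apply/eqP/val_inj; exact: e.
have psi_surj r : weighted (0 : 'I_N'.+1) r -> exists u, psi u = r.
  move=> wr; have [|V <-] := subst_toric_image N0 (r := r); last by exists (th1 V).
  move=> k /wr /eqP; rewrite /wt subr_eq0 => /eqP /(congr1 val); exact.
have psi_mono i j k : psi (t (X ^+ i * Y ^+ j * x ^+ k)) =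
    mono K (mnm2 (N'.+1 * i + k) (N'.+1 * j + k)).
  by rewrite -th1E psiE (taylor_monomial p0 px1) -[tor _]/(subst_toric _ _) (subst_toric_mono K N0) toricE.
have psiX : psi (t X) = vs K ^+ N'.+1.
  by have := psi_mono 1%N 0%N 0%N; rewrite !expr0 expr1 !mulr1 muln1 muln0 !addn0 vsX.
have psix : psi (t x) = vs K * vt K.
  have := psi_mono 0%N 0%N 1%N; rewrite !expr0 expr1 !mul1r !muln0 !add0n => ->.
  by rewrite /vs /vt -monoD mnm2D.
have ye : y = al' * w * X - al' * ga * x ^+ m.
  rewrite eX -!mulrA [w * (w' * _)]mulrA [w * w']mulrC ww mul1r -mulrBr addrK.
  by rewrite mulrA ala mul1r.
exists (Cl_weight psi_inj psi_wt psi_surj psiX); first exact: Cl_weight_bij.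
have [J [vJ wJ]] : exists J : height1 T, val J = ideal2 (t y) (t z) /\
    Cl_weight psi_inj psi_wt psi_surj psiX (prime_class J) = - inZp m.
  have [ga' gaE] := unit_of ga_unit.
  (* From al y = w X - ga x^m and, on the surface, X z = - w' be y^n. *)
  apply: (second_class _ _ _ _ m0 n1 mnN psix (a := t (al' * w)) (c := t (al' * ga)) (b := t (- (w' * be)))).
  - by rewrite {1}ye rmorphB !rmorphM rmorphXn.
  - apply: (@fps_unit_coef0 _ _ _ (psi (t (al * ga')))).
    by rewrite -!rmorphM mulrACA ala [ga * ga']mulrC gaE mul1r !rmorph1.
  - have h : t (w' * f) = 0 by rewrite rmorphM /= (complete_germ_f0 genI) mulr0.
    apply/eqP; rewrite -subr_eq0 -h; apply/eqP.
    rewrite -!rmorphXn -!rmorphM -rmorphB; congr (t _).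
    rewrite eX /f; move: (x ^+ m) (y ^+ n) => xm yn.
    by rewrite mulNr opprK !mulrDr !mulrDl !mulrA addrAC.
  - exact: second_ideal_prime.
  - by rewrite eX; exact: second_ideal_proper ww.
exists (P_vs psi_inj psi_wt psi_surj psiX), J; split.
- rewrite gen_image_ideal2 /=; apply/seteqP; split=> [u|].
    have [V <-] := surj1 u => h0.
    have {h0} : fdvd (vs K) (psi (th1 V)) := h0; rewrite psiE => /vsP hV.
    (* The coefficient of Y^j in V is that of t^(N j) after the substitution. *)
    have : restr (pred2 (inord 0) (inord 2)) V = 0.
      apply/fpsP => k; rewrite /restr; case: ifPn => // /forallP h.
      have := (h (inord 0), h (inord 2)); rewrite /= !eqxx orbT /= => -[/eqP k0 /eqP k2].
      have := hV (N'.+1 * k (inord 1))%N; rewrite /= -[X in mnm2 X](muln0 N'.+1).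
      rewrite -[X in mnm2 X](addn0) -[X in mnm2 _ X]addn0 subst_toric_coef // /diag_sum.
      by rewrite div0n big_ord1 add0n addn0 subn0 (mnm3P k) k0 k2 mnmE23.
    move=> /restr2_eq0[W1 [W2 ->]]; rewrite rmorphD !rmorphM /=.
    have -> : fps_of_mpoly 'X_(inord 0) = taylor p0 px1 X by have := taylor_param p0 px1 (inord 0); rewrite inordK //= => ->.
    have -> : fps_of_mpoly 'X_(inord 2) = taylor p0 px1 x by have := taylor_param p0 px1 (inord 2); rewrite inordK //= => ->.
    have [_ ID IM] := ideal2_ideal (t x) (t y).
    rewrite !th1E ![_ * th1 _]mulrC; apply: (ID); apply: (IM); last exact: ideal2_l.
    rewrite eX rmorphM; apply: (IM); rewrite rmorphD !rmorphM; apply: (ID); apply: (IM); first exact: ideal2_r.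
    by rewrite rmorphXn -(prednK m0) exprSr; apply: (IM); exact: ideal2_l.
  apply: ideal2_min; [exact: contract_ideal | |].
    change (fdvd (vs K) (psi (t x))); rewrite psix; apply: fdvdMr; exact: fdvdxx.
  change (fdvd (vs K) (psi (t y))).
  have -> : psi (t y) = psi (t (al' * w)) * psi (t X) - psi (t (al' * ga)) * psi (t x) ^+ m.
    by rewrite {1}ye !rmorphB !rmorphM !rmorphXn.
  rewrite psiX psix.
  apply: fdvdB; apply: fdvdMl; first by rewrite exprS; apply: fdvdMr; exact: fdvdxx.
  by rewrite -(prednK m0) exprS -mulrA; apply: fdvdMr; exact: fdvdxx.
- by rewrite gen_image_ideal2 vJ.
- exact: Cl_weight_P_vs.
apply: etrans wJ _; apply: inZp_complement; rewrite -mnN subnKC // leq_pmulr //; exact: ltnW.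
Qed.

End TypeA.

(** * Linear systems of surfaces *)

Section FiniteDimension.
Variable K : fieldType.

(** Rows in W spanning a space of maximal dimension span W. *)
Lemma subspace_matrix M (W : set 'rV[K]_M) : W 0 ->
  (forall u v, W u -> W v -> W (u + v)) -> (forall c u, W u -> W (c *: u)) ->
  exists N (A : 'M[K]_(N, M)), row_free A /\ forall u, W u <-> (u <= A)%MS.
Proof.
move=> W0 WD WZ.
pose P k := `[< exists N (A : 'M[K]_(N, M)), (forall i, W (row i A)) /\ \rank A = k >].
have P0 : exists k, P k.
  by exists 0%N; apply/asboolP; exists 0%N, 0; split; [case | rewrite mxrank0].
have Pb k : P k -> (k <= M)%N by move=> /asboolP[N [A [_ <-]]]; exact: rank_leq_col.
case: (ex_maxnP P0 Pb) => k /asboolP[N [A [WA rA]]] maxk.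
exists (\rank A), (row_base A); split; first exact: row_base_free.
move=> u; rewrite eq_row_base; split=> [Wu|/submxP[v ->]].
  have : P (\rank (col_mx A u)).
    apply/asboolP; exists (N + 1)%N, (col_mx A u); split=> // i.
    rewrite -(splitK i); case: (fintype.split i) => j /=; rewrite ?rowKu ?rowKd //.
    by rewrite (_ : row j u = u) //; apply/rowP => l; rewrite mxE [j]ord1.
  move=> /maxk; rewrite -rA => le.
  have s : (A <= col_mx A u)%MS by rewrite -addsmxE addsmxSl.
  have h : (col_mx A u <= A)%MS by rewrite -(geq_leqif (mxrank_leqif_sup s)).
  by apply: submx_trans h; rewrite -addsmxE addsmxSr.
rewrite mulmx_sum_row; elim/big_ind: _ => // i _; exact: WZ.
Qed.

Lemma exists_basis (U : lmodType K) M (phi : {linear U -> 'rV[K]_M}) (V : set U) : V 0 ->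
  (forall u v, V u -> V v -> V (u + v)) -> (forall c u, V u -> V (c *: u)) ->
  (forall u, V u -> phi u = 0 -> u = 0) -> exists N (b : 'I_N -> U), is_basis V b.
Proof.
move=> V0 VD VZ inj.
have [||| N [A [fA WA]]] := @subspace_matrix M (phi @` V).
- by exists 0; rewrite ?linear0.
- by move=> _ _ [u Vu <-] [v Vv <-]; exists (u + v); [exact: VD | rewrite linearD].
- by move=> c _ [u Vu <-]; exists (c *: u); [exact: VZ | rewrite linearZ].
have [b hb] : exists b : 'I_N -> U, forall i, V (b i) /\ phi (b i) = row i A.
  have h i : exists u, V u /\ phi u = row i A.
    by have /(WA _)[u Vu e] := row_sub i A; exists u.
  by have [b hb] := choice h; exists b.
have phiE c : phi (lincomb b c) = (\row_i c i) *m A.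
  by rewrite mulmx_sum_row linear_sum; apply: eq_bigr => i _; rewrite linearZ /= (hb i).2 mxE.
have Vl c : V (lincomb b c).
  by rewrite /lincomb; elim/big_ind: _ => // i _; apply: VZ; exact: (hb i).1.
exists N, b; split=> // u Vu.
have /submxP[v ev] : (phi u <= A)%MS by apply/WA; exists u.
have ev' : v = \row_i v ord0 i by apply/rowP => i; rewrite mxE.
exists (fun i => v ord0 i); split.
  apply/eqP; rewrite -subr_eq0; apply/eqP; apply: inj.
    by rewrite -scaleN1r; apply: VD => //; exact: VZ.
  by rewrite linearB /= phiE -ev' -ev subrr.
move=> c ec; apply/funext => i.
have := ev; rewrite ec phiE => /(row_free_inj fA) /rowP /(_ i).
by rewrite mxE.
Qed.

End FiniteDimension.

Section Sections.
Variable K : fieldType.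
Notation S := {mpoly K[4]}.
Implicit Types (F G : S) (I : set S).

Section LinearSystem.
Variables (I : set S) (d : nat).
Hypothesis idI : is_ideal I.

Lemma sections_ideal F : F \is d.-homog -> I F -> sections I d F.
Proof. by move=> Fd IF; split=> // x G f x0 Gd Gx e; exists d, F, G. Qed.

Lemma sections0 : sections I d 0.
Proof. by apply: sections_ideal; [exact: rpred0 | case: idI]. Qed.

Lemma sectionsD F G : sections I d F -> sections I d G -> sections I d (F + G).
Proof.
move=> [Fd hF] [Gd hG]; split; first exact: rpredD.
move=> x H f x0 Hd Hx e.
have [f1 [_ _ _ e1]] := quot_mk Fd Hd Hx; have [f2 [_ _ _ e2]] := quot_mk Gd Hd Hx.
have -> : f = f1 + f2 by apply: lv_inj; rewrite lvD e e1 e2 tofracD mulrDl.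
have [_ SD _] := @stalk_ideal _ x I idI.
by apply: SD; [exact: hF e1 | exact: hG e2].
Qed.

Lemma sectionsZ c F : sections I d F -> sections I d (c *: F).
Proof.
move=> [Fd hF]; split; first exact: rpredZ.
move=> x H f x0 Hd Hx e.
have [f1 [_ _ _ e1]] := quot_mk Fd Hd Hx.
have -> : f = cstP3 x c * f1.
  by apply: lv_inj; rewrite lvM e e1 /= -mul_mpolyC tofracM mulrA.
have [_ _ SM] := @stalk_ideal _ x I idI.
by apply: SM; exact: hF e1.
Qed.

Lemma sections_basis : exists N (b : 'I_N -> S), is_basis (sections I d) b.
Proof.
pose M := #|{: 'X_{1..4 < d.+1}}|.
pose phi F : 'rV[K]_M := \row_i F@_(val (enum_val i)).
have lphi : linear phi by move=> c F G; apply/rowP => i; rewrite !mxE mcoeffD mcoeffZ.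
pose phi' := GRing.isLinear.Build _ _ _ _ phi lphi.
pose phiL : {linear S -> 'rV[K]_M} := HB.pack phi phi'.
apply: (@exists_basis _ _ M phiL); [exact: sections0 | exact: sectionsD | exact: sectionsZ |].
move=> F [Fd _] /rowP h; apply/mpolyP => k; rewrite mcoeff0.
have [kF|/memN_msupp_eq0 //] := boolP (k \in msupp F).
have kd : (mdeg k < d.+1)%N by have /dhomogP/(_ _ kF) := Fd; rewrite ltnS => ->.
by have := h (enum_rank (BMultinom kd)); rewrite !mxE enum_rankK.
Qed.

End LinearSystem.

Variable p : 'I_4 -> K.
Hypothesis p0 : p != 0.
Notation A := (localP3 p).
Notation mm := (@maxideal A).

(** The germ of a form, trivialised by the power of a coordinate not vanishing at p. *)
Definition germ F : A := peval (std_param p0) (dehom p0 F).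
HB.instance Definition _ := GRing.RMorphism.copy germ (peval (std_param p0) \o dehom p0).

Lemma germZ c F : germ (c *: F) = cstP3 p c * germ F.
Proof. by rewrite -mul_mpolyC rmorphM /= /germ dehomC pevalC. Qed.

Lemma i0_unit k : ('X_(i0 p0) ^+ k : S).@[p] != 0.
Proof. by rewrite rmorphXn /= mevalXU expf_neq0 // p_i0. Qed.

Lemma i0_homog k : ('X_(i0 p0) ^+ k : S) \is k.-homog.
Proof.
rewrite -[X in X.-homog]mul1n; apply: dhomogMn.
by rewrite dhomogX /= mdeg1.
Qed.

Lemma germ_i0 k : germ ('X_(i0 p0) ^+ k) = 1.
Proof. by rewrite rmorphXn /= /germ dehom_i0 rmorph1 expr1n. Qed.

Lemma germ_val d F : F \is d.-homog -> localP3_val (germ F) = tofrac F / tofrac ('X_(i0 p0) ^+ d).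
Proof. exact: homog_dehom. Qed.

Lemma germ_unit d G : G \is d.-homog -> G.@[p] != 0 -> ~ mm (germ G).
Proof.
move=> Gd Gp /(mmP p0); rewrite /lev /germ taylor0_peval => /eqP.
by apply/negP; rewrite -(dehom_unit p0 Gd).
Qed.

Lemma germ_quot d F G f : quot_of f d F G -> f * germ G = germ F.
Proof.
move=> [Fd Gd Gp e]; apply: lv_inj; rewrite lvM e (germ_val Fd) (germ_val Gd).
by rewrite mulrA divfK // (denom_neq0 Gp).
Qed.

Lemma stalk_hypersurface d F : F \is d.-homog ->
  gen_ideal (stalk p (hypersurface F)) = principal (germ F).
Proof.
move=> Fd; apply/seteqP; split.
  apply: gen_ideal_min; first exact: principal_ideal.
  move=> f [e [F' [G' [Fd' Gd' Gp' hF' ef]]]].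
  have [a ea] : exists a, F' = a * F.
    move: hF'; apply: (@gen_ideal_min _ [set F] [set H | exists a, H = a * F]).
      split=> [|_ _ [a ->] [b ->]|b _ [a ->]]; first by exists 0; rewrite mul0r.
        by exists (a + b); rewrite mulrDl.
      by exists (b * a); rewrite mulrA.
    by move=> _ ->; exists 1; rewrite mul1r.
  have [u uG] := unit_of (germ_unit Gd' Gp').
  have q : f * germ G' = germ F' by apply: (@germ_quot e F' G' f).
  have qa : germ F' = germ a * germ F by rewrite ea rmorphM.
  by exists (u * germ a); rewrite -mulrA -qa -q mulrCA uG mulr1.
have [_ _ gM] := gen_idealP (stalk p (hypersurface F)).
move=> _ [b ->]; apply: gM; apply: sub_gen_ideal; exists d, F, ('X_(i0 p0) ^+ d); split=> //.
- exact: i0_homog.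
- exact: i0_unit.
- exact: sub_gen_ideal.
- exact: germ_val.
Qed.

Lemma germ_section I d F : sections I d F -> stalk p I (germ F).
Proof.
by move=> [Fd hF]; apply: (hF p ('X_(i0 p0) ^+ d)) => //; [exact: i0_homog | exact: i0_unit | exact: germ_val].
Qed.

End Sections.

(** * The general surface containing the union *)

Section GeneralMember.
Variable K : fieldType.
Notation S := {mpoly K[4]}.

(** The product of the finitely many linear forms in the coordinates is a polynomial G
    which is nonzero where no one of them vanishes. *)
Lemma general_member_functionals (V : set S) (Q : S -> Prop) r (l : 'I_r -> S -> K) N (b : 'I_N -> S) :
  is_basis V b ->
  (forall j F G, l j (F + G) = l j F + l j G) -> (forall j c F, l j (c *: F) = c * l j F) ->
  (exists2 F, V F & F <> 0 /\ forall j, l j F != 0) ->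
  (forall F, V F -> (forall j, l j F != 0) -> Q F) -> general_member V Q.
Proof.
move=> [bV bu] lD lZ [F0 VF0 [F00 lF0]] VQ.
have l0 j : l j 0 = 0 by rewrite -(scale0r 0) lZ mul0r.
pose G : {mpoly K[N]} := \prod_j \sum_i l j (b i) *: 'X_i.
have GE c : G.@[c] = \prod_j l j (lincomb b c).
  rewrite rmorph_prod /=; apply: eq_bigr => j _; rewrite raddf_sum /=.
  rewrite /lincomb (big_morph (l j) (lD j) (l0 j)); apply: eq_bigr => i _.
  by rewrite mevalZ mevalXU lZ mulrC.
have GP c : G.@[c] != 0 -> forall j, l j (lincomb b c) != 0.
  by rewrite GE => /prodf_neq0 h j; exact: h.
exists N, b, (\sum_(j < r) 1)%N, G; split=> //.
- rewrite /G; apply: (big_rec2 (fun (e : nat) (P : {mpoly K[N]}) => P \is e.-homog)).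
    exact: dhomog1.
  move=> j e P _ Pe; apply: dhomogM => //; apply: rpred_sum => i _; apply: rpredZ.
  by rewrite dhomogX /= mdeg1.
- have [c [ec _]] := bu F0 VF0; exists c.
    by apply/eqP => c0; case: F00; rewrite ec c0 /lincomb big1 // => i _; rewrite scale0r.
  by rewrite GE -ec; apply/prodf_neq0 => j _.
- by move=> c _ Gc; apply: VQ; [exact: bV | exact: GP].
Qed.

End GeneralMember.

Section SingularSurface.
Variables (K : fieldType) (p : 'I_4 -> K).
Hypothesis p0 : p != 0.
Notation S := {mpoly K[4]}.
Notation A := (localP3 p).
Notation mm := (@maxideal A).
Notation vec3 a b c := (fun j : 'I_3 => nth 0 [:: a; b; c] j).

Lemma general_section (I C1 C2 : set S) (x y z : A) m n : is_ideal I ->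
  params (vec3 x y z) -> (0 < m)%N -> (1 < n)%N ->
  stalk p I = ideal2 y (x ^+ m) `&` ideal2 z (y ^+ n) ->
  stalk p C1 = ideal2 x y -> stalk p C2 = ideal2 y z ->
  exists d0 : nat, forall d : nat, (d0 <= d)%N ->
    general_member (sections I d) (fun F =>
      sing_type_A (hypersurface F) p (m * n).-1 /\
      class_group_is (hypersurface F) p C1 C2 (m * n) 1 (m * n - m)).
Proof.
move=> idI px m0 n1 eI e1 e2.
have Ih : stalk p I (1 * (y * z) + 1 * y ^+ n + 1 * (x ^+ m * z)).
  rewrite eI !mul1r; split.
    have [_ D M] := ideal2_ideal y (x ^+ m); apply: (D); first apply: (D).
    - by rewrite mulrC; exact: ideal2_Ml.
    - by rewrite -(prednK (ltnW n1)) exprSr; exact: ideal2_Ml.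
    - by rewrite mulrC; exact: ideal2_Mr.
  have [_ D M] := ideal2_ideal z (y ^+ n); apply: (D); first apply: (D).
  - exact: ideal2_Ml.
  - exact: ideal2_r.
  - exact: ideal2_Ml.
have [d0 [F0 [G0 [Fd0 Gd0 Gp0 IF0 eh]]]] := Ih.
set h := _ + _ + _ in Ih eh.
exists d0 => d dd.
have [N [b bb]] := sections_basis d idI.
(* The exponents of y z, y^n and x^m z. *)
pose mo (j : 'I_3) := nth (mnm3 m 0 1) [:: mnm3 0 1 1; mnm3 0 n 0] j.
pose l (j : 'I_3) (F : S) := taylor p0 px (germ p0 F) (mo j).
have lE F al be ga : germ p0 F = al * (y * z) + be * y ^+ n + ga * (x ^+ m * z) ->
    (forall j, l j F != 0) <-> [/\ lev p0 al != 0, lev p0 be != 0 & lev p0 ga != 0].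
  move=> eF; have h1 := coef_yz p0 px al be ga m0 n1; have h2 := coef_yn p0 px m n al be ga.
  have h3 := coef_xz p0 px m al be ga n1; rewrite -eF in h1 h2 h3.
  rewrite -h1 -h2 -h3; split=> [H|[H1 H2 H3] [[|[|[|//]]] j3]] //.
  by split; [exact: (H ord0) | have := H (inord 1) | have := H (inord 2)]; rewrite /l /mo ?inordK.
apply: (general_member_functionals (l := l) bb).
- by move=> j F G; rewrite /l !rmorphD.
- by move=> j c F; rewrite /l germZ rmorphM /= taylor_cst cstM.
- (* The germ y z + y^n + x^m z is a quotient of forms F0 / G0 with F0 in I.  So F0
     times a power of a coordinate is a section, with the value of G0 at the point
     for its three coefficients. *)
  exists (F0 * 'X_(i0 p0) ^+ (d - d0)).
    apply: sections_ideal => //; last by case: idI => _ _ IM; rewrite mulrC; exact: IM.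
    by rewrite -(subnKC dd); apply: dhomogM => //; rewrite addKn; exact: i0_homog.
  have gE : germ p0 (F0 * 'X_(i0 p0) ^+ (d - d0)) = h * germ p0 G0.
    by rewrite rmorphM /= germ_i0 mulr1 (@germ_quot _ _ p0 d0 F0 G0 h).
  have lne : forall j, l j (F0 * 'X_(i0 p0) ^+ (d - d0)) != 0.
    have gn : lev p0 (germ p0 G0) != 0.
      by apply/eqP => /(mmP p0); exact: germ_unit Gd0 Gp0.
    apply/(lE _ (germ p0 G0) (germ p0 G0) (germ p0 G0)) => //.
    by rewrite gE /h !mul1r !mulrDl ![_ * germ p0 G0]mulrC.
  split=> //; move=> e; have := lne ord0; rewrite e /l.
  by rewrite !rmorph0 eqxx.
move=> F VF lF.
have : ideal3 (y * z) (y ^+ n) (x ^+ m * z) (germ p0 F).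
  have := germ_section p0 VF; rewrite eI => -[].
  by apply: (monomial_inter p0 px); exact: ltnW.
move=> [al [be [ga eF]]].
have [u1 u2 u3] := proj1 (lE F al be ga eF) lF.
have un a : lev p0 a != 0 -> ~ mm a by move=> /eqP ne /(mmP p0).
have genF : gen_ideal (stalk p (hypersurface F)) = principal (al * (y * z) + be * y ^+ n + ga * (x ^+ m * z)).
  by rewrite -eF; apply: stalk_hypersurface; exact: VF.1.
have mn0 : (0 < m * n)%N by rewrite muln_gt0 m0 ltnW.
have [phiE clE] := type_A_normal_form p0 px m0 n1 (esym (prednK mn0)) (un _ u1) (un _ u2) (un _ u3) genF.
split; first exact: phiE.
by rewrite /class_group_is /complete_ideal e1 e2; exact: clE.
Qed.

End SingularSurface.

Theorem proposition3p6 (R : realType) (p : 'I_4 -> R[i])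
    (C1 C2 Z1 Z2 : set {mpoly R[i][4]}) (S1 S2 : set (localP3 p))
    (m n : nat) (q : option nat) :
  p != 0 ->
  smooth_curve C1 -> smooth_curve C2 ->
  on_scheme C1 p -> on_scheme C2 p ->
  tangent (stalk p C1) <> tangent (stalk p C2) ->
  smooth_surface_germ S1 -> smooth_surface_germ S2 ->
  S1 `<=` stalk p C1 -> S2 `<=` stalk p C2 ->
  (0 < m)%N -> (0 < n)%N ->
  multiplicity_structure C1 Z1 -> multiplicity_structure C2 Z2 ->
  cartier_multiple m S1 (stalk p C1) (stalk p Z1) ->
  cartier_multiple n S2 (stalk p C2) (stalk p Z2) ->
  transverse (stalk p C1) S2 ->
  tangency_order (stalk p C2) S1 q -> leq_inf 2 q ->
  has_dim (tangent (stalk p (Z1 `&` Z2))) 3 ->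
  leq_inf m q ->
  exists d0 : nat, forall d : nat, (d0 <= d)%N ->
    general_member (sections (Z1 `&` Z2) d) (fun F =>
      sing_type_A (hypersurface F) p (m * n).-1 /\
      class_group_is (hypersurface F) p C1 C2 (m * n) 1 (m * n - m)).
Proof.
move=> p0 [[idC1 _] reg1] [[idC2 _] reg2] pC1 pC2 _ s1 s2 _ _ m0 n0.
move=> [[idZ1 _] _] [[idZ2 _] _] cm1 cm2 tr tan q2 dim3 mq.
have iP1 := stalk_ideal p idC1; have iP2 := stalk_ideal p idC2.
have [x [y [z [px e1 e2 eZ1 eZ2]]]] := normal_form p0 iP1 iP2 (reg1 p p0 pC1) (reg2 p p0 pC2)
  s1 s2 cm1 cm2 m0 n0 tr tan q2 mq.
have eZ : stalk p (Z1 `&` Z2) = ideal2 y (x ^+ m) `&` ideal2 z (y ^+ n).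
  by rewrite stalkI // eZ1 eZ2.
have n1 : (1 < n)%N.
  rewrite ltn_neqAle n0 andbT; apply/eqP => n1; apply: (tangent_dim_lt3 p0 px _ dim3).
  by rewrite eZ -n1 expr1; split; [exact: ideal2_l | exact: ideal2_r].
apply: (general_section p0 _ px m0 n1 eZ e1 e2).
case: idZ1 => i0 iD iM; case: idZ2 => j0 jD jM; split=> [|a b [ha ha'] [hb hb']|a b [hb hb']].
- by split.
- by split; [exact: iD | exact: jD].
- by split; [exact: iM | exact: jM].
Qed.
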